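(* Let $\omega$ be a free ultrafilter on $\mathbb{N}$. The von Neumann algebra $\prod^\omega M_n(\mathbb{C})$ is not $\ast$-isomorphic to $\mathcal{R}^\omega$, the ultrapower algebra of the hyperfinite type ${\rm II}_1$ factor $\mathcal{R}$.
   Context: If $\mathcal{M}_n$ ($n\in\mathbb{N}$) are finite von Neumann algebras with faithful normal tracial states $\tau_n$, the ultraproduct $\prod^\omega\mathcal{M}_n$ is the quotient of the algebra $\prod_n\mathcal{M}_n$ of norm-bounded sequences $\{X_n\}$, $X_n\in\mathcal{M}_n$ (with pointwise operations), by the equivalence relation $\{X_n\}\sim\{Y_n\}$ iff $\lim_{n\to\omega}\|X_n-Y_n\|_2=0$, where $\|X\|_2=\tau_n(X^*X)^{1/2}$ for $X\in\mathcal{M}_n$. In $\prod^\omega M_n(\mathbb{C})$ the trace on $M_n(\mathbb{C})$ is the normalized trace $\tau_n=\frac{1}{n}\mathrm{Tr}$. The ultrapower $\mathcal{R}^\omega$ is the ultraproduct with $\mathcal{M}_n=\mathcal{R}$ for all $n$, with the unique tracial state of $\mathcal{R}$. *)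

(* Defs.v *)
From HB Require Import structures.
From mathcomp Require Import all_boot all_order all_algebra generic_quotient.
From mathcomp Require Import ring_quotient sesquilinear spectral complex.
From mathcomp Require Import ring lra.
From mathcomp Require Import boolp classical_sets functions reals.
From mathcomp Require Import topology normedtype sequences.

Set Implicit Arguments.
Unset Strict Implicit.
Unset Printing Implicit Defensive.

Import Order.TTheory GRing.Theory Num.Theory.
Import numFieldNormedType.Exports.
Local Open Scope classical_set_scope.
Local Open Scope ring_scope.
Local Open Scope complex_scope.
Local Open Scope quotient_scope.

Section ComplexAux.
Context (R : realType).
Implicit Types (x y : R) (a b : R[i]).

Lemma rcM x y : (x * y)%:C = x%:C * y%:C.
Proof. exact: (rmorphM (real_complex R)). Qed.

Lemma rcD x y : (x + y)%:C = x%:C + y%:C.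
Proof. exact: (rmorphD (real_complex R)). Qed.

Lemma rcX x n : (x ^+ n)%:C = x%:C ^+ n.
Proof. exact: (rmorphXn (real_complex R)). Qed.

Lemma Re_ge0 a : 0 <= a -> 0 <= complex.Re a.
Proof. by case: a => x y; rewrite lecE /= => /andP[]. Qed.

Lemma Re_ge0E a : 0 <= a -> a = (complex.Re a)%:C.
Proof. by case: a => x y; rewrite lecE /= => /andP[/eqP->]. Qed.

Lemma conjD_Re a : a + a^*%R = (2 * complex.Re a)%:C.
Proof.
by rewrite rcM -[a^*%R]/(a^*%C) addcJ -(rmorph_nat (real_complex R)).
Qed.

Lemma le_rc_Re a y : `|a| <= y%:C -> complex.Re a <= y.
Proof.
move=> h; rewrite -lecR (le_trans _ h) // (le_trans _ (normc_ge_Re _)) //.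
by rewrite lecR ler_norm.
Qed.

Lemma le_sqr_rc a y : 0 <= y -> `|a| ^+ 2 <= (y ^+ 2)%:C -> `|a| <= y%:C.
Proof.
move=> y0; rewrite rcX => h; have yC : 0 <= y%:C by rewrite ler0c.
by rewrite -(@ler_pXn2r _ 2) ?nnegrE.
Qed.

Lemma Re_normM a b : complex.Re `|a * b| = complex.Re `|a| * complex.Re `|b|.
Proof.
apply: complexI; rewrite rcM -!Re_ge0E //; exact: normrM.
Qed.

End ComplexAux.

Section HermitianNorm.
Context (R : realType) (U : lmodType R[i]) (dot : {dot U for Num.conj}).
Implicit Types (u v : U) (a : R[i]).

Definition hnorm u : R := Num.sqrt (complex.Re (dot u u)).

Lemma hnorm_ge0 u : 0 <= hnorm u. Proof. exact: sqrtr_ge0. Qed.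

Lemma dotE u : dot u u = (hnorm u ^+ 2)%:C.
Proof.
rewrite sqr_sqrtr; last exact/Re_ge0/dnorm_ge0.
exact/Re_ge0E/dnorm_ge0.
Qed.

Lemma dotC u v : dot u v = (dot v u)^*%R.
Proof. by rewrite hermC /= expr0 mul1r. Qed.

Lemma hnormZ a u : hnorm (a *: u) = complex.Re `|a| * hnorm u.
Proof.
have /Re_ge0E an : 0 <= `|a| by [].
apply/eqP; rewrite -(@eqrXn2 _ 2) ?hnorm_ge0 ?mulr_ge0 ?hnorm_ge0 ?Re_ge0 //.
apply/eqP/complexI; rewrite -dotE dnormZ dotE exprMn [in LHS]an.
by rewrite -rcX -rcM.
Qed.

Lemma cauchy_schwarz u v : `|dot u v| <= (hnorm u * hnorm v)%:C.
Proof.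
have [->|v0] := eqVneq v 0.
  by rewrite linear0r normr0 ler0c mulr_ge0 ?hnorm_ge0.
have vv0 : 0 < dot v v by rewrite dnorm_gt0.
apply: le_sqr_rc; first by rewrite mulr_ge0 ?hnorm_ge0.
rewrite exprMn rcM -!dotE.
have := dnorm_ge0 dot (dot v v *: u - dot u v *: v).
rewrite dnormB !dnormZ linearZl_LR/= linearZr_LR /= !rmorphM /= conjCK.
rewrite (geC0_conj (ltW vv0)) (ger0_norm (ltW vv0)).
have -> : dot v v ^+ 2 * dot u u + `|dot u v| ^+ 2 * dot v v -
  (dot v v * ((dot u v)^* * dot u v) + dot v v * (dot u v * (dot u v)^*)) =
  dot v v * (dot u u * dot v v - `|dot u v| ^+ 2).
  by rewrite normCK; ring.
by rewrite pmulr_rge0 // subr_ge0.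
Qed.

Lemma hnorm_eq0 u : hnorm u = 0 -> u = 0.
Proof. by move=> u0; apply/eqP; rewrite -(dnorm_eq0 dot) dotE u0 expr0n. Qed.

Lemma hnorm0 : hnorm 0 = 0.
Proof. by rewrite /hnorm linear0r sqrtr0. Qed.

Lemma hnormD u v : hnorm (u + v) <= hnorm u + hnorm v.
Proof.
rewrite -(@ler_pXn2r _ 2) ?nnegrE ?addr_ge0 ?hnorm_ge0 //.
rewrite -lecR -dotE dnormD !dotE conjD_Re -!rcD lecR sqrrD.
have := le_rc_Re (cauchy_schwarz u v); lra.
Qed.

Definition bounded_by (f : U -> U) (c : R) : Prop :=
  0 <= c /\ forall u, hnorm (f u) <= c * hnorm u.

Definition bounded_operator (f : U -> U) : Prop :=
  linear f /\ exists c, bounded_by f c.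

(* Equal to 0 by convention when f is unbounded. *)
Definition opnorm (f : U -> U) : R := inf [set c | bounded_by f c].

Lemma opnorm_ge0 f : 0 <= opnorm f.
Proof.
rewrite /opnorm.
have [->|/set0P f0] := eqVneq [set c | bounded_by f c] set0.
  by rewrite inf0.
by apply: lb_le_inf => // c [].
Qed.

Lemma opnorm_lb f c : bounded_by f c -> opnorm f <= c.
Proof. by move=> fc; apply: ge_inf => //; exists 0 => d []. Qed.

Lemma opnormP f u : (exists c, bounded_by f c) ->
  hnorm (f u) <= opnorm f * hnorm u.
Proof.
move=> [c fc]; have [u0|u0] := eqVneq (hnorm u) 0.
  by have := fc.2 u; rewrite u0 !mulr0.
have u_gt0 : 0 < hnorm u by rewrite lt_def u0 hnorm_ge0.
rewrite -ler_pdivrMr //; apply: lb_le_inf; first by exists c.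
by move=> d [d0 fd]; rewrite ler_pdivrMr.
Qed.

Lemma opnorm_bound f : (exists c, bounded_by f c) -> bounded_by f (opnorm f).
Proof. by move=> h; split=> [|u]; [exact: opnorm_ge0|exact: opnormP]. Qed.

Lemma bounded_byD f g c d :
  bounded_by f c -> bounded_by g d -> bounded_by (fun u => f u + g u) (c + d).
Proof.
move=> [c0 fc] [d0 gd]; split=> [|u]; first exact: addr_ge0.
by rewrite (le_trans (hnormD _ _)) // mulrDl lerD.
Qed.

Lemma bounded_byM f g c d :
  bounded_by f c -> bounded_by g d -> bounded_by (fun u => f (g u)) (c * d).
Proof.
move=> [c0 fc] [d0 gd]; split=> [|u]; first exact: mulr_ge0.
by rewrite (le_trans (fc _)) // -mulrA ler_wpM2l.
Qed.

Lemma bounded_byZ a f c :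
  bounded_by f c -> bounded_by (fun u => a *: f u) (complex.Re `|a| * c).
Proof.
move=> [c0 fc]; have a0 : 0 <= complex.Re `|a| by apply: Re_ge0.
split=> [|u]; first exact: mulr_ge0.
by rewrite hnormZ -mulrA ler_wpM2l.
Qed.

Lemma bounded_by1 : bounded_by id 1.
Proof. by split=> // u; rewrite mul1r. Qed.

Definition is_adjoint (f g : U -> U) : Prop :=
  forall u v, dot (f u) v = dot u (g v).

Lemma is_adjointC f g : is_adjoint f g -> is_adjoint g f.
Proof. by move=> fg u v; rewrite dotC -fg -dotC. Qed.

Lemma bounded_by_adjoint f g c :
  is_adjoint f g -> bounded_by f c -> bounded_by g c.
Proof.
move=> fg [c0 fc]; split=> // v.
have [->|gv0] := eqVneq (hnorm (g v)) 0; first by rewrite mulr_ge0 ?hnorm_ge0.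
have gv_gt0 : 0 < hnorm (g v) by rewrite lt_def gv0 hnorm_ge0.
rewrite -(ler_pM2l gv_gt0) -expr2.
have := cauchy_schwarz (f (g v)) v; rewrite fg dotE => /le_rc_Re /= h.
apply: (le_trans h); rewrite mulrCA mulrA.
by rewrite ler_wpM2r ?hnorm_ge0.
Qed.

Lemma adjoint_inj f g h : is_adjoint f g -> is_adjoint f h -> g = h.
Proof.
move=> fg fh; apply/funext => v; apply/eqP; rewrite -subr_eq0 -(dnorm_eq0 dot).
by rewrite linearBr /= -fg -fh subrr.
Qed.

Lemma opnormD f g : (exists c, bounded_by f c) -> (exists c, bounded_by g c) ->
  opnorm (fun u => f u + g u) <= opnorm f + opnorm g.
Proof.
by move=> hf hg; apply/opnorm_lb/bounded_byD; exact: opnorm_bound.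
Qed.

Lemma opnormM f g : (exists c, bounded_by f c) -> (exists c, bounded_by g c) ->
  opnorm (fun u => f (g u)) <= opnorm f * opnorm g.
Proof.
by move=> hf hg; apply/opnorm_lb/bounded_byM; exact: opnorm_bound.
Qed.

Lemma opnormZ a f : (exists c, bounded_by f c) ->
  opnorm (fun u => a *: f u) = complex.Re `|a| * opnorm f.
Proof.
have le b g : (exists c, bounded_by g c) ->
    opnorm (fun u => b *: g u) <= complex.Re `|b| * opnorm g.
  by move=> hg; apply/opnorm_lb/bounded_byZ; exact: opnorm_bound.
move=> hf; apply: le_anti; apply/andP; split; first exact: le.
have [->|a0] := eqVneq a 0; first by rewrite normr0 mul0r opnorm_ge0.
have haf : exists c, bounded_by (fun u => a *: f u) c.
  by have [c fc] := hf; exists (complex.Re `|a| * c); exact: bounded_byZ.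
have := le a^-1 _ haf.
rewrite (_ : (fun u => _) = f); last first.
  by apply/funext => u; rewrite scalerA mulVf // scale1r.
have a_ge0 : 0 <= complex.Re `|a| by exact: Re_ge0.
move/(ler_wpM2l a_ge0) => /le_trans; apply.
by rewrite mulrA -Re_normM mulfV // normr1 mul1r.
Qed.

Lemma opnorm1 u : u != 0 -> opnorm id = 1.
Proof.
move=> u0; apply: le_anti; apply/andP; split.
  exact/opnorm_lb/bounded_by1.
have u_gt0 : 0 < hnorm u.
  by rewrite lt_def hnorm_ge0 andbT; apply: contra u0 => /eqP/hnorm_eq0 ->.
rewrite -(ler_pM2r u_gt0) mul1r; apply: (@opnormP id).
by exists 1; exact: bounded_by1.
Qed.

Lemma opnorm_eq0 f : (exists c, bounded_by f c) -> opnorm f = 0 -> f = 0.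
Proof.
move=> hf f0; apply/funext => u; apply/hnorm_eq0/eqP.
by rewrite eq_le hnorm_ge0 andbT (le_trans (opnormP u hf)) // f0 mul0r.
Qed.

Lemma opnorm_adjoint f g :
  is_adjoint f g -> (exists c, bounded_by f c) -> opnorm g = opnorm f.
Proof.
move=> fg hf; have fb := opnorm_bound hf.
have gb := bounded_by_adjoint fg fb.
apply: le_anti; apply/andP; split; first exact: opnorm_lb gb.
apply: opnorm_lb; apply: bounded_by_adjoint (is_adjointC fg) _.
by apply: opnorm_bound; exists (opnorm f).
Qed.

End HermitianNorm.

HB.mixin Record isStarAlgebra (R : realType) A of GRing.Algebra R[i] A := {
  star : A -> A;
  starK : involutive star;
  starD : {morph star : x y / x + y};
  starM : forall x y, star (x * y) = star y * star x;
  starZ : forall (a : R[i]) x, star (a *: x) = a^*%R *: star x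
}.

#[short(type="starAlgType")]
HB.structure Definition StarAlgebra (R : realType) :=
  {A of isStarAlgebra R A & GRing.Algebra R[i] A}.

(* The part of the structure of a tracial von Neumann algebra that the tracial
   ultraproduct depends on: the operator norm (for norm-bounded sequences) and
   the faithful trace (for the 2-norm), with |xy|_2 <= |x| |y|_2. *)
HB.mixin Record isTracialAlgebra (R : realType) A of StarAlgebra R A := {
  anorm : A -> R;
  anorm_eq0 : forall x, anorm x = 0 -> x = 0;
  anorm1 : anorm 1 = 1;
  anormD : forall x y, anorm (x + y) <= anorm x + anorm y;
  anormZ : forall (a : R[i]) x, anorm (a *: x) = complex.Re `|a| * anorm x;
  anormM : forall x y, anorm (x * y) <= anorm x * anorm y;
  anorm_star : forall x, anorm (star x) = anorm x;
  trace : A -> R[i];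
  trace_linear : scalar trace;
  trace1 : trace 1 = 1;
  traceC : forall x y, trace (x * y) = trace (y * x);
  trace_ge0 : forall x, 0 <= trace (star x * x);
  trace_faithful : forall x, trace (star x * x) = 0 -> x = 0;
  trace_bound : forall x y, trace (star (x * y) * (x * y)) <=
    (anorm x ^+ 2)%:C * trace (star y * y)
}.

#[short(type="tracialAlgType")]
HB.structure Definition TracialAlgebra (R : realType) :=
  {A of isTracialAlgebra R A & StarAlgebra R A}.

Definition star_isomorphic (R : realType) (A B : starAlgType R) : Prop :=
  exists f : {lrmorphism A -> B},
    bijective f /\ forall x, f (star x) = star (f x).

Section TwoNorm.
Context (R : realType) (A : tracialAlgType R).
Implicit Types (x y : A) (a : R[i]).

Definition norm2 x : R := Num.sqrt (complex.Re (trace (star x * x))).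

Lemma norm2_ge0 x : 0 <= norm2 x. Proof. exact: sqrtr_ge0. Qed.

Lemma norm2E x : trace (star x * x) = (norm2 x ^+ 2)%:C.
Proof.
rewrite sqr_sqrtr; last exact/Re_ge0/trace_ge0.
exact/Re_ge0E/trace_ge0.
Qed.

Lemma traceD x y : trace (x + y) = trace x + trace y.
Proof. by have := trace_linear 1 x y; rewrite scale1r mul1r. Qed.

Lemma trace0 : trace (0 : A) = 0.
Proof. by apply: (addrI (trace (0 : A))); rewrite -traceD !addr0. Qed.

Lemma traceZ a x : trace (a *: x) = a * trace x.
Proof. by have := trace_linear a x 0; rewrite trace0 !addr0. Qed.

Lemma traceN x : trace (- x) = - trace x.
Proof. by rewrite -scaleN1r traceZ mulN1r. Qed.

Lemma star0 : star (0 : A) = 0.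
Proof. by apply: (addrI (star (0 : A))); rewrite -starD !addr0. Qed.

Lemma starN x : star (- x) = - star x.
Proof. by rewrite -scaleN1r starZ rmorphN1 scaleN1r. Qed.

Lemma star1 : star (1 : A) = 1.
Proof. by rewrite -[LHS]mulr1 -[X in _ * X]starK -starM mulr1 starK. Qed.

Lemma norm2_star x : norm2 (star x) = norm2 x.
Proof. by rewrite /norm2 starK traceC. Qed.

Lemma norm2_1 : norm2 (1 : A) = 1.
Proof. by rewrite /norm2 star1 mulr1 trace1 sqrtr1. Qed.

Lemma norm2_0 : norm2 (0 : A) = 0.
Proof. by rewrite /norm2 mulr0 trace0 sqrtr0. Qed.

Lemma norm2Z a x : norm2 (a *: x) = complex.Re `|a| * norm2 x.
Proof.
have /Re_ge0E an : 0 <= `|a| by [].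
apply/eqP; rewrite -(@eqrXn2 _ 2) ?norm2_ge0 ?mulr_ge0 ?norm2_ge0 ?Re_ge0 //.
apply/eqP/complexI; rewrite -norm2E starZ -scalerAl -scalerAr !traceZ norm2E.
by rewrite mulrA [_^* * _]mulrC -normCK an -rcX -rcM exprMn.
Qed.

Lemma norm2N x : norm2 (- x) = norm2 x.
Proof. by rewrite /norm2 starN mulrNN. Qed.

Lemma anorm_ge0 x : 0 <= anorm x.
Proof.
have := anormD x (- x); rewrite subrr -scaleN1r anormZ normrN1 mul1r.
have -> : anorm (0 : A) = 0.
  by rewrite -[0](scale0r 1) anormZ normr0 mul0r.
by lra.
Qed.

Lemma norm2M_le x y : norm2 (x * y) <= anorm x * norm2 y.
Proof.
rewrite -(@ler_pXn2r _ 2) ?nnegrE ?norm2_ge0 ?mulr_ge0 ?anorm_ge0 ?norm2_ge0 //.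
by have := trace_bound x y; rewrite !norm2E -rcM lecR exprMn.
Qed.

Lemma norm2M_ler x y : norm2 (x * y) <= norm2 x * anorm y.
Proof.
by rewrite -norm2_star starM (le_trans (norm2M_le _ _)) // norm2_star anorm_star
  mulrC.
Qed.

(* The sharp bound is without the factor 2, which does not matter here. *)
Lemma norm2D_le x y : norm2 (x + y) <= 2 * (norm2 x + norm2 y).
Proof.
have h z := norm2_ge0 z.
rewrite -(@ler_pXn2r _ 2) ?nnegrE ?mulr_ge0 ?addr_ge0 //.
have par : norm2 (x + y) ^+ 2 + norm2 (x - y) ^+ 2 =
    2 * norm2 x ^+ 2 + 2 * norm2 y ^+ 2.
  apply: complexI; rewrite 2!rcD 2!rcM -!norm2E !starD starN.
  rewrite !mulrDl !mulrDr !mulNr !mulrN opprK !traceD.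
  rewrite !traceN (_ : 2%:C = 2%:R); last exact: (rmorph_nat (real_complex R)).
  ring.
have := h x; have := h y; have := sqr_ge0 (norm2 (x - y)); nra.
Qed.

End TwoNorm.

Section BoundedSequences.
Context (R : realType) (A : nat -> tracialAlgType R).

Record bounded_seq := BoundedSeq {
  bseq :> forall n, A n;
  bseqP : exists c : R, forall n, anorm (bseq n) <= c
}.
Implicit Types (X Y Z : bounded_seq) (a : R[i]).

HB.instance Definition _ := gen_eqMixin bounded_seq.
HB.instance Definition _ := gen_choiceMixin bounded_seq.

Lemma bseq_inj X Y : (forall n, X n = Y n) -> X = Y.
Proof.
case: X Y => [X hX] [Y hY] /= XY.
have E : X = Y by apply: functional_extensionality_dep.
by case: _ / E hY => hY; congr BoundedSeq; exact: Prop_irrelevance.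
Qed.

Fact bseq0P : exists c : R, forall n, anorm (0 : A n) <= c.
Proof. by exists 0 => n; rewrite -(scale0r 1) anormZ normr0 mul0r. Qed.

Fact bseq1P : exists c : R, forall n, anorm (1 : A n) <= c.
Proof. by exists 1 => n; rewrite anorm1. Qed.

Fact bseqDP X Y : exists c : R, forall n, anorm (X n + Y n) <= c.
Proof.
have [[c hc] [d hd]] := (bseqP X, bseqP Y).
by exists (c + d) => n; rewrite (le_trans (anormD _ _)) // lerD.
Qed.

Fact bseqZP a X : exists c : R, forall n, anorm (a *: X n) <= c.
Proof.
have [c hc] := bseqP X; exists (complex.Re `|a| * c) => n.
by rewrite anormZ ler_wpM2l // Re_ge0.
Qed.

Fact bseqNP X : exists c : R, forall n, anorm (- X n) <= c.
Proof.
by have [c hc] := bseqZP (-1) X; exists c => n; rewrite -scaleN1r.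
Qed.

Fact bseqMP X Y : exists c : R, forall n, anorm (X n * Y n) <= c.
Proof.
have [[c hc] [d hd]] := (bseqP X, bseqP Y).
by exists (c * d) => n; rewrite (le_trans (anormM _ _)) // ler_pM ?anorm_ge0.
Qed.

Fact bseq_starP X : exists c : R, forall n, anorm (star (X n)) <= c.
Proof. by have [c hc] := bseqP X; exists c => n; rewrite anorm_star. Qed.

Fact bseq_addA : associative (fun X Y => BoundedSeq (bseqDP X Y)).
Proof. by move=> X Y Z; apply: bseq_inj => n /=; rewrite addrA. Qed.

Fact bseq_addC : commutative (fun X Y => BoundedSeq (bseqDP X Y)).
Proof. by move=> X Y; apply: bseq_inj => n /=; rewrite addrC. Qed.

Fact bseq_add0 :
  left_id (BoundedSeq bseq0P) (fun X Y => BoundedSeq (bseqDP X Y)).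
Proof. by move=> X; apply: bseq_inj => n /=; rewrite add0r. Qed.

Fact bseq_addN : left_inverse (BoundedSeq bseq0P)
  (fun X => BoundedSeq (bseqNP X)) (fun X Y => BoundedSeq (bseqDP X Y)).
Proof. by move=> X; apply: bseq_inj => n /=; rewrite addNr. Qed.

HB.instance Definition _ := GRing.isZmodule.Build bounded_seq
  bseq_addA bseq_addC bseq_add0 bseq_addN.

Fact bseq_mulA : associative (fun X Y => BoundedSeq (bseqMP X Y)).
Proof. by move=> X Y Z; apply: bseq_inj => n /=; rewrite mulrA. Qed.

Fact bseq_mul1 :
  left_id (BoundedSeq bseq1P) (fun X Y => BoundedSeq (bseqMP X Y)).
Proof. by move=> X; apply: bseq_inj => n /=; rewrite mul1r. Qed.

Fact bseq_mulr1 :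
  right_id (BoundedSeq bseq1P) (fun X Y => BoundedSeq (bseqMP X Y)).
Proof. by move=> X; apply: bseq_inj => n /=; rewrite mulr1. Qed.

Fact bseq_mulDl :
  left_distributive (fun X Y => BoundedSeq (bseqMP X Y)) +%R.
Proof. by move=> X Y Z; apply: bseq_inj => n /=; rewrite mulrDl. Qed.

Fact bseq_mulDr :
  right_distributive (fun X Y => BoundedSeq (bseqMP X Y)) +%R.
Proof. by move=> X Y Z; apply: bseq_inj => n /=; rewrite mulrDr. Qed.

Fact bseq_1neq0 : BoundedSeq bseq1P != 0.
Proof.
apply/eqP => /(congr1 (fun X : bounded_seq => X 0%N)) /= /eqP.
by rewrite oner_eq0.
Qed.

HB.instance Definition _ := GRing.Zmodule_isNzRing.Build bounded_seq
  bseq_mulA bseq_mul1 bseq_mulr1 bseq_mulDl bseq_mulDr bseq_1neq0.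

Definition bseq_scale a X := BoundedSeq (bseqZP a X).

Fact bseq_scaleA a b X : bseq_scale a (bseq_scale b X) = bseq_scale (a * b) X.
Proof. by apply: bseq_inj => n /=; rewrite scalerA. Qed.

Fact bseq_scale1 : left_id 1 bseq_scale.
Proof. by move=> X; apply: bseq_inj => n /=; rewrite scale1r. Qed.

Fact bseq_scaleDr : right_distributive bseq_scale +%R.
Proof. by move=> a X Y; apply: bseq_inj => n /=; rewrite scalerDr. Qed.

Fact bseq_scaleDl X : {morph bseq_scale^~ X : a b / a + b}.
Proof. by move=> a b; apply: bseq_inj => n /=; rewrite scalerDl. Qed.

HB.instance Definition _ := GRing.Zmodule_isLmodule.Build R[i] bounded_seq
  bseq_scaleA bseq_scale1 bseq_scaleDr bseq_scaleDl.

Fact bseq_scaleAl a X Y : a *: (X * Y) = (a *: X) * Y.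
Proof. by apply: bseq_inj => n /=; rewrite scalerAl. Qed.

Fact bseq_scaleAr a X Y : a *: (X * Y) = X * (a *: Y).
Proof. by apply: bseq_inj => n /=; rewrite scalerAr. Qed.

HB.instance Definition _ :=
  GRing.Lmodule_isLalgebra.Build R[i] bounded_seq bseq_scaleAl.
HB.instance Definition _ :=
  GRing.Lalgebra_isAlgebra.Build R[i] bounded_seq bseq_scaleAr.

Definition bseq_star X := BoundedSeq (bseq_starP X).

Fact bseq_starK : involutive bseq_star.
Proof. by move=> X; apply: bseq_inj => n /=; rewrite starK. Qed.

Fact bseq_starD : {morph bseq_star : X Y / X + Y}.
Proof. by move=> X Y; apply: bseq_inj => n /=; rewrite starD. Qed.

Fact bseq_starM X Y : bseq_star (X * Y) = bseq_star Y * bseq_star X.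
Proof. by apply: bseq_inj => n /=; rewrite starM. Qed.

Fact bseq_starZ a X : bseq_star (a *: X) = a^*%R *: bseq_star X.
Proof. by apply: bseq_inj => n /=; rewrite starZ. Qed.

HB.instance Definition _ := isStarAlgebra.Build R bounded_seq
  bseq_starK bseq_starD bseq_starM bseq_starZ.

End BoundedSequences.

Record free_ultrafilter := FreeUltrafilter {
  ultrafilter_sets :> set_system nat;
  ultrafilter_ultra : UltraFilter ultrafilter_sets;
  ultrafilter_free : \bigcap_(E in ultrafilter_sets) E = set0
}.
#[global] Existing Instance ultrafilter_ultra.

Section Ultraproduct.
Context (R : realType) (omega : free_ultrafilter).
Context (A : nat -> tracialAlgType R).
Implicit Types (X Y Z : bounded_seq A) (a : R[i]).

Definition null_seq : {pred bounded_seq A} :=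
  fun X => `[< norm2 (X n) @[n --> ultrafilter_sets omega] --> (0 : R) >].

Lemma null_le X (f : nat -> R) :
  (forall n, norm2 (X n) <= f n) ->
  f @ ultrafilter_sets omega --> (0 : R) -> X \in null_seq.
Proof.
move=> Xf f0; apply/asboolP; apply: (@squeeze_cvgr _ _ _ _ (cst 0) f) => //.
- by near=> n; rewrite norm2_ge0 Xf.
- exact: cvg_cst.
Unshelve. all: by end_near. Qed.

Lemma nullP X :
  reflect (norm2 (X n) @[n --> ultrafilter_sets omega] --> (0 : R))
          (X \in null_seq).
Proof. exact: asboolP. Qed.

Fact null_seq_zmod_closed : zmod_closed null_seq.
Proof.
split=> [|X Y /nullP X0 /nullP Y0].
  by apply: (@null_le _ (cst 0)) => [n|]; [rewrite norm2_0|exact: cvg_cst].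
apply: (@null_le _ (fun n => 2 * (norm2 (X n) + norm2 (Y n)))) => [n|].
  by rewrite (le_trans (norm2D_le _ _)) // norm2N.
by rewrite -[0](mulr0 2) -[X in _ * X](addr0 0); apply: cvgMr; apply: cvgD.
Qed.

HB.instance Definition _ :=
  GRing.isZmodClosed.Build (bounded_seq A) null_seq null_seq_zmod_closed.

Lemma null_mull X Y : Y \in null_seq -> X * Y \in null_seq.
Proof.
move=> /nullP Y0; have [c hc] := bseqP X.
apply: (@null_le _ (fun n => c * norm2 (Y n))) => [n|].
  by rewrite (le_trans (norm2M_le _ _)) // ler_wpM2r ?norm2_ge0.
by rewrite -[0](mulr0 c); exact: cvgMr.
Qed.

Lemma null_mulr X Y : X \in null_seq -> X * Y \in null_seq.
Proof.
move=> /nullP X0; have [c hc] := bseqP Y.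
apply: (@null_le _ (fun n => c * norm2 (X n))) => [n|].
  by rewrite (le_trans (norm2M_ler _ _)) // mulrC ler_wpM2r ?norm2_ge0.
by rewrite -[0](mulr0 c); exact: cvgMr.
Qed.

Lemma null_scale a X : X \in null_seq -> a *: X \in null_seq.
Proof. by move=> X0; rewrite -[X]mul1r scalerAl null_mull. Qed.

Lemma null_star X : X \in null_seq -> star X \in null_seq.
Proof.
move=> /nullP X0; apply: (@null_le _ (fun n => norm2 (X n))) => // n.
by rewrite norm2_star.
Qed.

Lemma one_not_null : (1 : bounded_seq A) \notin null_seq.
Proof.
apply/negP => /nullP.
rewrite (_ : (fun n => _) = cst (1 : R)); last first.
  by apply/funext => n; rewrite /= norm2_1.
have h1 : cst (1 : R) n @[n --> ultrafilter_sets omega] --> (1 : R).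
  exact: cvg_cst.
move=> h0; have E : 0 = 1 :> R by apply: cvg_unique h0 h1.
by have := @oner_neq0 R; rewrite -E eqxx.
Qed.

(* Two bounded sequences are identified iff the 2-norm of their difference
   tends to 0 along omega: see upi_eq below. *)
Definition ultraproduct := @Quotient.quot (bounded_seq A) null_seq.

HB.instance Definition _ := GRing.Zmodule.on ultraproduct.
HB.instance Definition _ := EqQuotient.on ultraproduct.

Definition upi X : ultraproduct := \pi_ultraproduct X.

Lemma upi_eq X Y :
  upi X = upi Y <->
  norm2 (X n - Y n) @[n --> ultrafilter_sets omega] --> (0 : R).
Proof.
split=> [/eqP|h]; first by rewrite -Quotient.idealrBE => /nullP.
by apply/eqP; rewrite -Quotient.idealrBE; apply/nullP.
Qed.

Lemma upi_null X Y : X - Y \in null_seq -> upi X = upi Y.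
Proof. by move=> h; apply/upi_eq/(nullP (X - Y)). Qed.

Lemma upi_repr (x : ultraproduct) : upi (repr x) = x.
Proof. exact: reprK. Qed.

Lemma repr_upi X : repr (upi X) - X \in null_seq.
Proof. by apply/nullP/upi_eq; rewrite upi_repr. Qed.

Lemma upiD X Y : upi (X + Y) = upi X + upi Y.
Proof. exact: Quotient.pi_add. Qed.

Definition up_one := upi 1.
Definition up_mul (x y : ultraproduct) := upi (repr x * repr y).
Definition up_scale a (x : ultraproduct) := upi (a *: repr x).
Definition up_star (x : ultraproduct) := upi (star (repr x)).

Lemma upiM X Y : up_mul (upi X) (upi Y) = upi (X * Y).
Proof.
apply: upi_null; rewrite -[_ - _](subrKA (X * repr (upi Y))) rpredD //.
  by rewrite -mulrBl null_mulr ?repr_upi.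
by rewrite -mulrBr null_mull ?repr_upi.
Qed.

Lemma upiZ a X : up_scale a (upi X) = upi (a *: X).
Proof. by apply: upi_null; rewrite -scalerBr null_scale ?repr_upi. Qed.

Lemma upi_star X : up_star (upi X) = upi (star X).
Proof.
apply: upi_null; rewrite -scaleN1r -[-1](rmorphN1 (@Num.conj R[i])) -starZ.
by rewrite -starD null_star // scaleN1r repr_upi.
Qed.

Lemma upP (P : ultraproduct -> Prop) : (forall X, P (upi X)) -> forall x, P x.
Proof. by move=> h x; rewrite -(upi_repr x). Qed.

Fact up_mulA : associative up_mul.
Proof.
by elim/upP => X; elim/upP => Y; elim/upP => Z; rewrite !upiM mulrA.
Qed.

Fact up_mul1 : left_id up_one up_mul.
Proof. by elim/upP => X; rewrite upiM mul1r. Qed.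

Fact up_mulr1 : right_id up_one up_mul.
Proof. by elim/upP => X; rewrite upiM mulr1. Qed.

Fact up_mulDl : left_distributive up_mul +%R.
Proof.
elim/upP => X; elim/upP => Y; elim/upP => Z.
by rewrite -upiD !upiM mulrDl upiD.
Qed.

Fact up_mulDr : right_distributive up_mul +%R.
Proof.
elim/upP => X; elim/upP => Y; elim/upP => Z.
by rewrite -upiD !upiM mulrDr upiD.
Qed.

Fact up_1neq0 : up_one != 0.
Proof.
have upi0 : upi 0 = 0 by apply: (addrI (upi 0)); rewrite -upiD !addr0.
apply: contra one_not_null => h; rewrite -[1]subr0 Quotient.idealrBE.
by apply/eqP; rewrite -[RHS]/(upi 0) upi0; exact/eqP.
Qed.

HB.instance Definition _ := GRing.Zmodule_isNzRing.Build ultraproduct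
  up_mulA up_mul1 up_mulr1 up_mulDl up_mulDr up_1neq0.

Fact up_scaleA a b x : up_scale a (up_scale b x) = up_scale (a * b) x.
Proof. by elim/upP: x => X; rewrite !upiZ scalerA. Qed.

Fact up_scale1 : left_id 1 up_scale.
Proof. by elim/upP => X; rewrite upiZ scale1r. Qed.

Fact up_scaleDr : right_distributive up_scale +%R.
Proof.
by move=> a; elim/upP => X; elim/upP => Y; rewrite -upiD !upiZ scalerDr upiD.
Qed.

Fact up_scaleDl x : {morph up_scale^~ x : a b / a + b}.
Proof. by elim/upP: x => X a b; rewrite !upiZ scalerDl upiD. Qed.

HB.instance Definition _ := GRing.Zmodule_isLmodule.Build R[i] ultraproduct
  up_scaleA up_scale1 up_scaleDr up_scaleDl.

Fact up_scaleAl a (x y : ultraproduct) : a *: (x * y) = (a *: x) * y.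
Proof.
elim/upP: x => X; elim/upP: y => Y.
by rewrite /GRing.scale /GRing.mul /= !(upiM, upiZ) scalerAl.
Qed.

Fact up_scaleAr a (x y : ultraproduct) : a *: (x * y) = x * (a *: y).
Proof.
elim/upP: x => X; elim/upP: y => Y.
by rewrite /GRing.scale /GRing.mul /= !(upiM, upiZ) scalerAr.
Qed.

HB.instance Definition _ :=
  GRing.Lmodule_isLalgebra.Build R[i] ultraproduct up_scaleAl.
HB.instance Definition _ :=
  GRing.Lalgebra_isAlgebra.Build R[i] ultraproduct up_scaleAr.

Fact up_starK : involutive up_star.
Proof. by elim/upP => X; rewrite !upi_star starK. Qed.

Fact up_starD : {morph up_star : x y / x + y}.
Proof.
by elim/upP => X; elim/upP => Y; rewrite -upiD !upi_star starD upiD.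
Qed.

Fact up_starM (x y : ultraproduct) :
  up_star (x * y) = up_star y * up_star x.
Proof.
elim/upP: x => X; elim/upP: y => Y.
by rewrite /GRing.mul /= upiM !upi_star upiM starM.
Qed.

Fact up_starZ a (x : ultraproduct) :
  up_star (a *: x) = a^*%R *: up_star x.
Proof.
elim/upP: x => X.
by rewrite /GRing.scale /= upiZ !upi_star upiZ starZ.
Qed.

HB.instance Definition _ := isStarAlgebra.Build R ultraproduct
  up_starK up_starD up_starM up_starZ.

End Ultraproduct.

Arguments ultraproduct {R} omega A.

Section MatrixAlgebra.
Context (R : realType) (n : nat).
Local Notation C := R[i].
Local Notation dot := (@dotmx C n.+1).
Implicit Types (A B : 'M[C]_n.+1) (u v : 'rV[C]_n.+1).

Definition mx_star A : 'M[C]_n.+1 := map_mx Num.conj A^T.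

(* MathComp matrices act on row vectors; this is the usual operator norm. *)
Definition mx_opnorm A : R := opnorm dot (fun u => u *m A).

Definition mx_trace A : C := (n.+1%:R)^-1 * \tr A.

Fact mx_starK : involutive mx_star.
Proof. by move=> A; apply/matrixP => i j; rewrite !mxE conjCK. Qed.

Fact mx_starD : {morph mx_star : A B / A + B}.
Proof. by move=> A B; rewrite /mx_star linearD /= map_mxD. Qed.

Fact mx_starM A B : mx_star (A * B) = mx_star B * mx_star A.
Proof. by rewrite /mx_star -mulmxE trmx_mul map_mxM. Qed.

Fact mx_starZ (a : C) A : mx_star (a *: A) = a^*%R *: mx_star A.
Proof. by rewrite /mx_star linearZ /= map_mxZ. Qed.

HB.instance Definition _ := isStarAlgebra.Build R 'M[C]_n.+1
  mx_starK mx_starD mx_starM mx_starZ.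

Lemma mx_is_adjoint A :
  is_adjoint dot (fun u => u *m A) (fun u => u *m mx_star A).
Proof.
move=> u v /=; rewrite !dotmxE -mulmxA; congr (fun_of_matrix (_ *m _) _ _).
rewrite trmx_mul map_mxM; congr (_ *m _); exact/esym/mx_starK.
Qed.

Lemma mx_bounded A : exists c, bounded_by dot (fun u => u *m A) c.
Proof.
have coord_le u i : complex.Re `|u 0 i| <= hnorm dot u.
  rewrite -(@ler_pXn2r _ 2) ?nnegrE ?hnorm_ge0 ?Re_ge0 // -lecR -dotE.
  rewrite rcX -Re_ge0E //= dotmxE mxE (bigD1 i) //= !mxE -normCK.
  by rewrite lerDl sumr_ge0 // => j _; rewrite !mxE mul_conjC_ge0.
exists (\sum_i hnorm dot (row i A)); split=> [|u].
  by rewrite sumr_ge0 // => i _; exact: hnorm_ge0.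
have sum_le (I : Type) (r : seq I) (F : I -> 'rV[C]_n.+1) :
    hnorm dot (\sum_(i <- r) F i) <= \sum_(i <- r) hnorm dot (F i).
  elim: r => [|i r IH]; first by rewrite !big_nil hnorm0.
  by rewrite !big_cons (le_trans (hnormD _ _ _)) // lerD2l.
rewrite mulmx_sum_row (le_trans (sum_le _ _ _)) // mulr_suml ler_sum // => i _.
by rewrite hnormZ mulrC ler_wpM2l ?hnorm_ge0.
Qed.

Lemma tr_starM A : \tr (A *m mx_star A) = \sum_i dot (row i A) (row i A).
Proof.
rewrite /mxtrace; apply: eq_bigr => i _; rewrite /= dotmxE !mxE.
by apply: eq_bigr => k _; rewrite !mxE.
Qed.

Fact mx_opnorm_eq0 A : mx_opnorm A = 0 -> A = 0.
Proof.
move=> /(opnorm_eq0 (mx_bounded A)) A0; apply/row_matrixP => i.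
by rewrite rowE row0; apply: (congr1 (fun f => f _) A0).
Qed.

Fact mx_opnorm1 : mx_opnorm 1 = 1.
Proof.
rewrite /mx_opnorm (_ : (fun u => _) = id).
  apply: (@opnorm1 _ _ _ (delta_mx 0 0)).
  by apply/eqP => /matrixP /(_ 0 0) /eqP; rewrite !mxE !eqxx oner_eq0.
by apply/funext => u; rewrite mulmx1.
Qed.

Fact mx_opnormD A B : mx_opnorm (A + B) <= mx_opnorm A + mx_opnorm B.
Proof.
rewrite /mx_opnorm (_ : (fun u => _) = (fun u => u *m A + u *m B)).
  exact/opnormD/mx_bounded/mx_bounded.
by apply/funext => u; rewrite mulmxDr.
Qed.

Fact mx_opnormZ (a : C) A :
  mx_opnorm (a *: A) = complex.Re `|a| * mx_opnorm A.
Proof.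
rewrite -(opnormZ _ (mx_bounded A)); congr opnorm.
by apply/funext => u; rewrite scalemxAr.
Qed.

Fact mx_opnormM A B : mx_opnorm (A * B) <= mx_opnorm A * mx_opnorm B.
Proof.
rewrite mulrC /mx_opnorm.
rewrite (_ : (fun u => _) = (fun u => (u *m A) *m B)).
  exact: (opnormM (mx_bounded B) (mx_bounded A)).
by apply/funext => u; rewrite mulmxA.
Qed.

Fact mx_opnorm_star A : mx_opnorm (mx_star A) = mx_opnorm A.
Proof. exact: opnorm_adjoint (mx_is_adjoint A) (mx_bounded A). Qed.

Fact mx_trace_linear : scalar mx_trace.
Proof.
by move=> a A B; rewrite /mx_trace linearD /= linearZ /= mulrDr mulrCA.
Qed.

Fact mx_trace1 : mx_trace 1 = 1.
Proof. by rewrite /mx_trace mxtrace1 mulVf // pnatr_eq0. Qed.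

Fact mx_traceC A B : mx_trace (A * B) = mx_trace (B * A).
Proof. by rewrite /mx_trace -!mulmxE mxtrace_mulC. Qed.

Let n1_gt0 : 0 < (n.+1%:R : C)^-1. Proof. by rewrite invr_gt0 ltr0n. Qed.

Fact mx_trace_ge0 A : 0 <= mx_trace (mx_star A * A).
Proof.
rewrite mx_traceC /mx_trace -mulmxE tr_starM mulr_ge0 ?(ltW n1_gt0) //.
by rewrite sumr_ge0 // => i _; exact: dnorm_ge0.
Qed.

Fact mx_trace_faithful A : mx_trace (mx_star A * A) = 0 -> A = 0.
Proof.
rewrite mx_traceC /mx_trace -mulmxE tr_starM => /eqP.
rewrite mulf_eq0 (gt_eqF n1_gt0) /= psumr_eq0 => [|i _]; last exact: dnorm_ge0.
move=> /allP h; apply/row_matrixP => i; apply/eqP.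
rewrite row0 -(dnorm_eq0 dot); exact: h i (mem_index_enum i).
Qed.

Fact mx_trace_bound A B : mx_trace (mx_star (A * B) * (A * B)) <=
  (mx_opnorm A ^+ 2)%:C * mx_trace (mx_star B * B).
Proof.
rewrite mx_starM -mx_opnorm_star /mx_trace mulrCA ler_pM2l //.
have -> : \tr (mx_star B * mx_star A * (A * B)) =
    \tr ((mx_star B *m mx_star A) *m mx_star (mx_star B *m mx_star A)).
  by rewrite [in RHS]mulmxE mx_starM !mx_starK.
rewrite -[X in _ * \tr (_ * X)]mx_starK -mulmxE !tr_starM mulr_sumr.
apply: ler_sum => i _; rewrite row_mul !dotE -rcM lecR -exprMn.
rewrite lerXn2r ?nnegrE ?mulr_ge0 ?hnorm_ge0 ?opnorm_ge0 //.
exact: (opnormP _ (mx_bounded (mx_star A))).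
Qed.

HB.instance Definition _ := isTracialAlgebra.Build R 'M[C]_n.+1
  mx_opnorm_eq0 mx_opnorm1 mx_opnormD mx_opnormZ mx_opnormM mx_opnorm_star
  mx_trace_linear mx_trace1 mx_traceC mx_trace_ge0 mx_trace_faithful
  mx_trace_bound.

End MatrixAlgebra.

Record hilbertSpace (R : realType) := HilbertSpace {
  hs_sort :> lmodType R[i];
  hs_dot : {dot hs_sort for Num.conj};
  hs_complete : forall u : nat -> hs_sort,
    (forall e : R, 0 < e -> exists N, forall m n, (N <= m)%N -> (N <= n)%N ->
      hnorm hs_dot (u m - u n) < e) ->
    exists l, hnorm hs_dot (u n - l) @[n --> \oo] --> (0 : R)
}.

Section VonNeumannAlgebras.
Context (R : realType) (H : hilbertSpace R).
Local Notation C := R[i].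
Local Notation dot := (@hs_dot R H).
Local Notation ops := (set (H -> H)).
Implicit Types (f g : H -> H) (S : ops).

Definition commutant S : ops :=
  [set g | bounded_operator dot g /\ forall f, S f -> f \o g = g \o f].

(* Adjoints of bounded operators exist and are unique, so asking for an adjoint
   inside S is the usual closure under the star operation. *)
Definition star_subalgebra S : Prop :=
  [/\ S `<=` bounded_operator dot,
      S id,
      forall (a : C) f g, S f -> S g -> S (a *: f + g),
      forall f g, S f -> S g -> S (f \o g) &
      forall f, S f -> exists2 g, S g & is_adjoint dot f g].

Definition finite_dimensional S : Prop :=
  exists n (b : 'I_n -> H -> H),
    forall f, S f -> exists a : 'I_n -> C, f = \sum_i a i *: b i.

Record vonNeumannAlgebra := VonNeumannAlgebra {
  vn_ops : ops;
  vn_star : star_subalgebra vn_ops;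
  vn_bicommutant : commutant (commutant vn_ops) = vn_ops
}.

Definition positive_operator f : Prop := forall u, 0 <= dot (f u) u.

Definition square_summable (x : nat -> H) : Prop :=
  cvgn (series (fun n => hnorm dot (x n) ^+ 2)).

(* The functionals sum_n <f x_n, y_n> with square-summable x and y; they
   define the ultraweak (sigma-weak) topology. *)
Definition ultraweak_form (x y : nat -> H) f : C :=
  limn (fun N => \sum_(n < N) dot (f (x n)) (y n) : C^o).

(* Continuity at 0, which is continuity for a functional that is linear on S. *)
Definition ultraweakly_continuous S (tau : (H -> H) -> C) : Prop :=
  forall e : R, 0 < e -> exists (k : nat) (x y : 'I_k -> nat -> H),
    (forall j, square_summable (x j) /\ square_summable (y j)) /\
    exists2 d : R, 0 < d & forall f, S f ->
      (forall j, `|ultraweak_form (x j) (y j) f| < d%:C) -> `|tau f| < e%:C.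

(* A functional on M; its values off M are irrelevant. *)
Record faithful_normal_tracial_state (M : vonNeumannAlgebra) := TracialState {
  ts_fun :> (H -> H) -> C;
  ts_linear : forall (a : C) f g, vn_ops M f -> vn_ops M g ->
    ts_fun (a *: f + g) = a * ts_fun f + ts_fun g;
  ts_id : ts_fun id = 1;
  ts_positive : forall f, vn_ops M f -> positive_operator f -> 0 <= ts_fun f;
  ts_trace : forall f g, vn_ops M f -> vn_ops M g ->
    ts_fun (f \o g) = ts_fun (g \o f);
  ts_faithful : forall f, vn_ops M f -> positive_operator f ->
    ts_fun f = 0 -> f = 0;
  ts_normal : ultraweakly_continuous (vn_ops M) ts_fun
}.

Definition is_factor (M : vonNeumannAlgebra) : Prop :=
  vn_ops M `&` commutant (vn_ops M) =
    [set f | exists a : C, f = a *: (id : H -> H)].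

Definition is_II1_factor (M : vonNeumannAlgebra) : Prop :=
  [/\ is_factor M, ~ finite_dimensional (vn_ops M) &
      inhabited (faithful_normal_tracial_state M)].

(* Generated by an increasing sequence of finite-dimensional star-subalgebras;
   in particular the predual is separable. *)
Definition is_hyperfinite (M : vonNeumannAlgebra) : Prop :=
  exists A : nat -> ops,
    [/\ forall k, star_subalgebra (A k) /\ finite_dimensional (A k),
        forall k, A k `<=` A k.+1 &
        commutant (commutant (\bigcup_k A k)) = vn_ops M].

Section VonNeumannClosure.
Context (M : vonNeumannAlgebra).

Definition vn_pred : {pred H -> H} := fun f => f \in vn_ops M.

Lemma vn_predE f : (f \in vn_pred) = (f \in vn_ops M). Proof. by []. Qed.

Lemma vnP f : reflect (vn_ops M f) (f \in vn_pred).
Proof. by apply: (iffP idP); rewrite vn_predE inE. Qed.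

Lemma vn_bounded f : vn_ops M f -> exists c, bounded_by dot f c.
Proof. by case: (vn_star M) => + _ _ _ _ Mf => /(_ f Mf) []. Qed.

Lemma vn_linear f : vn_ops M f -> linear f.
Proof. by case: (vn_star M) => + _ _ _ _ Mf => /(_ f Mf) []. Qed.

Lemma vn_id : vn_ops M id. Proof. by case: (vn_star M). Qed.

Lemma vn_comb (a : C) f g : vn_ops M f -> vn_ops M g -> vn_ops M (a *: f + g).
Proof. by case: (vn_star M) => _ _ + _ _; apply. Qed.

Lemma vn_comp f g : vn_ops M f -> vn_ops M g -> vn_ops M (f \o g).
Proof. by case: (vn_star M) => _ _ _ + _; apply. Qed.

Lemma vn_adj f : vn_ops M f -> exists2 g, vn_ops M g & is_adjoint dot f g.
Proof. by case: (vn_star M) => _ _ _ _; apply. Qed.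

Lemma vn0 : vn_ops M 0.
Proof.
by have := vn_comb (-1) vn_id vn_id; rewrite scaleN1r addNr.
Qed.

Fact vn_submod_closed : submod_closed vn_pred.
Proof.
split=> [|a f g /vnP Mf /vnP Mg]; first exact/vnP/vn0.
exact/vnP/vn_comb.
Qed.

HB.instance Definition _ :=
  GRing.isSubmodClosed.Build C (H -> H) vn_pred vn_submod_closed.

End VonNeumannClosure.

Definition vn_algebra (M : vonNeumannAlgebra)
  (tau : faithful_normal_tracial_state M) : Type :=
  {f : H -> H | f \in vn_pred M}.

Section TracialAlgebraOfState.
Context (M : vonNeumannAlgebra) (tau : faithful_normal_tracial_state M).
Local Notation T := (vn_algebra tau).

HB.instance Definition _ := SubChoice.on T.
HB.instance Definition _ := [SubChoice_isSubLmodule of T by <:].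

Lemma vn_valP (x : T) : vn_ops M (val x).
Proof. exact/vnP/(valP x). Qed.

Lemma vn_valD (x y : T) : val (x + y) = val x + val y.
Proof. exact: raddfD. Qed.

Lemma vn_valZ (a : C) (x : T) : val (a *: x) = a *: val x.
Proof. exact: linearZ. Qed.

Fact vn_compP (x y : T) : val x \o val y \in vn_pred M.
Proof. exact/vnP/vn_comp/vn_valP/vn_valP. Qed.

Fact vn_idP : id \in vn_pred M. Proof. exact/vnP/vn_id. Qed.

Definition vn_mul (x y : T) : T := exist _ (val x \o val y) (vn_compP x y).
Definition vn_one : T := exist _ id vn_idP.

Definition vn_adjoint (x : T) : T :=
  let g := cid2 (vn_adj (vn_valP x)) in
  exist _ (s2val g) (introT (vnP _ _) (s2valP g)).

Lemma vn_adjointP (x : T) : is_adjoint dot (val x) (val (vn_adjoint x)).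
Proof. by rewrite /vn_adjoint /=; case: cid2. Qed.

Lemma vn_adjoint_eq (x y : T) : is_adjoint dot (val x) (val y) ->
  vn_adjoint x = y.
Proof. by move=> xy; apply/val_inj/(adjoint_inj (vn_adjointP x) xy). Qed.

Lemma vn_val_linear (x : T) (a : C) u v :
  val x (a *: u + v) = a *: val x u + val x v.
Proof. exact: (vn_linear (vn_valP x)). Qed.

Lemma vn_val_add (x : T) u v : val x (u + v) = val x u + val x v.
Proof. by have := vn_val_linear x 1 u v; rewrite !scale1r. Qed.

Lemma vn_val0 (x : T) : val x 0 = 0.
Proof. by apply: (addrI (val x 0)); rewrite -vn_val_add !addr0. Qed.

Lemma vn_val_scale (x : T) (a : C) u : val x (a *: u) = a *: val x u.
Proof. by have := vn_val_linear x a u 0; rewrite vn_val0 !addr0. Qed.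

Lemma vn_val_bounded (x : T) : exists c, bounded_by dot (val x) c.
Proof. exact: vn_bounded (vn_valP x). Qed.

Fact vn_mulA : associative vn_mul.
Proof. by move=> x y z; apply: val_inj. Qed.

Fact vn_mul1 : left_id vn_one vn_mul.
Proof. by move=> x; apply: val_inj. Qed.

Fact vn_mulr1 : right_id vn_one vn_mul.
Proof. by move=> x; apply: val_inj. Qed.

Fact vn_mulDl : left_distributive vn_mul +%R.
Proof. by move=> x y z; apply: val_inj. Qed.

Fact vn_mulDr : right_distributive vn_mul +%R.
Proof.
by move=> x y z; apply: val_inj; apply/funext => u; exact: vn_val_add.
Qed.

Lemma ts0 : tau 0 = 0.
Proof.
by have := ts_linear tau (-1) (vn_id M) (vn_id M);
  rewrite scaleN1r addNr mulN1r addNr.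
Qed.

Fact vn_1neq0 : vn_one != 0.
Proof.
apply/eqP => /(congr1 val) E; have := ts_id tau.
rewrite -[id]/(val vn_one) E -[val 0]/(0 : H -> H) ts0 => /eqP.
by rewrite eq_sym oner_eq0.
Qed.

HB.instance Definition _ := GRing.Zmodule_isNzRing.Build T
  vn_mulA vn_mul1 vn_mulr1 vn_mulDl vn_mulDr vn_1neq0.

Fact vn_scaleAl (a : C) (x y : T) : a *: (x * y) = (a *: x) * y.
Proof. by apply: val_inj. Qed.

Fact vn_scaleAr (a : C) (x y : T) : a *: (x * y) = x * (a *: y).
Proof.
by apply: val_inj; apply/funext => u; apply/esym; exact: vn_val_scale.
Qed.

HB.instance Definition _ := GRing.Lmodule_isLalgebra.Build C T vn_scaleAl.
HB.instance Definition _ := GRing.Lalgebra_isAlgebra.Build C T vn_scaleAr.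

Fact vn_adjointK : involutive vn_adjoint.
Proof. by move=> x; apply/vn_adjoint_eq/is_adjointC/vn_adjointP. Qed.

Fact vn_adjointD : {morph vn_adjoint : x y / x + y}.
Proof.
move=> x y; apply: vn_adjoint_eq => u v; rewrite !vn_valD.
by rewrite linearDl linearDr /= !vn_adjointP.
Qed.

Fact vn_adjointM (x y : T) : vn_adjoint (x * y) = vn_adjoint y * vn_adjoint x.
Proof. by apply: vn_adjoint_eq => u v; rewrite /= !vn_adjointP. Qed.

Fact vn_adjointZ (a : C) (x : T) :
  vn_adjoint (a *: x) = a^*%R *: vn_adjoint x.
Proof.
apply: vn_adjoint_eq => u v; rewrite !vn_valZ.
by rewrite linearZl_LR linearZr_LR /= conjCK vn_adjointP.
Qed.

HB.instance Definition _ := isStarAlgebra.Build R T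
  vn_adjointK vn_adjointD vn_adjointM vn_adjointZ.

Definition vn_norm (x : T) : R := opnorm dot (val x).
Definition vn_trace (x : T) : C := tau (val x).

Fact vn_norm_eq0 x : vn_norm x = 0 -> x = 0.
Proof. by move/(opnorm_eq0 (vn_val_bounded x)) => x0; apply: val_inj. Qed.

Fact vn_norm1 : vn_norm 1 = 1.
Proof.
have [u u0] : exists u : H, u != 0.
  apply: contrapT => /forallNP h; have /eqP := vn_1neq0; apply.
  by apply: val_inj; apply/funext => u; have /negP/negPn/eqP := h u.
exact: opnorm1 u0.
Qed.

Fact vn_normD x y : vn_norm (x + y) <= vn_norm x + vn_norm y.
Proof. exact: opnormD (vn_val_bounded x) (vn_val_bounded y). Qed.

Fact vn_normZ (a : C) x : vn_norm (a *: x) = complex.Re `|a| * vn_norm x.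
Proof. exact: opnormZ (vn_val_bounded x). Qed.

Fact vn_normM x y : vn_norm (x * y) <= vn_norm x * vn_norm y.
Proof. exact: opnormM (vn_val_bounded x) (vn_val_bounded y). Qed.

Fact vn_norm_adjoint x : vn_norm (vn_adjoint x) = vn_norm x.
Proof. exact: opnorm_adjoint (vn_adjointP x) (vn_val_bounded x). Qed.

Fact vn_trace_linear : scalar vn_trace.
Proof. by move=> a x y; apply: ts_linear; exact: vn_valP. Qed.

Fact vn_trace1 : vn_trace 1 = 1. Proof. exact: ts_id. Qed.

Fact vn_traceC x y : vn_trace (x * y) = vn_trace (y * x).
Proof. by apply: ts_trace; exact: vn_valP. Qed.

Lemma vn_square_pos x : positive_operator (val (vn_adjoint x * x)).
Proof.
by move=> u; rewrite /= -[val x u]/(val x u) (is_adjointC (vn_adjointP x))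
  dnorm_ge0.
Qed.

Fact vn_trace_ge0 x : 0 <= vn_trace (vn_adjoint x * x).
Proof. by apply: ts_positive (vn_square_pos x); exact: vn_valP. Qed.

Fact vn_trace_faithful x : vn_trace (vn_adjoint x * x) = 0 -> x = 0.
Proof.
move=> t0; have E := ts_faithful (vn_valP _) (vn_square_pos x) t0.
apply: val_inj; apply/funext => u; apply/eqP.
rewrite -(dnorm_eq0 dot) vn_adjointP.
by rewrite -[val (vn_adjoint x) _]/(val (vn_adjoint x * x) u) E linear0r.
Qed.

Fact vn_trace_bound x y : vn_trace (vn_adjoint (x * y) * (x * y)) <=
  (vn_norm x ^+ 2)%:C * vn_trace (vn_adjoint y * y).
Proof.
set p := (vn_norm x ^+ 2)%:C *: (vn_adjoint y * y) -
  vn_adjoint (x * y) * (x * y).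
have p_pos : positive_operator (val p).
  have sqE (z : T) u : dot (val (vn_adjoint z) (val z u)) u =
      (hnorm dot (val z u) ^+ 2)%:C.
    by rewrite (is_adjointC (vn_adjointP z)) dotE.
  move=> u.
  have -> : val p u = (vn_norm x ^+ 2)%:C *: val (vn_adjoint y) (val y u) -
    val (vn_adjoint (x * y)) (val (x * y) u) by [].
  have Bl (a b w : H) : dot (a - b) w = dot a w - dot b w by exact: linearBl.
  have Zl (c : C) (a w : H) : dot (c *: a) w = c * dot a w.
    by exact: linearZl_LR.
  rewrite Bl Zl !sqE -rcM subr_ge0 lecR -exprMn.
  rewrite lerXn2r ?nnegrE ?mulr_ge0 ?hnorm_ge0 ?opnorm_ge0 //.
  exact: opnormP (vn_val_bounded x).
have := ts_positive tau (vn_valP p) p_pos; rewrite -[tau _]/(vn_trace p).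
rewrite /p -scaleN1r addrC vn_trace_linear mulN1r.
have -> : vn_trace ((vn_norm x ^+ 2)%:C *: (vn_adjoint y * y)) =
    (vn_norm x ^+ 2)%:C * vn_trace (vn_adjoint y * y).
  have := vn_trace_linear (vn_norm x ^+ 2)%:C (vn_adjoint y * y) 0.
  by rewrite addr0 /vn_trace ts0 addr0.
by rewrite addrC subr_ge0.
Qed.

HB.instance Definition _ := isTracialAlgebra.Build R T
  vn_norm_eq0 vn_norm1 vn_normD vn_normZ vn_normM vn_norm_adjoint
  vn_trace_linear vn_trace1 vn_traceC vn_trace_ge0 vn_trace_faithful
  vn_trace_bound.

End TracialAlgebraOfState.
End VonNeumannAlgebras.

(* Main.v *)
Require Import Defs.
From HB Require Import structures.
From mathcomp Require Import all_boot all_order all_algebra.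
From mathcomp Require Import sesquilinear spectral complex ring lra zify.
From mathcomp Require Import boolp classical_sets functions reals.
From mathcomp Require Import topology normedtype sequences trigo.

Set Implicit Arguments.
Unset Strict Implicit.
Unset Printing Implicit Defensive.

Import Order.TTheory GRing.Theory Num.Theory.
Import numFieldNormedType.Exports.
Local Open Scope classical_set_scope.
Local Open Scope ring_scope.
Local Open Scope complex_scope.

(** Call a family of elements of an algebra irreducible when only the scalars
    commute with all of them.  Algebra isomorphisms preserve this notion, and it
    separates the two algebras: the matrix ultraproduct has an irreducible triple
    ([matrix_scalar_commutant]), whereas no finite family of the ultrapower of
    the hyperfinite factor is irreducible ([hyperfinite_nonscalar_commutant]).

    Matrices.  For N = n + 1 and w = exp (2 i pi / N) the triple consists of the
    clock matrix diag (w^j), the chirp diag (w^(j^2)) and the discrete Fourier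
    matrix.  Expand a matrix m in the Weyl basis X^a Z^b, indexed by the phase
    space (Z/N)^2.  Conjugation by each of the three unitaries only changes the
    phases of the coefficients, apart from permuting them: the clock fixes
    (a, b) and multiplies its coefficient by w^a, the chirp acts by the shear
    (a, b) -> (a, b + 2 a), the Fourier matrix by a quarter turn.  If m almost
    commutes with the three, then the measure |coefficient|^2 on phase space is
    almost invariant under the shear and the quarter turn, and, because of the
    clock and its rotated copy, concentrated where a and b are small compared
    with N.  There the shear acts as on Z^2, and a ping-pong argument applies:
    the shear and its inverse send the nonzero points with |b| <= |a| to disjoint
    sets of points with |a| <= |b|, while the quarter turn exchanges the two cones,
    so the mass away from the origin is small.  The coefficient at the origin is
    the trace; this gives a bound on |m - tr m|_2 by the commutators, uniform in
    N ([spectral_gap]), and an ultralimit of traces turns it into the result.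

    The hyperfinite side.  Let M be generated by an increasing sequence of
    finite-dimensional star-subalgebras A_k.  It suffices to find projections
    z_k commuting with A_k whose traces stay away from 0 and 1
    ([asymptotically_central]), provided the union of the A_k is dense in M for
    the 2-norm ([stage_dense]): given finitely many elements of the ultrapower,
    approximate their n-th representatives in some A_k and use z_k.

    For the projections, work inside A_l with l >= k.  If e is a minimal
    projection of the relative commutant of A_k in A_l, then e A_l e = A_k e
    ([atom_corner]), so e is a sum of at most dim A_k minimal projections of
    A_l.  Hence, if minimal projections of A_l have small trace for large l, the
    same holds in the relative commutant, and a partial sum of them has trace
    between 1/3 and 2/3.  Otherwise A_l contains, for arbitrarily large l,
    minimal projections with trace bounded below; the central support of such a
    projection generates an ideal of A_l of bounded dimension
    ([central_support]), so its trace cannot approach 1 because M is infinite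
    dimensional ([tr_away_from_1]), and this central projection serves as z_k.

    Density is the bicommutant theorem in its ultrastrong form
    ([bicommutant_density]): it is proved by projecting, in the Hilbert space of
    square-summable sequences of vectors, onto the closure of an orbit of the
    subalgebra; normality of the trace then transfers it to the 2-norm. *)

(** * Squared modulus and roots of unity *)

Section SquaredModulus.
Context (R : realType).
Implicit Types (a b : R[i]) (x : R).

Definition sqmod a : R := complex.Re a ^+ 2 + complex.Im a ^+ 2.

Lemma sqmod_ge0 a : 0 <= sqmod a.
Proof. by rewrite addr_ge0 ?sqr_ge0. Qed.

Lemma sqmodE a : (sqmod a)%:C = a * a^*%R.
Proof.
case: a => x y; rewrite /sqmod /= -[(_ +i* _)^*%R]/(x -i* y).
by apply/eqP; rewrite eq_complex /=; apply/andP; split; apply/eqP; ring.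
Qed.

Lemma sqmod_norm a : (sqmod a)%:C = `|a| ^+ 2.
Proof. by rewrite sqmodE normCK. Qed.

Lemma sqmodM a b : sqmod (a * b) = sqmod a * sqmod b.
Proof. by case: a b => [x y] [z t]; rewrite /sqmod /=; ring. Qed.

Lemma sqmod_rc x : sqmod x%:C = x ^+ 2.
Proof. by rewrite /sqmod /= expr0n addr0. Qed.

(** Any factor 1 + s > 1 in front of [sqmod b] is possible, at the cost of
    1 + 1 / s in front of the difference.  The ping-pong argument applies the
    estimate twice in a row and needs (1 + s)^2 < 2, whence s = 1/4. *)
Lemma sqmod_perturb a b : sqmod a <= 5 / 4 * sqmod b + 5 * sqmod (a - b).
Proof.
case: a b => [x y] [z t]; rewrite /sqmod /=.
have h (u v : R) : u ^+ 2 <= 5 / 4 * v ^+ 2 + 5 * (u - v) ^+ 2.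
  have := sqr_ge0 (4 * u - 5 * v); lra.
have := h x z; have := h y t; lra.
Qed.

End SquaredModulus.

Section RootOfUnity.
Context (R : realType) (n : nat).
Local Notation C := R[i].
Local Notation N := n.+1.

Definition cis (x : R) : C := cos x +i* sin x.

Lemma cisD x y : cis (x + y) = cis x * cis y.
Proof.
apply/eqP; rewrite eq_complex /= cosD sinD; apply/andP; split; apply/eqP; ring.
Qed.

Lemma cis0 : cis 0 = 1. Proof. by rewrite /cis cos0 sin0. Qed.

Lemma cisX x k : cis x ^+ k = cis (k%:R * x).
Proof.
elim: k => [|k IH]; first by rewrite mul0r cis0.
by rewrite exprS IH -cisD -{1}[x]mul1r -mulrDl -natr1 addrC.
Qed.

Lemma sqmod_cis x : sqmod (cis x) = 1.
Proof. exact: cos2Dsin2. Qed.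

Lemma sqmod_cisB1 x : sqmod (cis x - 1) = 2 - 2 * cos x.
Proof. rewrite /sqmod /= oppr0 addr0; have := cos2Dsin2 x; lra. Qed.

Definition zeta : C := cis (2 * pi / N%:R).
Local Notation w := zeta.

Lemma zetaX k : w ^+ k = cis (k%:R * (2 * pi / N%:R)). Proof. exact: cisX. Qed.

Lemma zetaN : w ^+ N = 1.
Proof.
rewrite zetaX mulrC divfK ?pnatr_eq0 //.
by rewrite /cis mulrC mulr_natr cos2pi sin2pi.
Qed.

Lemma zeta_mod k : w ^+ (k %% N) = w ^+ k.
Proof. exact: expr_mod zetaN. Qed.

Lemma sqmod_zeta k : sqmod (w ^+ k) = 1.
Proof. by rewrite zetaX sqmod_cis. Qed.

Lemma zeta_conjK k : w ^+ k * (w ^+ k)^*%R = 1.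
Proof. by rewrite -sqmodE sqmod_zeta. Qed.

(** The cosine decreases on [0, pi] and is symmetric about pi. *)
Lemma cos_far (c x : R) : 0 <= c <= pi -> c <= x -> x <= 2 * pi - c ->
  cos x <= cos c.
Proof.
move=> /andP[c0 cpi] cx xc.
have mono y : c <= y -> y <= pi -> cos y <= cos c.
  move=> cy ypi; rewrite leNgt ltr_cos ?in_itv /= ?c0 //; first by rewrite -leNgt.
  by rewrite ypi andbT (le_trans c0).
have [xpi|xpi] := leP x pi; first exact: mono.
rewrite -cosN -(cosD2pi (- x)); apply: mono; lra.
Qed.

Lemma zeta_neq1 k : (0 < k < N)%N -> w ^+ k != 1.
Proof.
move=> /andP[k0 kN]; apply/eqP => wk.
set t : R := k%:R * (2 * pi / N%:R).
have pi0 := @pi_gt0 R.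
have N0 : 0 < N%:R :> R by rewrite ltr0n.
have t0 : 0 < t by rewrite mulr_gt0 ?ltr0n // divr_gt0 // mulr_gt0.
have t2 : t < 2 * pi.
  by rewrite /t mulrA ltr_pdivrMr // mulrC ltr_pM2l ?mulr_gt0 // ltr_nat.
pose c := Num.min (Num.min t (2 * pi - t)) pi.
have c0 : 0 < c by rewrite !lt_min t0 pi0 subr_gt0 t2.
have cpi : c <= pi by rewrite ge_min lexx orbT.
have ct : c <= t by rewrite !ge_min lexx.
have ct2 : c <= 2 * pi - t by rewrite !ge_min lexx orbT.
have h : cos t <= cos c by apply: cos_far; rewrite ?(ltW c0) ?cpi //; lra.
have : cos c < cos 0.
  by rewrite ltr_cos ?in_itv /= ?lexx ?pi_ge0 ?(ltW c0).
have := congr1 (@complex.Re R) wk; rewrite zetaX /= -/t cos0; lra.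
Qed.

(** The squared distance to 1 of an eighth root of unity exp (i pi / 4). *)
Definition cutoff : R := 2 - 2 * cos (pi / 4).

Lemma cutoff_gt0 : 0 < cutoff.
Proof.
have pi0 := @pi_gt0 R.
suff : cos (pi / 4) < cos (0 : R) by rewrite cos0 /cutoff; lra.
rewrite ltr_cos ?in_itv /= ?lexx ?pi_ge0 //; lra.
Qed.

Lemma zeta_far k : (N <= 8 * k)%N -> (N <= 8 * (N - k))%N ->
  cutoff <= sqmod (w ^+ k - 1).
Proof.
move=> k1 k2; rewrite zetaX sqmod_cisB1 /cutoff.
have pi0 := @pi_gt0 R.
have N0 : 0 < N%:R :> R by rewrite ltr0n.
have kN : (k <= N)%N by lia.
have h1 : N%:R <= 8 * k%:R :> R by rewrite -natrM ler_nat.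
have h2 : N%:R <= 8 * (N%:R - k%:R) :> R by rewrite -natrB // -natrM ler_nat.
suff : cos (k%:R * (2 * pi / N%:R)) <= cos (pi / 4 : R) by lra.
apply: cos_far; first by apply/andP; split; lra.
  by rewrite mulrA ler_pdivlMr //; nra.
by rewrite mulrA ler_pdivrMr //; nra.
Qed.

End RootOfUnity.

(** * Weyl coefficients of a matrix *)

Section WeylCoefficients.
Context (R : realType) (n : nat).
Local Notation C := R[i].
Local Notation N := n.+1.
Local Notation w := (zeta R n).
Implicit Types (a b j k : 'I_N) (m : 'M[C]_N).

Definition chi a j : C := w ^+ (a * j)%N.

Lemma chiC a j : chi a j = chi j a.
Proof. by rewrite /chi mulnC. Qed.

Lemma chiD a b j : chi (a + b) j = chi a j * chi b j.
Proof.
rewrite /chi -exprD -mulnDl -[LHS]zeta_mod -[RHS]zeta_mod.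
by congr (_ ^+ _); rewrite /= modnMml.
Qed.

Lemma chi0 j : chi 0 j = 1.
Proof. by rewrite /chi mul0n. Qed.

Lemma sqmod_chi a j : sqmod (chi a j) = 1.
Proof. exact: sqmod_zeta. Qed.

Lemma chi_conjK a j : chi a j * (chi a j)^*%R = 1.
Proof. exact: zeta_conjK. Qed.

Lemma chiN a j : chi (- a) j = (chi a j)^*%R.
Proof.
by rewrite -[LHS]mulr1 -(chi_conjK a j) mulrA -chiD addNr chi0 mul1r.
Qed.

Lemma sum_chi a : \sum_j chi a j = N%:R *+ (a == 0).
Proof.
have [->|a0] := eqVneq a 0.
  rewrite (eq_bigr (fun _ => 1)) => [|j _]; last exact: chi0.
  by rewrite sumr_const card_ord.
rewrite mulr0n.
have wa : w ^+ a != 1.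
  by apply: zeta_neq1; rewrite ltn_ord lt0n andbT; apply: contra a0.
have := subrX1 (w ^+ a) N.
rewrite -exprM mulnC exprM zetaN expr1n subrr => /esym/eqP.
rewrite mulf_eq0 subr_eq0 (negPf wa) /= => /eqP E.
by rewrite -[RHS]E; apply: eq_bigr => j _; rewrite /chi exprM.
Qed.

(** The coordinate of [m] on X^a Z^b, where X is the cyclic shift
    e_j -> e_(j + a) for a = 1 and Z the clock; these N^2 unitaries are
    orthonormal for the normalized trace. *)
Definition weyl m a b : C :=
  N%:R^-1 * \sum_j (chi b j)^*%R * m (j + a) j.

Lemma weylB m m' a b : weyl (m - m') a b = weyl m a b - weyl m' a b.
Proof.
rewrite /weyl -mulrBr -sumrB; congr (_ * _); apply: eq_bigr => j _.
by rewrite !mxE mulrBr.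
Qed.

Lemma weyl00 m : weyl m 0 0 = trace m.
Proof.
rewrite /weyl /trace /= /mx_trace /mxtrace; congr (_ * _).
by apply: eq_bigr => j _; rewrite chi0 rmorph1 mul1r addr0.
Qed.

Lemma weyl_scalar (c : C) a b : weyl (c *: (1 : 'M[C]_N)) a b =
  c *+ ((a == 0) && (b == 0)).
Proof.
rewrite /weyl; under eq_bigr do rewrite !mxE -subr_eq0 addrAC subrr add0r.
have [_|a0] := eqVneq a 0; last first.
  by rewrite big1 ?mulr0 // => j _; rewrite /= !mulr0.
rewrite /= -mulr_suml mulr1.
under eq_bigr do rewrite -chiN.
rewrite sum_chi oppr_eq0; case: eqP => _; rewrite ?mul0r ?mulr0 //.
by rewrite mulrA mulVf ?pnatr_eq0 // mul1r.
Qed.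

Lemma dft_parseval (x : 'I_N -> C) :
  \sum_b sqmod (\sum_j (chi b j)^*%R * x j) = N%:R * \sum_j sqmod (x j).
Proof.
apply: complexI; rewrite rmorphM rmorph_nat !rmorph_sum /=.
have E b : (sqmod (\sum_j (chi b j)^*%R * x j))%:C =
    \sum_j \sum_k (chi b j)^*%R * x j * ((chi b k)^*%R * x k)^*%R.
  rewrite sqmodE mulr_suml; apply: eq_bigr => j _.
  by rewrite (rmorph_sum (@Num.conj C)) mulr_sumr.
under eq_bigr do rewrite E.
rewrite exchange_big mulr_sumr; apply: eq_bigr => j _.
rewrite exchange_big (bigD1 j) //= [X in _ + X]big1 => [|k kj].
  rewrite addr0 (eq_bigr (fun _ => x j * (x j)^*%R)) => [|b _].
    by rewrite sumr_const card_ord sqmodE mulr_natl.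
  rewrite rmorphM /= conjCK mulrACA [_ * chi _ _]mulrC chi_conjK mul1r //.
rewrite (eq_bigr (fun b => (x j * (x k)^*%R) * chi (k - j) b)) => [|b _].
  by rewrite -mulr_sumr sum_chi subr_eq0 (negPf kj) mulr0.
rewrite rmorphM /= conjCK mulrACA mulrC chiD chiN; congr (_ * _).
by rewrite mulrC !(chiC b).
Qed.

Lemma norm2_mxE m : norm2 m ^+ 2 = N%:R^-1 * \sum_i \sum_j sqmod (m i j).
Proof.
apply: complexI; rewrite -norm2E /trace /= /mx_trace.
rewrite rmorphM fmorphV rmorph_nat; congr (_ * _).
rewrite exchange_big rmorph_sum /mxtrace; apply: eq_bigr => j _.
rewrite /= -mulmxE mxE rmorph_sum; apply: eq_bigr => i _.
by rewrite -[star m]/(mx_star m) !mxE mulrC [RHS]sqmodE.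
Qed.

(** The a-th cyclic diagonal of [m] and its coordinates on the X^a Z^b are
    related by a discrete Fourier transform, for each a. *)
Lemma parseval m : \sum_a \sum_b sqmod (weyl m a b) = norm2 m ^+ 2.
Proof.
rewrite norm2_mxE.
have E a : \sum_b sqmod (weyl m a b) = N%:R^-1 * \sum_j sqmod (m (j + a) j).
  rewrite /weyl; under eq_bigr do rewrite sqmodM.
  rewrite -mulr_sumr dft_parseval mulrA; congr (_ * _).
  have -> : (N%:R^-1 : C) = (N%:R^-1 : R)%:C by rewrite fmorphV rmorph_nat.
  by rewrite sqmod_rc expr2 -mulrA mulVf ?pnatr_eq0 // mulr1.
under eq_bigr do rewrite E.
rewrite -mulr_sumr; congr (_ * _).
rewrite exchange_big [RHS]exchange_big; apply: eq_bigr => j _.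
by rewrite [RHS](reindex_inj (addrI j)).
Qed.

Definition clock : 'M[C]_N := diag_mx (\row_j w ^+ j).
Definition chirp : 'M[C]_N := diag_mx (\row_j chi j j).
Definition fourier : 'M[C]_N :=
  \matrix_(i, j) ((Num.sqrt N%:R : R)^-1%:C * chi i j).

Lemma diag_conj (d : 'rV[C]_N) m i j :
  (diag_mx d * m * star (diag_mx d)) i j = d 0 i * m i j * (d 0 j)^*%R.
Proof.
rewrite -[star _]/(mx_star _) /mx_star tr_diag_mx map_diag_mx -!mulmxE.
by rewrite mul_mx_diag mxE mul_diag_mx !mxE.
Qed.

Lemma weyl_clock m a b :
  weyl (clock * m * star clock) a b = w ^+ a * weyl m a b.
Proof.
rewrite /weyl mulrCA; congr (_ * _); rewrite mulr_sumr; apply: eq_bigr => j _.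
rewrite diag_conj !mxE.
have -> : w ^+ (j + a)%R = w ^+ j * w ^+ a by rewrite -exprD -[RHS]zeta_mod.
rewrite -[RHS]mulr1 -(zeta_conjK R n j); ring.
Qed.

(** The chirp maps X^a to a multiple of X^a Z^(2 a) since (j + a)^2 - j^2 is
    2 a j up to a constant; an exponent j^2, rather than j^2 / 2, makes it well
    defined modulo N for N of either parity. *)
Lemma weyl_chirp m a b :
  weyl (chirp * m * star chirp) a b = chi a a * weyl m a (b - a - a).
Proof.
rewrite /weyl mulrCA; congr (_ * _); rewrite mulr_sumr; apply: eq_bigr => j _.
rewrite diag_conj !mxE !chiD !chiN !rmorphM /= !conjCK.
rewrite [chi j (j + a)]chiC [chi a (j + a)]chiC !chiD (chiC j a).
rewrite -[RHS]mulr1 -(chi_conjK j j); ring.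
Qed.

Lemma sqrtN_sqr : ((Num.sqrt N%:R : R)^-1%:C) ^+ 2 = N%:R^-1 :> C.
Proof. by rewrite -rcX exprVn sqr_sqrtr ?ler0n // fmorphV rmorph_nat. Qed.

Lemma fourier_conj m k l : (fourier * m * star fourier) k l =
  N%:R^-1 * \sum_i \sum_j chi k i * m i j * (chi l j)^*%R.
Proof.
rewrite -sqrtN_sqr -!mulmxE mxE exchange_big mulr_sumr; apply: eq_bigr => j _.
rewrite -[star _]/(mx_star _) !mxE rmorphM /= mulr_suml mulr_sumr; apply: eq_bigr => i _.
rewrite !mxE expr2.
have -> : ((Num.sqrt N%:R : R)^-1%:C)^*%R = (Num.sqrt N%:R : R)^-1%:C :> C.
  by rewrite -[LHS]/(_^*%C) /= oppr0.
ring.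
Qed.

(** The Fourier matrix exchanges shift and clock, up to an inverse. *)
Lemma weyl_fourier m a b :
  weyl (fourier * m * star fourier) a b = chi a b * weyl m b (- a).
Proof.
rewrite /weyl mulrCA; congr (_ * _).
under eq_bigr do rewrite fourier_conj mulrCA mulr_sumr.
rewrite -mulr_sumr exchange_big.
under eq_bigr => i _ do under eq_bigr do rewrite mulr_sumr.
under eq_bigr => i _ do rewrite exchange_big.
rewrite exchange_big !mulr_sumr; apply: eq_bigr => j _.
(* the sum over the outer index l is an orthogonality relation of characters *)
rewrite (eq_bigr (fun i => chi a i * m i j * (N%:R *+ (i - j - b == 0)))); last first.
  move=> i _; rewrite -sum_chi mulr_sumr; apply: eq_bigr => l _.
  rewrite !chiD !chiN (chiC l i) (chiC l j); ring.
rewrite (bigD1 (j + b)) //= big1 => [|i ij]; last first.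
  rewrite -addrA -opprD subr_eq0 (negPf ij) mulr0 //.
rewrite -addrA -opprD subrr eqxx addr0 mulr1n mulrCA mulVf ?pnatr_eq0 // mulr1.
rewrite chiN conjCK (chiC a (j + b)) chiD (chiC j a) (chiC b a); ring.
Qed.

Lemma diag_unitary (d : 'rV[C]_N) : (forall j, d 0 j * (d 0 j)^*%R = 1) ->
  diag_mx d * star (diag_mx d) = 1.
Proof.
move=> d1; apply/matrixP => i j; rewrite -[X in X * _]mulr1 diag_conj !mxE.
by case: eqP => [->|_]; rewrite ?mulr1 ?mulr0 ?mul0r ?d1.
Qed.

Lemma clock_unitary : clock * star clock = 1.
Proof. by apply: diag_unitary => j; rewrite mxE zeta_conjK. Qed.

Lemma chirp_unitary : chirp * star chirp = 1.
Proof. by apply: diag_unitary => j; rewrite mxE chi_conjK. Qed.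

Lemma fourier_unitary : fourier * star fourier = 1.
Proof.
apply/matrixP => k l; rewrite -[X in X * _]mulr1 fourier_conj.
rewrite (eq_bigr (fun i => chi (k - l) i)) => [|i _].
  rewrite sum_chi subr_eq0 !mxE; case: eqP => _; last by rewrite mulr0.
  by rewrite mulVf ?pnatr_eq0.
rewrite (bigD1 i) //= !mxE eqxx mulr1 big1 => [|j ji].
  by rewrite addr0 chiD chiN.
by rewrite !mxE eq_sym (negPf ji) mulr0 mul0r.
Qed.

Lemma unitary_anorm_le1 (u : 'M[C]_N) : u * star u = 1 -> anorm u <= 1.
Proof.
move=> uu; apply: opnorm_lb; split=> // v; rewrite mul1r /hnorm.
rewrite (mx_is_adjoint u v (v *m u)) -mulmxA.
by rewrite -[star u]/(mx_star u) in uu; rewrite mulmxE uu mulmx1.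
Qed.

(** Commutators with a unitary control conjugation by it, without loss. *)
Lemma norm2_conjB (u m : 'M[C]_N) : u * star u = 1 ->
  norm2 (u * m * star u - m) <= norm2 (u * m - m * u).
Proof.
move=> uu; have -> : u * m * star u - m = (u * m - m * u) * star u.
  by rewrite mulrBl -[m * u * _]mulrA uu mulr1.
rewrite (le_trans (norm2M_ler _ _)) // anorm_star -[leRHS]mulr1.
by rewrite ler_wpM2l ?norm2_ge0 ?unitary_anorm_le1.
Qed.

End WeylCoefficients.

(** * Ping-pong on phase space *)

Section Shear.
Context (R : realType) (n : nat).
Local Notation C := R[i].
Local Notation N := n.+1.
Implicit Types (a b : 'I_N) (p : 'I_N * 'I_N) (E : pred ('I_N * 'I_N)).
Implicit Types (m u : 'M[C]_N).

(** Distance to 0 on the circle Z/N. *)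
Definition dist0 a : nat := minn a (N - a).

Lemma val_addE a b : (a + b)%R = (a + b)%N :> nat \/ ((a + b)%R + N = a + b)%N.
Proof.
rewrite /=; have := ltn_ord a; have := ltn_ord b => hb ha.
have [h|h] := ltnP (a + b) N; first by left; rewrite modn_small.
right; have -> : (a + b = (a + b - N) + N)%N by lia.
by rewrite modnDr modn_small //; lia.
Qed.

Lemma dist0N a : dist0 (- a) = dist0 a.
Proof.
rewrite /dist0 /=; have := ltn_ord a.
have [->|a0] := posnP a; first by rewrite subn0 modnn.
by move=> aN; rewrite modn_small; lia.
Qed.

Definition flat p := (dist0 p.2 <= dist0 p.1)%N && (p.1 != 0).
Definition steep p := (dist0 p.1 <= dist0 p.2)%N && (p.2 != 0).
Definition near0 p := (8 * dist0 p.1 < N)%N && (8 * dist0 p.2 < N)%N.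

(** If |b +- 2 a| <= |a| and these values are so small that they add up as
    integers, then |b| >= 2 |a| - |a|; both signs together would give
    4 |a| <= 2 |a|.  So the two shears send the flat cone to disjoint parts of
    the steep one. *)
Lemma shear_steep a b c c' : c = b + a + a -> b = c' + a + a ->
  ((flat (a, c) && near0 (a, c)) + (flat (a, c') && near0 (a, c'))
  <= steep (a, b))%N.
Proof.
move=> cE bE.
have h1 := val_addE b a; have h2 := val_addE (b + a) a.
have h3 := val_addE c' a; have h4 := val_addE (c' + a) a.
rewrite -cE -bE in h1 h2 h3 h4; clear cE bE.
have e0 (i : 'I_N) : (i != 0) = (0 < i)%N by rewrite lt0n.
rewrite /flat /steep /near0 /dist0 /= !e0.
have := ltn_ord a; have := ltn_ord b; have := ltn_ord c; have := ltn_ord c'.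
have := ltn_ord (b + a); have := ltn_ord (c' + a).
move: (nat_of_ord (b + a)) (nat_of_ord (c' + a)) h1 h2 h3 h4 => x y.
move: (nat_of_ord a) (nat_of_ord b) (nat_of_ord c) (nat_of_ord c').
move=> {e0 a b c c'} a b c c' h1 h2 h3 h4 xN yN c'N cN bN aN.
(* one implication for each shear, then disjointness *)
have s1 : (minn c (N - c) <= minn a (N - a))%N && (0 < a)%N &&
    ((8 * minn a (N - a) < N)%N && (8 * minn c (N - c) < N)%N) ->
    (minn a (N - a) <= minn b (N - b))%N && (0 < b)%N.
  by move: h1 h2; clear h3 h4; lia.
have s2 : (minn c' (N - c') <= minn a (N - a))%N && (0 < a)%N &&
    ((8 * minn a (N - a) < N)%N && (8 * minn c' (N - c') < N)%N) ->
    (minn a (N - a) <= minn b (N - b))%N && (0 < b)%N.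
  by move: h3 h4; clear h1 h2 s1; lia.
have s3 : (minn c (N - c) <= minn a (N - a))%N && (0 < a)%N &&
    ((8 * minn a (N - a) < N)%N && (8 * minn c (N - c) < N)%N) ->
  ~~ ((minn c' (N - c') <= minn a (N - a))%N && (0 < a)%N &&
    ((8 * minn a (N - a) < N)%N && (8 * minn c' (N - c') < N)%N)).
  by clear s1 s2; lia.
move: s1 s2 s3; case: (_ && _ && (_ && _)); case: (_ && _ && (_ && _)) => //=.
- by move=> _ _ /(_ isT).
- by move=> ->.
by move=> _ ->.
Qed.

End Shear.
Arguments flat {n} p.
Arguments steep {n} p.
Arguments near0 {n} p.

(** * A uniform spectral gap for the clock, the chirp and the Fourier matrix *)

Section SpectralGap.
Context (R : realType) (n : nat).
Local Notation C := R[i].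
Local Notation N := n.+1.
Implicit Types (a b : 'I_N) (p : 'I_N * 'I_N) (E : pred ('I_N * 'I_N)).
Implicit Types (m u : 'M[C]_N).

Definition mass m E : R := \sum_(p | E p) sqmod (weyl m p.1 p.2).

Lemma mass_sub m E E' : (forall p, E p -> E' p) -> mass m E <= mass m E'.
Proof.
move=> EE'; rewrite /mass big_mkcond [leRHS]big_mkcond /=.
apply: ler_sum => p _; case: ifP => [/EE' ->//|_].
by case: ifP => // _; exact: sqmod_ge0.
Qed.

Lemma mass_subU m E E1 E2 : (forall p, E p -> E1 p || E2 p) ->
  mass m E <= mass m E1 + mass m E2.
Proof.
move=> EE; rewrite /mass big_mkcond 2![X in _ <= _ + X]big_mkcond.
rewrite [X in _ <= X + _]big_mkcond -big_split /=.
apply: ler_sum => p _; have := EE p; have := sqmod_ge0 (weyl m p.1 p.2).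
move: (sqmod _) => s; case: (E p) (E1 p) (E2 p) => [] [] [] h k; try lra; by have := k isT.
Qed.

Lemma mass_le m E : mass m E <= norm2 m ^+ 2.
Proof.
rewrite -parseval pair_big /=; apply: (@mass_sub m E xpredT) => //.
Qed.

Lemma mass_perturb m m' E :
  mass m E <= 5 / 4 * mass m' E + 5 * norm2 (m - m') ^+ 2.
Proof.
apply: (@le_trans _ _ (5 / 4 * mass m' E + 5 * mass (m - m') E)).
  rewrite /mass !mulr_sumr -big_split /=; apply: ler_sum => p _.
  by rewrite weylB sqmod_perturb.
by rewrite lerD2l ler_pM2l ?mass_le.
Qed.

Definition comm_sqr u m : R := norm2 (u * m - m * u) ^+ 2.

Lemma comm_sqr_ge0 u m : 0 <= comm_sqr u m. Proof. exact: sqr_ge0. Qed.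

Lemma comm_sqr_conj u m : u * star u = 1 ->
  norm2 (u * m * star u - m) ^+ 2 <= comm_sqr u m.
Proof.
by move=> uu; rewrite lerXn2r ?nnegrE ?norm2_ge0 ?norm2_conjB.
Qed.

(** A matrix that almost commutes with [u] has almost the same mass as its
    conjugate on every subset of phase space. *)
Lemma mass_conj_le u m E : u * star u = 1 ->
  mass (u * m * star u) E <= 5 / 4 * mass m E + 5 * comm_sqr u m.
Proof.
move=> uu; apply: (le_trans (mass_perturb _ m _)).
by rewrite lerD2l ler_pM2l ?comm_sqr_conj.
Qed.

Lemma mass_conj_ge u m E : u * star u = 1 ->
  mass m E <= 5 / 4 * mass (u * m * star u) E + 5 * comm_sqr u m.
Proof.
move=> uu; apply: (le_trans (mass_perturb _ (u * m * star u) _)).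
rewrite lerD2l ler_pM2l // -opprB norm2N; exact: comm_sqr_conj.
Qed.

Lemma mass_chirp m E :
  mass (chirp R n * m * star (chirp R n)) E =
  mass m (fun p => E (p.1, p.2 + p.1 + p.1)).
Proof.
rewrite /mass (reindex_inj (h := fun p => (p.1, p.2 + p.1 + p.1))) /=; last first.
  apply: (can_inj (g := fun p => (p.1, p.2 - p.1 - p.1))) => -[a b] /=.
  by rewrite !addrK.
by apply: eq_bigr => p _; rewrite weyl_chirp sqmodM sqmod_chi mul1r !addrK.
Qed.

Lemma mass_fourier m E :
  mass (fourier R n * m * star (fourier R n)) E =
  mass m (fun p => E (- p.2, p.1)).
Proof.
rewrite /mass (reindex_inj (h := fun p => (- p.2, p.1))) /=; last first.
  by apply: (can_inj (g := fun p => (p.2, - p.1))) => -[a b]; rewrite /= opprK.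
by apply: eq_bigr => p _; rewrite weyl_fourier sqmodM sqmod_chi mul1r opprK.
Qed.

Lemma gap_arith (U V E W1 W2 T F Z : R) :
  2 * E <= 5 / 4 * V + 10 * T -> V <= 5 / 4 * U + 5 * F ->
  W2 <= 5 / 4 * W1 + 5 * F -> W1 <= Z -> U <= E + (W1 + W2) ->
  0 <= T -> 0 <= F -> 0 <= Z -> U + V <= 100 * (T + F) + 24 * Z.
Proof. lra. Qed.

Lemma gap_arith2 (c Z T F : R) : 0 < c -> 0 <= Z -> 0 <= T -> 0 <= F ->
  100 * (T + F) + 24 * (Z / c) <= (100 + 24 / c) * (Z + T + F).
Proof.
move=> c0 Z0 T0 F0; have : 0 < c^-1 by rewrite invr_gt0.
move: c^-1 => d d0; nra.
Qed.

(** The constant does not depend on the size of the matrix, which is what makes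
    the estimate survive in the ultraproduct. *)
Theorem spectral_gap m :
  norm2 (m - trace m *: 1) ^+ 2 <= (100 + 24 / cutoff R) *
    (comm_sqr (clock R n) m + comm_sqr (chirp R n) m + comm_sqr (fourier R n) m).
Proof.
set dZ := comm_sqr (clock R n) m; set dT := comm_sqr (chirp R n) m.
set dF := comm_sqr (fourier R n) m.
have uZ := clock_unitary R n; have uT := chirp_unitary R n.
have uF := fourier_unitary R n.
pose E p := flat p && near0 p.
(* the chirp and its inverse move the central part of the flat cone to disjoint parts of the steep cone *)
have hE : 2 * mass m E <= 5 / 4 * mass m steep + 10 * dT.
  have h1 := mass_conj_ge m E uT; rewrite mass_chirp in h1.
  pose E' p := E (p.1, p.2 - p.1 - p.1).
  have h2 := mass_conj_le m E' uT; rewrite mass_chirp in h2.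
  have EE : mass m (fun p => E' (p.1, p.2 + p.1 + p.1)) = mass m E.
    by apply: eq_bigl => -[a b]; rewrite /E' /= !addrK.
  rewrite EE in h2.
  have : mass m (fun p => E (p.1, p.2 + p.1 + p.1)) + mass m E'
      <= mass m steep.
    rewrite /mass big_mkcond [X in _ + X <= _]big_mkcond [leRHS]big_mkcond.
    rewrite -big_split; apply: ler_sum => -[a b] _ /=.
    have := shear_steep (erefl (b + a + a)) (c' := b - a - a).
    rewrite !subrK => /(_ erefl); rewrite -!/(E _) /E' /=.
    have := sqmod_ge0 (weyl m a b).
    by case: (E _) (E _) (steep _) => [] [] [] //= h _; lra.
  by rewrite -/dT in h1 h2; lra.
(* the quarter turn exchanges the two cones *)
have hV : mass m steep <= 5 / 4 * mass m flat + 5 * dF.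
  have := mass_conj_ge m steep uF; rewrite mass_fourier -/dF.
  have -> // : mass m (fun p => steep (- p.2, p.1)) = mass m flat.
  by apply: eq_bigl => -[a b]; rewrite /steep /flat /= dist0N.
pose W1 p := (N <= 8 * dist0 p.1)%N; pose W2 p := (N <= 8 * dist0 p.2)%N.
have hW2 : mass m W2 <= 5 / 4 * mass m W1 + 5 * dF.
  have := mass_conj_ge m W2 uF; rewrite mass_fourier -/dF.
  have -> // : mass m (fun p => W2 (- p.2, p.1)) = mass m W1 by [].
(* far from the axis the clock multiplies by a phase at distance at least sqrt cutoff from 1 *)
have hW1 : mass m W1 <= dZ / cutoff R.
  rewrite ler_pdivlMr ?cutoff_gt0 //.
  have hZ : norm2 (clock R n * m * star (clock R n) - m) ^+ 2 <= dZ.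
    exact: comm_sqr_conj.
  apply: le_trans hZ; apply: le_trans (mass_le _ W1); rewrite /mass mulr_suml ler_sum // => p W1p.
  rewrite weylB weyl_clock -[X in _ - X]mul1r -mulrBl [leRHS]sqmodM mulrC.
  rewrite ler_wpM2r ?sqmod_ge0 // zeta_far //.
    by move: W1p; rewrite /W1 /dist0; move: (nat_of_ord p.1) => x; lia.
  by move: W1p; rewrite /W1 /dist0; move: (nat_of_ord p.1) => x; lia.
have hU : mass m flat <= mass m E + (mass m W1 + mass m W2).
  apply: le_trans (@mass_subU m flat E (fun p => W1 p || W2 p) _) _.
    by move=> p; rewrite /E /near0 /W1 /W2 => ->; lia.
  by rewrite lerD2l; apply: mass_subU.
have hall : norm2 (m - trace m *: 1) ^+ 2 <= mass m flat + mass m steep.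
  rewrite -parseval pair_big /=.
  apply: le_trans (mass_subU m _ (E := fun p => p != 0)).
    rewrite /mass [leRHS]big_mkcond; apply: ler_sum => -[a b] _ /=.
    rewrite weylB weyl_scalar -[(a, b) == 0]/((a == 0) && (b == 0)).
    case: andP => [[/eqP-> /eqP->]|_] /=.
      by rewrite weyl00 subrr sqmod_rc expr0n.
    by rewrite subr0.
  move=> [a b]; rewrite -[(a, b) == 0]/((a == 0) && (b == 0)).
  rewrite /flat /steep /dist0 /= -!val_eqE /=.
  by have := ltn_ord a; have := ltn_ord b; lia.
have c0 := @cutoff_gt0 R.
have dZ0 : 0 <= dZ / cutoff R by rewrite divr_ge0 ?comm_sqr_ge0 ?ltW.
have dZ1 : 0 <= dZ by exact: comm_sqr_ge0.
have dT1 : 0 <= dT by exact: comm_sqr_ge0.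
have dF1 : 0 <= dF by exact: comm_sqr_ge0.
apply: (le_trans hall); apply: (le_trans (gap_arith hE hV hW2 hW1 hU dT1 dF1 dZ0)).
exact: gap_arith2.
Qed.

End SpectralGap.

(** * The inner product of a trace and orthonormal families *)

Section TraceInnerProduct.
Context (R : realType) (T : tracialAlgType R).
Local Notation C := R[i].
Implicit Types (x y z : T).

Lemma trace_sum (I : Type) (r : seq I) (P : pred I) (F : I -> T) :
  trace (\sum_(i <- r | P i) F i) = \sum_(i <- r | P i) trace (F i).
Proof. by apply: (big_morph _ (@traceD R T) (trace0 T)). Qed.

Lemma star_sum (I : Type) (r : seq I) (P : pred I) (F : I -> T) :
  star (\sum_(i <- r | P i) F i) = \sum_(i <- r | P i) star (F i).
Proof. by apply: (big_morph _ (@starD R T) (star0 T)). Qed.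

Lemma starB x y : star (x - y) = star x - star y.
Proof. by rewrite starD starN. Qed.

Lemma traceB x y : trace (x - y) = trace x - trace y.
Proof. by rewrite traceD traceN. Qed.

Definition ip x y : C := trace (star y * x).

Lemma ipxx x : ip x x = (norm2 x ^+ 2)%:C.
Proof. exact: norm2E. Qed.

Lemma norm2_eq0 x : norm2 x = 0 -> x = 0.
Proof. by move=> x0; apply: trace_faithful; rewrite norm2E x0 expr0n. Qed.

Lemma norm2_gt0 x : x != 0 -> 0 < norm2 x.
Proof.
move=> x0; rewrite lt_def norm2_ge0 andbT.
by apply: contra x0 => /eqP/norm2_eq0 ->.
Qed.

Lemma ipDl x y z : ip (x + y) z = ip x z + ip y z.
Proof. by rewrite /ip mulrDr traceD. Qed.

Lemma ipBl x y z : ip (x - y) z = ip x z - ip y z.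
Proof. by rewrite /ip mulrBr traceB. Qed.

Lemma ipZl a x y : ip (a *: x) y = a * ip x y.
Proof. by rewrite /ip -scalerAr traceZ. Qed.

Lemma ipZr a x y : ip x (a *: y) = a^*%R * ip x y.
Proof. by rewrite /ip starZ -scalerAl traceZ. Qed.

Lemma ipDr x y z : ip x (y + z) = ip x y + ip x z.
Proof. by rewrite /ip starD mulrDl traceD. Qed.

Lemma ip0l y : ip 0 y = 0.
Proof. by rewrite /ip mulr0 trace0. Qed.

Lemma ip_suml (I : Type) (r : seq I) (P : pred I) (F : I -> T) y :
  ip (\sum_(i <- r | P i) F i) y = \sum_(i <- r | P i) ip (F i) y.
Proof. by rewrite /ip mulr_sumr trace_sum. Qed.

Lemma ip_sumr (I : Type) (r : seq I) (P : pred I) (F : I -> T) x :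
  ip x (\sum_(i <- r | P i) F i) = \sum_(i <- r | P i) ip x (F i).
Proof. by rewrite /ip star_sum mulr_suml trace_sum. Qed.

(** Positivity of [ip] on x + y and on x + i y forces hermitian symmetry. *)
Lemma ip_conj x y : ip y x = (ip x y)^*%R.
Proof.
have real z : complex.Im (ip z z) = 0 by rewrite ipxx.
have h1 := real (x + y); have h2 := real (x + 'i *: y).
rewrite !(ipDl, ipDr, ipZl, ipZr) !raddfD /= !real in h1 h2.
move: h1 h2; case: (ip x y) (ip y x) => [u v] [s t] /=.
have -> : ip y y = (complex.Re (ip y y))%:C by rewrite ipxx.
rewrite /= => h1 h2; apply/eqP; rewrite eq_complex /=.
by apply/andP; split; apply/eqP; lra.
Qed.

Lemma norm2_pythagoras x y : ip x y = 0 ->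
  norm2 (x + y) ^+ 2 = norm2 x ^+ 2 + norm2 y ^+ 2.
Proof.
move=> xy; apply: complexI; rewrite rcD -!ipxx !(ipDl, ipDr) xy.
by rewrite (ip_conj x y) xy rmorph0 addr0 add0r.
Qed.

Lemma trace_star x : trace (star x) = (trace x)^*%R.
Proof. by have := ip_conj x 1; rewrite /ip star1 mulr1 mul1r. Qed.

Definition orthonormal_family n (a : nat -> T) : Prop :=
  forall i j, (i < n)%N -> (j < n)%N -> ip (a i) (a j) = (i == j)%:R.

Definition spans (I : finType) (b : I -> T) (S : set T) : Prop :=
  forall x, S x -> exists c : I -> C, x = \sum_i c i *: b i.

(** The Gram matrix of the family factors through a space with as many
    dimensions as there are spanning vectors. *)
Lemma orthonormal_le n (a : nat -> T) (I : finType) (b : I -> T) (S : set T) :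
  spans b S -> (forall i, (i < n)%N -> S (a i)) -> orthonormal_family n a ->
  (n <= #|I|)%N.
Proof.
move=> bS aS an.
have /choice[c hc] (i : 'I_n) : exists c : I -> C, a i = \sum_k c k *: b k.
  exact/bS/aS.
pose M := \matrix_(i < n, k < #|I|) c i (enum_val k).
pose G := \matrix_(k < #|I|, l < #|I|) ip (b (enum_val k)) (b (enum_val l)).
pose M' := \matrix_(l < #|I|, i < n) (c i (enum_val l))^*%R.
have E : M *m (G *m M') = 1%:M.
  apply/matrixP => i j; rewrite !mxE -[RHS](an i j) // !hc ip_suml.
  rewrite [RHS](reindex (@enum_val I predT)) /=; last first.
    by apply: onW_bij; apply: enum_val_bij.
  apply: eq_bigr => k _; rewrite ipZl !mxE; congr (_ * _).
  rewrite ip_sumr [RHS](reindex (@enum_val I predT)) /=; last first.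
    by apply: onW_bij; apply: enum_val_bij.
  by apply: eq_bigr => l _; rewrite ipZr !mxE mulrC.
rewrite -[n in (n <= _)%N](mxrank1 C) -E.
exact: leq_trans (mxrankM_maxl _ _) (rank_leq_col _).
Qed.

Definition linear_subspace (S : set T) : Prop :=
  S 0 /\ forall a x y, S x -> S y -> S (a *: x + y).

Section Subspace.
Variables (S : set T) (lS : linear_subspace S).

Lemma sub0 : S 0. Proof. by case: lS. Qed.

Lemma subZ a x : S x -> S (a *: x).
Proof. by move=> Sx; rewrite -[_ *: _]addr0; apply: lS.2 => //; exact: sub0. Qed.

Lemma subD x y : S x -> S y -> S (x + y).
Proof. by move=> Sx Sy; rewrite -[x]scale1r; apply: lS.2. Qed.

Lemma subB x y : S x -> S y -> S (x - y).
Proof. by move=> Sx Sy; rewrite addrC -scaleN1r; apply: lS.2. Qed.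

Lemma sub_sum (I : Type) (r : seq I) (P : pred I) (F : I -> T) :
  (forall i, P i -> S (F i)) -> S (\sum_(i <- r | P i) F i).
Proof. by move=> SF; elim/big_ind: _ => //; [exact: sub0|exact: subD]. Qed.

(** A maximal orthonormal family of [S] spans [S]: the component of an element
    of [S] orthogonal to the family could otherwise be normalized and added. *)
Lemma onb_exists_bound d :
  (forall n a, (forall i, (i < n)%N -> S (a i)) -> orthonormal_family n a ->
    (n <= d)%N) ->
  exists n a, [/\ (n <= d)%N, forall i, (i < n)%N -> S (a i),
    orthonormal_family n a & forall x, S x -> x = \sum_(i < n) ip x (a i) *: a i].
Proof.
move=> bd.
pose P n := `[< exists a, (forall i, (i < n)%N -> S (a i)) /\ orthonormal_family n a >].
have P0 : exists n, P n by exists 0%N; apply/asboolP; exists (fun=> 0); split.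
have Pb n : P n -> (n <= d)%N by move=> /asboolP[a [Sa an]]; exact: bd Sa an.
case: (ex_maxnP P0 Pb) => n Pn nmax; move/asboolP: (Pn) => [a [Sa an]].
exists n, a; split=> // [|x Sx]; first exact: Pb.
apply/eqP; rewrite -subr_eq0; apply: contrapT => /negP y0.
set y := x - _ in y0.
have Sy : S y.
  by apply: subB => //; apply: sub_sum => i _; apply: subZ; exact: Sa.
have ya j : (j < n)%N -> ip y (a j) = 0.
  move=> jn; rewrite ipBl ip_suml (bigD1 (Ordinal jn)) //= big1.
    by rewrite ipZl an // eqxx mulr1 addr0 subrr.
  by move=> i ij; rewrite ipZl an // -val_eqE /= in ij *; rewrite (negPf ij) mulr0.
have y_gt0 := norm2_gt0 y0.
pose u := (norm2 y)^-1%:C *: y.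
have uu : ip u u = 1.
  rewrite ipZl ipZr ipxx -[X in _ * (X * _)]/(((norm2 y)^-1%:C)^*%C) /= oppr0.
  by rewrite -!rcM expr2 mulKf ?mulVf ?gt_eqF.
have ua j : (j < n)%N -> ip u (a j) = 0.
  by move=> jn; rewrite ipZl ya ?mulr0.
have /nmax : P n.+1; last by rewrite ltnn.
apply/asboolP; exists (fun i => if (i < n)%N then a i else u); split.
  by move=> i _; case: ifP => // [/Sa//|_]; exact: subZ.
move=> i j; rewrite !ltnS [(i <= _)%N]leq_eqVlt [(j <= _)%N]leq_eqVlt.
have [->|ni] := eqVneq i n; have [->|nj] := eqVneq j n; rewrite ?ltnn //= => hi hj.
- by rewrite hj ua // eq_sym (negPf nj).
- by rewrite hi ip_conj ua // rmorph0 (negPf ni).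
- by rewrite hi hj an.
Qed.

Lemma onb_exists (I : finType) (b : I -> T) : spans b S ->
  exists n a, [/\ (n <= #|I|)%N, forall i, (i < n)%N -> S (a i),
    orthonormal_family n a & forall x, S x -> x = \sum_(i < n) ip x (a i) *: a i].
Proof.
by move=> bS; apply: onb_exists_bound => n a; exact: orthonormal_le bS.
Qed.

Lemma orth_proj_exists (I : finType) (b : I -> T) x : spans b S ->
  exists2 y, S y & forall z, S z -> ip (x - y) z = 0.
Proof.
move=> /onb_exists[n [a [_ Sa an aS]]].
exists (\sum_(i < n) ip x (a i) *: a i).
  by apply: sub_sum => i _; apply: subZ; exact: Sa.
move=> z /aS {1}->; rewrite ip_sumr big1 // => j _; rewrite ipZr.
rewrite ipBl ip_suml (bigD1 j) //= big1 => [|i ij].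
  by rewrite ipZl an // eqxx mulr1 addr0 subrr mulr0.
by rewrite ipZl an // -val_eqE /= in ij *; rewrite (negPf ij) mulr0.
Qed.

End Subspace.
End TraceInnerProduct.

(** * Projections and minimal projections in finite-dimensional star-algebras *)

Section Projections.
Context (R : realType) (T : tracialAlgType R).
Local Notation C := R[i].
Implicit Types (x y z e p q : T).

Lemma star_mul_eq0 x : star x * x = 0 -> x = 0.
Proof. by move=> xx; apply: trace_faithful; rewrite xx trace0. Qed.

Definition projection p : Prop := p * p = p /\ star p = p.

Definition tr x : R := complex.Re (trace x).

Lemma trace_proj p : projection p -> trace p = (norm2 p ^+ 2)%:C.
Proof. by case=> pp sp; rewrite -norm2E sp pp. Qed.

Lemma tr_proj p : projection p -> tr p = norm2 p ^+ 2.
Proof. by move=> /trace_proj; rewrite /tr => ->. Qed.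

Lemma trace_projE p : projection p -> trace p = (tr p)%:C.
Proof. by move=> pp; rewrite tr_proj // trace_proj. Qed.

Lemma tr_ge0 p : projection p -> 0 <= tr p.
Proof. by move=> /tr_proj ->; exact: sqr_ge0. Qed.

Lemma tr_gt0 p : projection p -> p != 0 -> 0 < tr p.
Proof. by move=> /tr_proj -> p0; rewrite exprn_gt0 ?norm2_gt0. Qed.

Lemma tr1 : tr (1 : T) = 1.
Proof. by rewrite /tr trace1. Qed.

Lemma trB x y : tr (x - y) = tr x - tr y.
Proof. by rewrite /tr traceB raddfB. Qed.

Lemma trD x y : tr (x + y) = tr x + tr y.
Proof. by rewrite /tr traceD raddfD. Qed.

Lemma tr_sum (I : Type) (r : seq I) (P : pred I) (F : I -> T) :
  tr (\sum_(i <- r | P i) F i) = \sum_(i <- r | P i) tr (F i).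
Proof. by rewrite /tr trace_sum raddf_sum. Qed.

Lemma proj0 : projection 0.
Proof. by split; rewrite ?mulr0 ?star0. Qed.

Lemma proj1 : projection 1.
Proof. by split; rewrite ?mulr1 ?star1. Qed.

Lemma projD p q : projection p -> projection q -> p * q = 0 ->
  projection (p + q).
Proof.
move=> [pp sp] [qq sq] pq; have qp : q * p = 0.
  by rewrite -[q * p]starK starM sp sq pq star0.
by split; rewrite ?starD ?sp ?sq // mulrDl !mulrDr pp qq pq qp addr0 add0r.
Qed.

Lemma projB p q : projection p -> projection q -> p * q = q ->
  projection (p - q).
Proof.
move=> [pp sp] [qq sq] pq; have qp : q * p = q.
  by rewrite -[q * p]starK starM sp sq pq sq.
by split; rewrite ?starB ?sp ?sq // mulrBl !mulrBr pp qq pq qp subrr subr0.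
Qed.

Lemma proj_tr_le1 p : projection p -> tr p <= 1.
Proof.
move=> pp; rewrite -subr_ge0 -tr1 -trB; apply: tr_ge0.
by apply: projB => //; [exact: proj1|rewrite mul1r].
Qed.

(** A unit is not required, so that corners are covered. *)
Definition star_closed (S : set T) : Prop :=
  [/\ S 0, forall (a : C) x y, S x -> S y -> S (a *: x + y),
      forall x y, S x -> S y -> S (x * y) & forall x, S x -> S (star x)].

Lemma star_closed_linear S : star_closed S -> linear_subspace S.
Proof. by case=> S0 Sl _ _; split. Qed.

Definition finite_span (S : set T) : Prop :=
  exists (I : finType) (b : I -> T), spans b S.

(** A minimal projection, in the strong form: the corner it cuts out consists of
    its multiples. *)
Definition atom (D : set T) e : Prop :=
  [/\ projection e, D e, e != 0 &
      forall y, D y -> exists c : C, e * y * e = c *: e].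

Definition orth_family n (f : nat -> T) : Prop :=
  forall i j, (i < n)%N -> (j < n)%N -> i != j -> f i * f j = 0.

Section FiniteDimensional.
Variables (D : set T) (sD : star_closed D) (fD : finite_span D).
Let lD := star_closed_linear sD.

Let DM x y : D x -> D y -> D (x * y). Proof. by case: sD => _ _ + _; apply. Qed.
Let Dstar x : D x -> D (star x). Proof. by case: sD => _ _ _; apply. Qed.

Lemma linear_dependence (I : finType) (b : I -> T) (S : set T) (x : nat -> T) :
  spans b S -> (forall i, (i < #|I|.+1)%N -> S (x i)) ->
  exists2 a : 'I_#|I|.+1 -> C, exists i, a i != 0 & \sum_i a i *: x i = 0.
Proof.
move=> bS xS.
have /choice[c hc] (i : 'I_#|I|.+1) : exists c : I -> C,
    x i = \sum_k c k *: b k by exact/bS/xS.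
pose M := \matrix_(i < #|I|.+1, k < #|I|) c i (enum_val k).
have : kermx M != 0.
  rewrite kermx_eq0 /row_free neq_ltn; apply/orP; left.
  by rewrite ltnS rank_leq_col.
case/rowV0Pn => v /sub_kermxP vM v0.
exists (fun i => v 0 i).
  apply: contrapT => /forallNP h; move/eqP: v0; apply.
  by apply/rowP => i; rewrite mxE; have /negP/negPn/eqP := h i.
rewrite (eq_bigr (fun i => \sum_k (v 0 i * c i k) *: b k)); last first.
  by move=> i _; rewrite hc scaler_sumr; apply: eq_bigr => k _; rewrite scalerA.
rewrite exchange_big big1 //= => k _; rewrite -scaler_suml.
suff -> : \sum_i v 0 i * c i k = 0 by rewrite scale0r.
have /rowP/(_ (enum_rank k)) := vM; rewrite !mxE => vM0; rewrite -[RHS]vM0.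
by apply: eq_bigr => i _; rewrite !mxE enum_rankK.
Qed.

Lemma sub_horner y e (P : {poly C}) : D y -> D e -> D (horner_alg y P * e).
Proof.
move=> Dy; elim/poly_ind: P e => [|P c IH] e De.
  by rewrite rmorph0 mul0r; apply: sub0 lD.
rewrite rmorphD rmorphM /= horner_algX horner_algC mulrDl.
rewrite -mulrA; apply: (subD lD); first by apply: IH; apply: DM.
by rewrite -scalerAl mul1r; apply: (subZ lD).
Qed.

Lemma comm_horner y e (P : {poly C}) : e * y = y * e ->
  e * horner_alg y P = horner_alg y P * e.
Proof.
move=> ey; elim/poly_ind: P => [|P c IH]; first by rewrite rmorph0 mul0r mulr0.
rewrite rmorphD rmorphM /= horner_algX horner_algC mulrDl mulrDr mulrA IH.
by rewrite -!mulrA ey -scalerAl -scalerAr mul1r mulr1.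
Qed.

Lemma star_horner y (P : {poly C}) : star y = y ->
  star (horner_alg y P) = horner_alg y (map_poly Num.conj P).
Proof.
move=> sy; elim/poly_ind: P => [|P c IH]; first by rewrite !rmorph0 star0.
rewrite !rmorphD !rmorphM /= map_polyX map_polyC /= !horner_algX !horner_algC.
by rewrite starD starM IH sy starZ star1 comm_horner.
Qed.

Lemma horner_eigen y w l (P : {poly C}) : y * w = l *: w ->
  horner_alg y P * w = P.[l] *: w.
Proof.
move=> yw; elim/poly_ind: P => [|P c IH].
  by rewrite rmorph0 mul0r horner0 scale0r.
rewrite rmorphD rmorphM /= horner_algX horner_algC mulrDl -mulrA yw.
by rewrite -scalerAr IH -scalerAl mul1r hornerMXaddC scalerA scalerDl mulrC.
Qed.

(** A replacement for the spectral theorem.  Take a nonzero polynomial P of least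
    degree with P(y) e = 0, a root l of P and P = Q * ('X - l); then
    w = Q(y) e is a nonzero eigenvector of y. Since w is built from y,
    star w * w is again a multiple of w, so that w is proportional to a
    projection. *)
Lemma eigenprojection e y : projection e -> D e -> e != 0 ->
  D y -> star y = y -> e * y = y -> y * e = y ->
  exists q l, [/\ projection q, D q, q != 0, e * q = q & y * q = l *: q].
Proof.
move=> [ee se] De e0 Dy sy ey ye.
have eyC : e * y = y * e by rewrite ey ye.
pose kills (P : {poly C}) := horner_alg y P * e = 0.
pose deg n := `[< exists P, [/\ P != 0, kills P & size P = n] >].
have ex_deg : exists n, deg n.
  have [I [b bD]] := fD.
  have [|a [i ai] a0] := @linear_dependence _ b D (fun k => y ^+ k * e) bD.
    move=> k _; have -> : y ^+ k = horner_alg y 'X^k.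
      by rewrite rmorphXn /= horner_algX.
    exact: sub_horner.
  pose P := \poly_(k < #|I|.+1) a (inord k).
  exists (size P); apply/asboolP; exists P; split=> //.
    apply/eqP => /(congr1 (fun p : {poly C} => p`_i)).
    by rewrite coef_poly ltn_ord inord_val coef0 => /eqP; rewrite (negPf ai).
  rewrite /kills /P poly_def linear_sum mulr_suml -[RHS]a0.
  apply: eq_bigr => k _; rewrite inord_val linearZ /= rmorphXn /= horner_algX.
  by rewrite -!scalerAl mul1r.
case: (ex_minnP ex_deg) => n /asboolP[P [P0 Pe Pn]] nmin.
have [l Pl] : exists l, root P l.
  apply/closed_rootP; apply/eqP => /eqP/size_poly1P[c c0 Pc].
  move: Pe; rewrite /kills Pc horner_algC -scalerAl mul1r => /eqP.
  by rewrite scaler_eq0 (negPf c0) (negPf e0).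
have [Q PQ] := factor_theorem P l Pl.
have Q0 : Q != 0 by apply: contraNneq P0 => Q0; rewrite PQ Q0 mul0r.
pose w := horner_alg y Q * e.
have w0 : w != 0.
  apply/eqP => w0; have /nmin : deg (size Q) by apply/asboolP; exists Q.
  by rewrite -Pn PQ size_mul ?polyXsubC_eq0 // size_XsubC addn2 ltnn.
have yw : y * w = l *: w.
  apply/eqP; rewrite -subr_eq0; apply/eqP.
  move: Pe; rewrite /kills PQ mulrC rmorphM rmorphB /= horner_algX horner_algC.
  by rewrite -mulrA mulrBl -scalerAl mul1r.
have ew : e * w = w by rewrite mulrA comm_horner // -mulrA ee.
pose k := (map_poly Num.conj Q).[l].
have ww : star w * w = k *: w.
  rewrite {1}/w starM se star_horner // -mulrA (horner_eigen _ yw) -scalerAr.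
  by rewrite ew.
have k0 : k != 0.
  apply/eqP => k0; move: ww; rewrite k0 scale0r => ww0.
  by case/eqP: w0; exact: star_mul_eq0.
have kc0 : k^*%R != 0 by rewrite conjC_eq0.
have sw : k^*%R *: star w = k *: w by rewrite -starZ -ww starM starK.
have Dw : D w by exact: sub_horner.
pose q := (k^*%R)^-1 *: w.
have sq : star q = q.
  rewrite starZ rmorphV ?unitfE //= conjCK.
  apply: (scalerI kc0); rewrite [RHS]scalerA mulfV // scale1r.
  apply: (scalerI k0); rewrite -sw !scalerA; congr (_ *: _).
  by rewrite mulrAC mulfV ?mul1r.
exists q, l; split.
- split=> //; rewrite -{1}sq starZ rmorphV ?unitfE //= conjCK.
  rewrite -scalerAl -scalerAr ww !scalerA; congr (_ *: _).
  by rewrite mulrAC mulVf ?mul1r.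
- exact: subZ.
- by rewrite scaler_eq0 invr_eq0 (negPf kc0).
- by rewrite -scalerAr ew.
- by rewrite -scalerAr yw !scalerA mulrC.
Qed.

End FiniteDimensional.
End Projections.

Section Atoms.
Context (R : realType) (T : tracialAlgType R).
Local Notation C := R[i].
Implicit Types (x y z e p q : T).

Lemma proj_orth_sym p q : projection p -> projection q -> p * q = 0 -> q * p = 0.
Proof. by move=> [_ sp] [_ sq] pq; rewrite -[q * p]starK starM sp sq pq star0. Qed.

Lemma proj_absorb_sym p q : projection p -> projection q -> p * q = q -> q * p = q.
Proof. by move=> [_ sp] [_ sq] pq; rewrite -[q * p]starK starM sp sq pq sq. Qed.

Lemma orth_family_lt n (f : nat -> T) :
  (forall i, (i < n)%N -> projection (f i)) ->
  (forall i j, (i < j)%N -> (j < n)%N -> f i * f j = 0) -> orth_family n f.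
Proof.
move=> pf fl i j ij jn; rewrite neq_ltn => /orP[|] h; first exact: fl.
by apply: proj_orth_sym; [exact: pf|exact: pf|exact: fl].
Qed.

Lemma proj_sum n (f : nat -> T) :
  (forall i, (i < n)%N -> projection (f i)) -> orth_family n f ->
  forall k, (k <= n)%N -> projection (\sum_(i < k) f i).
Proof.
move=> pf of_; elim=> [|k IH] kn; first by rewrite big_ord0; exact: proj0.
rewrite big_ord_recr /=; apply: projD; [exact/IH/ltnW|exact: pf|].
rewrite mulr_suml big1 // => i _; apply: of_ => //; first by apply: ltn_trans kn.
by rewrite neq_ltn ltn_ord.
Qed.

(** Nonzero orthogonal projections become orthonormal after normalization. *)
Lemma orth_family_le n (f : nat -> T) (I : finType) (b : I -> T) (S : set T) :
  spans b S -> (forall i, (i < n)%N -> [/\ projection (f i), f i != 0 & S (f i)]) ->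
  orth_family n f -> (n <= #|I|)%N.
Proof.
move=> bS Pf of_.
pose a i := (norm2 (f i))^-1%:C *: f i.
pose S' : set T := [set x | exists c : C, exists2 y, S y & x = c *: y].
apply: (@orthonormal_le R T n a I b S').
- move=> _ [c [y /bS[d ->] ->]]; exists (fun i => c * d i).
  by rewrite scaler_sumr; apply: eq_bigr => i _; rewrite scalerA.
- by move=> i /Pf[_ _ Sf]; exists (norm2 (f i))^-1%:C, (f i).
move=> i j hi hj; have [pi fi0 _] := Pf i hi; have [pj _ _] := Pf j hj.
rewrite /a ipZl ipZr /ip; case: pj => _ ->.
have [<-|ij] := eqVneq i j; last first.
  by rewrite of_ // 1?eq_sym // trace0 !mulr0.
case: (pi) => -> _; rewrite trace_proj //.
rewrite -[X in _ * (X * _)]/(((norm2 (f i))^-1%:C)^*%C) /= oppr0 -!rcM expr2.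
by rewrite mulKf ?mulVf ?gt_eqF ?norm2_gt0.
Qed.

Section Decomposition.
Variables (D : set T) (sD : star_closed D) (fD : finite_span D).
Let lD := star_closed_linear sD.

Let DM x y : D x -> D y -> D (x * y). Proof. by case: sD => _ _ + _; apply. Qed.
Let Dstar x : D x -> D (star x). Proof. by case: sD => _ _ _; apply. Qed.

(** A self-adjoint element of the corner of [e] has an eigenprojection below
    [e], which must be [e]; the general case follows by real and imaginary
    parts. *)
Lemma atomI e : projection e -> D e -> e != 0 ->
  (forall q, projection q -> D q -> q != 0 -> e * q = q -> q = e) -> atom D e.
Proof.
move=> pe De e0 emin; have [ee se] := pe; split=> // y Dy.
have sa u : D u -> star u = u -> exists c : C, e * u * e = c *: e.
  move=> Du su.
  have [||||q [l [pq Dq q0 eq uq]]] := eigenprojection sD fD pe De e0 (y := e * u * e).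
  - exact/DM/De/DM.
  - by rewrite !starM se su mulrA.
  - by rewrite !mulrA ee.
  - by rewrite -!mulrA ee.
  exists l; move: uq; rewrite (emin q) // => <-.
  by rewrite -!mulrA ee.
have [c hc] : exists c : C, e * (y + star y) * e = c *: e.
  apply: sa; first by apply: (subD lD) => //; exact: Dstar.
  by rewrite starD starK addrC.
have [d hd] : exists d : C, e * ('i *: (y - star y)) * e = d *: e.
  apply: sa; first by apply: (subZ lD); apply: (subB lD) => //; exact: Dstar.
  by rewrite starZ starB starK conjCi scaleNr -scalerN opprB.
exists (2^-1 * c - 2^-1 * 'i * d).
have -> : y = 2^-1 *: (y + star y) - (2^-1 * 'i) *: ('i *: (y - star y)).
  rewrite scalerA -mulrA -expr2 sqrCi mulrN1 scaleNr opprK -scalerDr.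
  rewrite addrACA subrr addr0 -[y + y]mulr2n -[y *+ 2]scaler_nat scalerA.
  by rewrite mulVf ?pnatr_eq0 // scale1r.
move: (y + star y) ('i *: (y - star y)) hc hd => u v hc hd.
by rewrite mulrBr mulrBl -!(scalerAr, scalerAl) hc hd !scalerA scalerBl.
Qed.

(** A family of orthogonal nonzero projections below [e] of maximal length works:
    a gap below [e] could be filled, and a member that is not minimal could be
    split in two. *)
Lemma atom_decomp e : projection e -> D e ->
  exists n f, [/\ forall i, (i < n)%N -> atom D (f i),
    forall i, (i < n)%N -> e * f i = f i, orth_family n f & e = \sum_(i < n) f i].
Proof.
move=> pe De; have [I [b bD]] := fD.
pose good n f := (forall i, (i < n)%N ->
  [/\ projection (f i), f i != 0, D (f i) & e * f i = f i]) /\ orth_family n f.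
pose P n := `[< exists f, good n f >].
have P0 : exists n, P n by exists 0%N; apply/asboolP; exists (fun=> 0); split.
have Pb n : P n -> (n <= #|I|)%N.
  move=> /asboolP[f [Pf of_]]; apply: orth_family_le bD _ of_ => i /Pf[] //.
case: (ex_maxnP P0 Pb) => n /asboolP[f [Pf of_]] nmax.
have no_bigger g : ~ good n.+1 g.
  by move=> gg; have /nmax : P n.+1; [apply/asboolP; exists g|rewrite ltnn].
have pf i : (i < n)%N -> projection (f i) by move=> /Pf[].
exists n, f; split=> //; last first.
- pose s := \sum_(i < n) f i.
  have ps : projection s by exact: proj_sum pf of_ n (leqnn n).
  have es : e * s = s.
    by rewrite mulr_sumr; apply: eq_bigr => i _; case: (Pf i (ltn_ord i)).
  apply/eqP; rewrite -subr_eq0; apply: contrapT => /negP s0.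
  have pes : projection (e - s) by exact: projB.
  apply: (no_bigger (fun k => if (k < n)%N then f k else e - s)).
  have sf i : (i < n)%N -> s * f i = f i.
    move=> hi; rewrite mulr_suml (bigD1 (Ordinal hi)) //= big1.
      by rewrite addr0; case: (pf i hi).
    by move=> j ji; apply: of_ => //.
  have fI i : (i < n.+1)%N -> [/\ projection (if (i < n)%N then f i else e - s),
      (if (i < n)%N then f i else e - s) != 0, D (if (i < n)%N then f i else e - s) &
      e * (if (i < n)%N then f i else e - s) = if (i < n)%N then f i else e - s].
    move=> _; case: ifP => [/Pf//|_]; split=> //.
      by apply: (subB lD) => //; apply: (sub_sum lD) => i' _; case: (Pf i' (ltn_ord i')).
    by rewrite mulrBr es; case: pe => ->.
  split=> //; apply: orth_family_lt => [i /fI[]//|i j ij].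
  rewrite ltnS leq_eqVlt => /orP[/eqP jn|jn].
    rewrite jn ltnn -jn ij; apply: proj_orth_sym; [exact: pes| |].
      by apply: pf; rewrite -jn.
    rewrite mulrBl sf -?jn //; have [] := Pf i; rewrite -?jn // => _ _ _ ->.
    by rewrite subrr.
  by rewrite jn (ltn_trans ij jn); apply: of_; rewrite ?(ltn_trans ij jn) // neq_ltn ij.
- by move=> i /Pf[].
move=> i hi; have [pi fi0 Di ei] := Pf i hi.
apply: atomI => // q pq Dq q0 fq; apply: contrapT => qf.
have qf' : q * f i = q by exact: proj_absorb_sym.
have pfq : projection (f i - q) by exact: projB.
(* f i is replaced by q, and f i - q is appended *)
pose g k := if k == n then f i - q else if k == i then q else f k.
have gI k : (k < n.+1)%N -> [/\ projection (g k), g k != 0, D (g k) & e * g k = g k].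
  rewrite ltnS leq_eqVlt /g; case: eqP => [_ _|_ /= hk].
    split=> //; [|exact: (subB lD)|].
      by rewrite subr_eq0; apply/eqP => h; apply: qf.
    by rewrite mulrBr ei -{1}fq mulrA ei fq.
  case: eqP => [_|_]; last exact: Pf.
  by split=> //; rewrite -{1}fq mulrA ei fq.
apply: (no_bigger g); split=> //.
apply: orth_family_lt => [k /gI[]//|k j kj].
have qo k' : (k' < n)%N -> k' != i -> q * f k' = 0.
  by move=> hk ki; rewrite -qf' -mulrA of_ ?mulr0 // eq_sym.
rewrite ltnS leq_eqVlt => /orP[/eqP jn|jn].
  have kn : (k < n)%N by rewrite -jn.
  have [gk _ _ _] := gI k (ltnW kn).
  apply: proj_orth_sym => //; first by rewrite /g jn eqxx.
  rewrite /g jn eqxx (ltn_eqF kn) mulrBl; case: eqP => [_|/eqP ki].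
    by rewrite fq; case: pq => -> _; rewrite subrr.
  by rewrite of_ 1?eq_sym // qo // subrr.
have kn := ltn_trans kj jn.
rewrite /g (ltn_eqF jn) (ltn_eqF kn).
case: eqP => [ki|/eqP ki]; case: eqP => [ji|/eqP ji].
- by move: kj; rewrite ki ji ltnn.
- exact: qo.
- by apply: proj_orth_sym => //; [exact: pf|exact: qo].
by apply: of_; rewrite // neq_ltn kj.
Qed.

End Decomposition.
End Atoms.

(** * Minimal projections of a relative commutant *)

Section Casimir.
Context (R : realType) (T : tracialAlgType R).
Local Notation C := R[i].
Implicit Types (x y z e p q : T).

Definition rel_commutant (A L : set T) : set T :=
  [set x | L x /\ forall a, A a -> a * x = x * a].

Section FiniteSubalgebra.
Variables (A : set T) (sA : star_closed A) (n : nat) (a : nat -> T).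
Hypotheses (Aa : forall i, (i < n)%N -> A (a i))
  (aS : forall x, A x -> x = \sum_(i < n) ip x (a i) *: a i).
Let lA := star_closed_linear sA.
Let AM x y : A x -> A y -> A (x * y). Proof. by case: sA => _ _ + _; apply. Qed.
Let Astar x : A x -> A (star x). Proof. by case: sA => _ _ _; apply. Qed.

(** For a full matrix algebra with matrix units e_kl this is, up to a factor,
    x -> sum e_kl x e_lk; written with an orthonormal basis it makes sense
    without knowing the structure of the algebra. *)
Definition casimir x : T := \sum_(i < n) a i * x * star (a i).

(** Left multiplication by [b] and right multiplication by [b] have transposed
    matrices in the bases [a i] and [star (a i)]. *)
Lemma casimir_comm x b : A b -> b * casimir x = casimir x * b.
Proof.
move=> Ab; rewrite mulr_sumr mulr_suml.
rewrite (eq_bigr (fun i : 'I_n => \sum_(j < n)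
    ip (b * a i) (a j) *: (a j * x * star (a i)))); last first.
  move=> i _; rewrite !mulrA {1}(aS (AM Ab (Aa (ltn_ord i)))) !mulr_suml.
  by apply: eq_bigr => j _; rewrite -!scalerAl.
rewrite exchange_big; apply: eq_bigr => j _.
rewrite -[RHS]mulrA -[star (a j) * b]starK starM starK.
rewrite (aS (AM (Astar Ab) (Aa (ltn_ord j)))) star_sum mulr_sumr.
apply: eq_bigr => i _; rewrite starZ -ip_conj -scalerAr; congr (_ *: _).
by rewrite /ip starM starK mulrA.
Qed.

Lemma trace_casimir x : trace (casimir x) = trace (x * \sum_(i < n) star (a i) * a i).
Proof.
rewrite trace_sum mulr_sumr trace_sum; apply: eq_bigr => i _.
by rewrite -mulrA traceC -mulrA.
Qed.

End FiniteSubalgebra.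

Lemma onb_star (A : set T) n (a : nat -> T) : star_closed A ->
  (forall x, A x -> x = \sum_(i < n) ip x (a i) *: a i) ->
  forall x, A x -> x = \sum_(i < n) ip x (star (a i)) *: star (a i).
Proof.
move=> [_ _ _ Astar] aS x Ax; rewrite -[LHS]starK (aS _ (Astar _ Ax)) star_sum.
apply: eq_bigr => i _; rewrite starZ -ip_conj; congr (_ *: _).
by rewrite /ip !starK traceC.
Qed.

Section Corner.
Variables (A L : set T) (sA : star_closed A) (sL : star_closed L).
Variables (A1 : A 1) (AL : A `<=` L) (fA : finite_span A).
Variables (e : T) (ae : atom (rel_commutant A L) e).
Let lA := star_closed_linear sA.
Let lL := star_closed_linear sL.
Let AM x y : A x -> A y -> A (x * y). Proof. by case: sA => _ _ + _; apply. Qed.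
Let Astar x : A x -> A (star x). Proof. by case: sA => _ _ _; apply. Qed.
Let LM x y : L x -> L y -> L (x * y). Proof. by case: sL => _ _ + _; apply. Qed.

Let ee : e * e = e. Proof. by case: ae => -[]. Qed.
Let se : star e = e. Proof. by case: ae => -[]. Qed.
Let Le : L e. Proof. by case: ae => _ [] . Qed.
Let comm_e x : A x -> x * e = e * x. Proof. by case: ae => _ [_ h] _ _; apply: h. Qed.

Definition corner_span : set T := [set x | exists2 y, A y & x = y * e].

(** Let y1 be the component of e y e orthogonal to A e, and Phi = [casimir].
    For c in A, Phi (y1 c) commutes with A and lies in the corner of e, so it is
    a multiple of e, and its trace vanishes by orthogonality: Phi (y1 c) = 0.
    Taking c = a_j, multiplying by star (a_j) and summing gives
    sum_i a_i y1 Phi (star (a_i)) = 0, and each Phi (star (a_i)) acts on e as a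
    scalar.  Those scalars are, up to a common nonzero factor, the coordinates
    of the projection g of e onto A.  Hence g y1 = 0; but g acts on e as a
    nonzero scalar, so that y1 = 0. *)
Lemma atom_corner y : L y -> corner_span (e * y * e).
Proof.
move=> Ly; set y0 := e * y * e.
have [n [a [_ Aa _ aS]]] : exists n a, [/\ True, forall i, (i < n)%N -> A (a i),
    orthonormal_family n a & forall x, A x -> x = \sum_(i < n) ip x (a i) *: a i].
  by have [I [b /(onb_exists lA)[n [a [_ h1 h2 h3]]]]] := fA; exists n, a.
have pe : projection e by case: ae.
pose t := trace e.
have t0 : t != 0.
  rewrite /t trace_proj //; apply/eqP => /complexI/eqP.
  rewrite sqrf_eq0 => /eqP/norm2_eq0; apply/eqP; by case: ae.
have [y1 [Ly1 ey1 y1e orth1 y01]] : exists y1, [/\ L y1, e * y1 = y1, y1 * e = y1,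
    forall c, A c -> trace (y1 * c) = 0 & corner_span (y0 - y1)].
  have lAe : linear_subspace corner_span.
    split=> [|k _ _ [u Au ->] [v Av ->]]; first by exists 0; rewrite ?mul0r //; exact: sub0.
    exists (k *: u + v); first by apply: lA.2.
    by rewrite mulrDl scalerAl.
  have [I [b bA]] := fA.
  have bAe : spans (fun i => b i * e) corner_span.
    move=> _ [u /bA[c ->] ->]; exists c; rewrite mulr_suml.
    by apply: eq_bigr => i _; rewrite scalerAl.
  have [_ [z Az ->] h] := orth_proj_exists lAe y0 bAe.
  have de : (y0 - z * e) * e = y0 - z * e.
    by rewrite mulrBl /y0 -!mulrA ee.
  exists (y0 - z * e); split.
  - apply: (subB lL); first exact/LM/Le/LM.
    by apply: LM => //; exact: AL.
  - by rewrite mulrBr /y0 !mulrA ee -(comm_e Az) -[z * e * e]mulrA ee.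
  - exact: de.
  - move=> c Ac; have := h (star c * e); rewrite /ip starM starK se => hc.
    rewrite traceC -de mulrA traceC mulrA hc //.
    by exists (star c) => //; exact: Astar.
  - by exists z => //; rewrite opprB addrC subrK.
suff y10 : y1 = 0 by move: y01; rewrite y10 subr0.
pose Phi := casimir n a.
have LPhi x : L x -> L (Phi x).
  move=> Lx; apply: (sub_sum lL) => i _; have Ai := Aa _ (ltn_ord i).
  by apply: LM; [apply: LM; [exact: AL|]|exact/AL/Astar].
have Phi_scal x : L x -> exists c : C, e * Phi x * e = c *: e.
  move=> Lx; case: ae => _ _ _; apply; split; first exact: LPhi.
  by move=> b Ab; exact: (casimir_comm sA Aa aS).
have Phi_e x : Phi (e * x * e) = e * Phi x * e.
  rewrite /Phi /casimir mulr_sumr mulr_suml; apply: eq_bigr => i _.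
  have Ai := Aa _ (ltn_ord i); rewrite !mulrA (comm_e Ai) -!mulrA.
  by rewrite (comm_e (Astar Ai)).
pose H := \sum_(i < n) star (a i) * a i.
have AH : A H.
  by apply: (sub_sum lA) => i _; have Ai := Aa _ (ltn_ord i); apply: AM => //; exact: Astar.
have HC b : A b -> b * H = H * b.
  have -> : H = casimir n (fun i => star (a i)) 1.
    by apply: eq_bigr => i _; rewrite mulr1 starK.
  move=> Ab; apply: (casimir_comm sA) => // [i /Aa/Astar//|].
  exact: onb_star.
have Phi0 c : A c -> Phi (y1 * c) = 0.
  move=> Ac; have Lyc : L (y1 * c) by apply: LM => //; exact: AL.
  have [k hk] := Phi_scal _ Lyc.
  have E : e * (y1 * c) * e = y1 * c.
    by rewrite !mulrA ey1 -mulrA (comm_e Ac) mulrA y1e.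
  rewrite -Phi_e E in hk; rewrite hk.
  suff : k * t = 0 by move/eqP; rewrite mulf_eq0 (negPf t0) orbF => /eqP ->; rewrite scale0r.
  rewrite -traceZ -hk trace_casimir -mulrA orth1 //; exact: AM.
(* being central in A, H acts on e as a scalar, which gives the scalars kap *)
have [eta heta] : exists c : C, e * H * e = c *: e.
  by case: ae => _ _ _; apply; split; [exact: AL|].
have He : H * e = eta *: e by rewrite -heta -(comm_e AH) -mulrA ee.
have kap i : (i < n)%N -> Phi (star (a i)) * e = (eta / t * ip e (a i)) *: e.
  move=> hi; have Asi := Astar (Aa i hi).
  have APhi : A (Phi (star (a i))).
    by apply: (sub_sum lA) => j _; have Aj := Aa _ (ltn_ord j); do ?apply: AM => //; exact: Astar.
  have [k hk] := Phi_scal _ (AL Asi).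
  have hk' : Phi (star (a i)) * e = k *: e by rewrite -hk -(comm_e APhi) -mulrA ee.
  rewrite hk'; congr (_ *: _); apply: (mulIf t0).
  have -> : k * t = trace (Phi (star (a i)) * e) by rewrite hk' traceZ.
  have -> : Phi (star (a i)) * e = Phi (star (a i) * e).
    rewrite /Phi /casimir mulr_suml; apply: eq_bigr => j _.
    by rewrite -!mulrA (comm_e (Astar (Aa _ (ltn_ord j)))).
  rewrite trace_casimir -/H -[star (a i) * e * H]mulrA -(comm_e AH) He -scalerAr traceZ.
  by rewrite mulrAC divfK.
pose g := \sum_(i < n) ip e (a i) *: a i.
have Ag : A g by apply: (sub_sum lA) => i _; apply: (subZ lA); exact: Aa.
(* exchange the sums defining Phi and use Phi0 *)
have sum0 : \sum_(i < n) a i * y1 * Phi (star (a i)) = 0.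
  rewrite /Phi /casimir; under eq_bigr do rewrite mulr_sumr.
  rewrite exchange_big big1 // => j _ /=.
  have := Phi0 _ (Aa _ (ltn_ord j)) => /(congr1 (fun x => x * star (a j))).
  rewrite mul0r mulr_suml => E; rewrite -[RHS]E; apply: eq_bigr => i _.
  by rewrite !mulrA.
have gy1 : (eta / t) *: (g * y1) = 0.
  rewrite -[RHS]sum0 /g mulr_suml scaler_sumr; apply: eq_bigr => i _.
  have Ai := Aa _ (ltn_ord i).
  have AP : A (Phi (star (a i))).
    by apply: (sub_sum lA) => j _; have Aj := Aa _ (ltn_ord j); do ?apply: AM => //; exact: Astar.
  rewrite -{2}y1e -!mulrA -(comm_e AP) kap // -scalerAr -scalerAr y1e.
  by rewrite -scalerAl scalerA.
have eta0 : eta != 0.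
  apply/eqP => eta0; move: He; rewrite eta0 scale0r => He0.
  have : trace (e * (H * e)) = 0 by rewrite He0 mulr0 trace0.
  rewrite /H mulr_suml mulr_sumr trace_sum => /eqP.
  rewrite psumr_eq0 => [/allP ae0|i _]; last first.
    by have := trace_ge0 (a i * e); rewrite starM se !mulrA.
  have e0 : e = 0.
    rewrite -[e]mul1r {1}(aS _ A1) mulr_suml big1 // => i _; rewrite -scalerAl.
    suff -> : a i * e = 0 by rewrite scaler0.
    apply: trace_faithful; have := ae0 i (mem_index_enum i).
    by rewrite implyTb starM se !mulrA => /eqP.
  by case: ae => _ _ /eqP.
have {}gy1 : g * y1 = 0.
  move/eqP: gy1; rewrite scaler_eq0 mulf_eq0 invr_eq0 (negPf eta0) (negPf t0).
  by move=> /eqP.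
have tg c : A c -> trace (c * g) = trace (c * e).
  move=> Ac; rewrite -[c]starK -![trace (star _ * _)]/(ip _ _).
  rewrite ip_suml [in RHS](aS _ (Astar Ac)) ip_sumr; apply: eq_bigr => i _.
  by rewrite ipZl ipZr -ip_conj mulrC.
(* e commutes with A, hence so does its orthogonal projection onto A *)
have gC b : A b -> b * g = g * b.
  move=> Ab; apply/eqP; rewrite -subr_eq0; apply/eqP; set d := _ - _.
  have Ad : A d by apply: (subB lA); exact: AM.
  have tcd c : A c -> trace (c * d) = 0.
    move=> Ac; rewrite mulrBr traceB !mulrA tg; last exact: AM.
    rewrite [X in _ - X]traceC mulrA tg; last exact: AM.
    rewrite -mulrA (comm_e Ab) mulrA [X in X - _]traceC !mulrA.
    by rewrite subrr.
  by apply: trace_faithful; apply: tcd; exact: Astar.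
have [nu hnu] : exists c : C, e * g * e = c *: e.
  by case: ae => _ _ _; apply; split; [exact: AL|].
have ge : g * e = nu *: e by rewrite -hnu -(comm_e Ag) -mulrA ee.
have nu0 : nu != 0.
  apply/eqP => nu0; move: ge; rewrite nu0 scale0r => ge0.
  have g0 : g = 0.
    apply: trace_faithful; rewrite tg; last exact: Astar.
    by rewrite -[e]se -starM -(comm_e Ag) ge0 star0 trace0.
  have := tg 1 A1; rewrite g0 mulr0 trace0 mul1r => /esym/eqP.
  by rewrite -/t (negPf t0).
apply/eqP; have := gy1; rewrite -ey1 mulrA ge -scalerAl => /eqP.
by rewrite scaler_eq0 (negPf nu0) ey1.
Qed.

End Corner.
End Casimir.

(** * Central supports of large minimal projections *)

Section CentralProjections.
Context (R : realType) (T : tracialAlgType R).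
Local Notation C := R[i].
Implicit Types (x y z e p q f : T).

Lemma norm2_sum_orthonormal n (x : nat -> T) (c : 'I_n -> C) :
  orthonormal_family n x ->
  norm2 (\sum_(i < n) c i *: x i) ^+ 2 = \sum_(i < n) sqmod (c i).
Proof.
move=> xn; apply: complexI; rewrite -ipxx rmorph_sum ip_suml /=.
apply: eq_bigr => i _; rewrite ipZl ip_sumr (bigD1 i) //= big1 => [|j ji].
  by rewrite addr0 ipZr xn // eqxx mulr1 sqmodE.
by rewrite ipZr xn // eq_sym -val_eqE /= in ji *; rewrite (negPf ji) mulr0.
Qed.

Section Central.
Variables (L : set T) (sL : star_closed L) (fL : finite_span L).
Variables (f : T) (af : atom L f).
Let lL := star_closed_linear sL.
Let LM x y : L x -> L y -> L (x * y). Proof. by case: sL => _ _ + _; apply. Qed.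
Let Lstar x : L x -> L (star x). Proof. by case: sL => _ _ _; apply. Qed.

(** Let u_i be an orthonormal basis of L f.  Since f L f consists of multiples of
    f, the elements u_i are, up to a common factor, partial isometries with
    initial projection f and orthogonal ranges; p is the sum of the range
    projections, the least projection acting as 1 on L f.  Its trace is r tr f,
    and p L is spanned by the r^2 elements v_i star (v_j). *)
Lemma central_support : exists p r (v : 'I_r -> T),
  [/\ projection p, L p, forall x, L x -> p * x = x * p,
      r%:R * tr f <= 1 /\ tr f <= tr p &
      forall x, L x -> exists c : 'I_r * 'I_r -> C,
        p * x = \sum_ij c ij *: (v ij.1 * star (v ij.2))].
Proof.
case: (af) => pf Lf f0 fLf; have [ff sf] := pf.
pose S : set T := [set x | L x /\ x * f = x].
have lS : linear_subspace S.
  split=> [|k x y [Lx xf] [Ly yf]]; first by split; rewrite ?mul0r //; exact: sub0.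
  by split; [exact: lL.2|rewrite mulrDl -scalerAl xf yf].
have [I [b bL]] := fL.
have bS : spans b S by move=> x [/bL].
have [r [u [_ Su un uS]]] := onb_exists lS bS.
have t0 : 0 < tr f by exact: tr_gt0.
have tf := trace_projE pf.
have tC0 : trace f != 0 by rewrite tf; apply/eqP => /complexI/eqP; rewrite gt_eqF.
have fip x y : S x -> S y -> star y * x = (ip x y / trace f) *: f.
  move=> [Lx xf] [Ly yf]; have [c hc] := fLf (star y * x) (LM (Lstar Ly) Lx).
  have E : star y * x = c *: f.
    by rewrite -hc -{1}xf -{1}yf starM sf !mulrA.
  rewrite E; congr (_ *: _); apply: (mulIf tC0).
  by rewrite divfK // -traceZ -E.
pose p := \sum_(i < r) (trace f) *: (u i * star (u i)).
have pS x : S x -> p * x = x.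
  move=> Sx; rewrite [RHS](uS _ Sx) mulr_suml; apply: eq_bigr => i _.
  rewrite -scalerAl -mulrA (fip _ _ Sx (Su i (ltn_ord i))) -scalerAr scalerA.
  rewrite mulrC divfK //.
  by case: (Su i (ltn_ord i)) => _ ->.
have tfR : (trace f)^*%R = trace f by rewrite -trace_star sf.
have sp : star p = p.
  rewrite star_sum; apply: eq_bigr => i _.
  by rewrite starZ tfR starM starK.
have Lp : L p.
  apply: (sub_sum lL) => i _; apply: (subZ lL); have [Lu _] := Su i (ltn_ord i).
  by apply: LM => //; exact: Lstar.
have Sxu x i : L x -> (i < r)%N -> S (x * u i).
  by move=> Lx /Su[Lu uf]; split; [exact: LM|rewrite -mulrA uf].
have pxp x : L x -> p * x * p = x * p.
  move=> Lx; rewrite -mulrA [x * p]mulr_sumr mulr_sumr; apply: eq_bigr => i _.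
  by rewrite -scalerAr -scalerAr !mulrA -[p * x * u i]mulrA pS //; exact: Sxu.
have pxp' x : L x -> p * x * p = p * x.
  move=> Lx; have := pxp _ (Lstar Lx) => /(congr1 (@star R T)).
  by rewrite !starM sp starK mulrA.
have pp : p * p = p by rewrite {2}/p mulr_sumr; apply: eq_bigr => i _;
  rewrite -scalerAr mulrA pS //; exact: Su.
have projp : projection p by [].
have trp : tr p = r%:R * tr f.
  rewrite /tr trace_sum (eq_bigr (fun=> trace f)) => [|i _]; last first.
    by rewrite traceZ traceC -[trace (_ * _)]/(ip _ _) un // eqxx mulr1.
  by rewrite sumr_const card_ord mulr_natl raddfMn.
have pC x : L x -> p * x = x * p by move=> Lx; rewrite -pxp // pxp'.
exists p, r, (fun i => u i); split=> //.
- split; first by rewrite -trp proj_tr_le1.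
  have r0 : (0 < r)%N.
    rewrite lt0n; apply/eqP => r0; move/eqP: f0; apply.
    by rewrite (uS f) // big1 // => i _; have := ltn_ord i; rewrite [X in (_ < X)%N]r0.
  by rewrite trp ler_peMl ?(ltW t0) // ler1n.
move=> x Lx; exists (fun ij : 'I_r * 'I_r => trace f * ip (x * u ij.2) (u ij.1)).
rewrite pC // /p mulr_sumr.
rewrite -(pair_bigA _ (fun i j : 'I_r => (trace f * ip (x * u j) (u i)) *:
  (u i * star (u j)))) exchange_big.
apply: eq_bigr => j _; rewrite /= -scalerAr mulrA.
rewrite {1}(uS _ (Sxu _ _ Lx (ltn_ord j))) mulr_suml scaler_sumr.
by apply: eq_bigr => i _; rewrite -scalerAl scalerA.
Qed.

End Central.

(** By dimension, [p] kills a nontrivial combination y of the [x i].  Then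
    y = (1 - p) y, so that the 2-norm of y is at most that of 1 - p times the
    operator norm of y, while orthonormality bounds the operator norm of y by a
    multiple of its 2-norm. *)
Lemma tr_away_from_1 (x : nat -> T) p (I : finType) (b : I -> T) :
  projection p -> orthonormal_family #|I|.+1 x ->
  (forall i, (i < #|I|.+1)%N -> exists c : I -> C, p * x i = \sum_k c k *: b k) ->
  (1 + \sum_(i < #|I|.+1) anorm (x i)) ^- 2 <= 1 - tr p.
Proof.
move=> pp xn px.
pose S : set T := [set y | exists c : I -> C, y = \sum_k c k *: b k].
have [a [i0 ai0] a0] := @linear_dependence R T I b S (fun i => p * x i) (fun _ h => h) px.
pose y := \sum_(i < #|I|.+1) a i *: x i.
have py : p * y = 0.
  by rewrite -[RHS]a0 mulr_sumr; apply: eq_bigr => i _; rewrite scalerAr.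
set K := 1 + _.
have anorm_sum (r : seq 'I_#|I|.+1) (F : 'I_#|I|.+1 -> T) :
    anorm (\sum_(i <- r) F i) <= \sum_(i <- r) anorm (F i).
  elim: r => [|i r IH]; last by rewrite !big_cons (le_trans (anormD _ _)) ?lerD2l.
  by rewrite !big_nil -(scale0r (1 : T)) anormZ normr0 mul0r.
have s2 := norm2_sum_orthonormal a xn; rewrite -/y in s2.
set s := norm2 y in s2.
have sq_le i : sqmod (a i) <= s ^+ 2.
  by rewrite s2 (bigD1 i) //= lerDl sumr_ge0 // => j _; exact: sqmod_ge0.
have s0 : 0 < s.
  rewrite lt_def norm2_ge0 andbT; apply: contra ai0 => /eqP s0.
  have := sq_le i0; rewrite s0 expr0n /= => h; have := sqmod_ge0 (a i0) => h'.
  have : (sqmod (a i0))%:C = 0 by apply/eqP; rewrite eq_complex /= eq_le h h' eqxx.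
  by rewrite sqmod_norm => /eqP; rewrite sqrf_eq0 normr_eq0.
have ay : anorm y <= s * K.
  apply: (le_trans (anorm_sum _ _)); rewrite mulrDr mulr1 mulr_sumr.
  rewrite -[leLHS]add0r lerD ?(ltW s0) // ler_sum // => i _.
  rewrite anormZ ler_wpM2r ?anorm_ge0 //.
  rewrite -(@ler_pXn2r _ 2) ?nnegrE ?(ltW s0) ?Re_ge0 //.
  rewrite (le_trans _ (sq_le i)) // -lecR sqmod_norm rcX -Re_ge0E //.
have K0 : 0 < K by rewrite ltr_pwDl // sumr_ge0 // => i _; exact: anorm_ge0.
have p1 : projection (1 - p) by apply: projB; [exact: proj1|by []|rewrite mul1r].
have := norm2M_ler (1 - p) y; rewrite mulrBl mul1r py subr0 -/s => h.
have {}h : 1 <= norm2 (1 - p) * K.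
  rewrite -(ler_pM2l s0) mulr1 mulrCA; apply: (le_trans h).
  by rewrite ler_wpM2l ?norm2_ge0.
have -> : 1 - tr p = tr (1 - p) by rewrite trB tr1.
rewrite tr_proj // -exprVn lerXn2r ?nnegrE ?norm2_ge0 ?invr_ge0 ?(ltW K0) //.
by rewrite -[leLHS]mul1r ler_pdivrMr.
Qed.

End CentralProjections.

(** * Asymptotically central projections in a tower of finite-dimensional algebras *)

Section AsymptoticallyCentral.
Context (R : realType) (T : tracialAlgType R).
Local Notation C := R[i].
Implicit Types (x y z e p q f : T).

Lemma chain_le (A : nat -> set T) : (forall k, A k `<=` A k.+1) ->
  forall k l, (k <= l)%N -> A k `<=` A l.
Proof.
move=> Ainc k l /subnK <-; elim: (l - k)%N => [|m IH] //= x Ax.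
exact/Ainc/IH.
Qed.

Lemma rel_commutant_closed (A L : set T) : star_closed A -> star_closed L ->
  star_closed (rel_commutant A L).
Proof.
move=> [_ _ _ Astar] [L0 Llin LM Lstar]; split.
- by split=> // a _; rewrite mulr0 mul0r.
- move=> k x y [Lx xA] [Ly yA]; split; first exact: Llin.
  by move=> a Aa; rewrite mulrDr mulrDl -scalerAr -scalerAl xA ?yA.
- move=> x y [Lx xA] [Ly yA]; split; first exact: LM.
  by move=> a Aa; rewrite mulrA xA // -mulrA yA // mulrA.
- move=> x [Lx xA]; split; first exact: Lstar.
  move=> a Aa; rewrite -[a]starK -!starM xA //; exact: Astar.
Qed.

(** Partial sums of a decomposition of 1 into minimal projections increase by
    steps of at most 1/3, so one of them falls into the middle third. *)
Lemma middle_projection (D : set T) : star_closed D -> finite_span D -> D 1 ->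
  (forall e, atom D e -> tr e <= 1 / 3) ->
  exists z, [/\ projection z, D z & 1 / 3 <= tr z <= 1 - 1 / 3].
Proof.
move=> sD fD D1 small.
have [n [f [af _ of_ f1]]] := atom_decomp sD fD (@proj1 R T) D1.
have pf i : (i < n)%N -> projection (f i) by move=> /af[].
pose s k := tr (\sum_(i < k) f i).
have ex : exists k, (k <= n)%N && (1 / 3 <= s k).
  by exists n; rewrite leqnn /s -f1 tr1 /=; lra.
case: (ex_minnP ex) => -[|k] /andP[kn sk] kmin.
  by move: sk; rewrite /s big_ord0 /tr trace0 /=; lra.
exists (\sum_(i < k.+1) f i); split.
- exact: proj_sum of_ _ kn.
- apply: (sub_sum (star_closed_linear sD)) => i _.
  by case: (af i (leq_trans (ltn_ord i) kn)).
rewrite -/(s k.+1) sk /=.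
have sk' : s k < 1 / 3.
  rewrite ltNge; apply/negP => h; have := kmin k.
  by rewrite h (ltnW kn) ltnn => /(_ isT).
have := small (f k) (af k kn); rewrite /s big_ord_recr /= trD -/(s k); lra.
Qed.

(** By [atom_corner], a decomposition of [e] into minimal projections of [L] takes
    place in A e, whose dimension is at most that of [A]. *)
Lemma atom_rel_commutant_tr (A L : set T) (I : finType) (b : I -> T) (c : R) e :
  star_closed A -> star_closed L -> A 1 -> A `<=` L -> spans b A ->
  finite_span L -> 0 <= c -> (forall f, atom L f -> tr f <= c) ->
  atom (rel_commutant A L) e -> tr e <= #|I|%:R * c.
Proof.
move=> sA sL A1 AL bA fL c0 small ae.
have [pe [Le _] _ _] := ae.
have [m [g [ag eg og gE]]] := atom_decomp sL fL pe Le.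
have ge i : (i < m)%N -> g i * e = g i.
  by move=> hi; apply: proj_absorb_sym => //; [case: (ag i hi)|exact: eg].
have gI i : (i < m)%N -> corner_span A e (g i).
  move=> hi; have -> : g i = e * g i * e by rewrite eg // ge.
  apply: (atom_corner sA sL A1 AL) => //; first by exists I, b.
  by case: (ag i hi).
have bAe : spans (fun i => b i * e) (corner_span A e).
  move=> _ [u /bA[d ->] ->]; exists d; rewrite mulr_suml.
  by apply: eq_bigr => i _; rewrite scalerAl.
have mI : (m <= #|I|)%N.
  apply: (orth_family_le bAe _ og) => i hi; have [pg _ g0 _] := ag i hi.
  by split=> //; exact: gI.
rewrite gE tr_sum; apply: (@le_trans _ _ (\sum_(i < m) c)).
  by apply: ler_sum => i _; apply/small/ag.
by rewrite sumr_const card_ord -[c *+ m]mulr_natl ler_wpM2r ?ler_nat.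
Qed.

Section Tower.
Variables (A : nat -> set T) (sA : forall k, star_closed (A k)).
Variables (A1 : forall k, A k 1) (fA : forall k, finite_span (A k)).
Hypotheses (Ainc : forall k, A k `<=` A k.+1)
  (Ainf : forall d, exists k (x : nat -> T), orthonormal_family d x /\
    forall i, (i < d)%N -> A k (x i)).

Lemma central_of_large_atoms (c : R) : 0 < c ->
  (forall k, exists l f, [/\ (k <= l)%N, atom (A l) f & c <= tr f]) ->
  exists2 d : R, 0 < d & forall k, exists z, [/\ projection z,
    forall a, A k a -> a * z = z * a & d <= tr z <= 1 - d].
Proof.
move=> c0 large.
pose D := Num.bound c^-1.
have hD : c^-1 < D%:R by apply: archi_boundP; rewrite invr_ge0 ltW.
have [k0 [x [xn xA]]] := Ainf (D * D).+1.
pose K : R := 1 + \sum_(i < (D * D).+1) anorm (x i).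
have sum_ge0 (m : nat) : 0 <= \sum_(i < m) anorm (x i).
  by apply: sumr_ge0 => i _; exact: anorm_ge0.
have K0 : 0 < K by rewrite ltr_pwDl.
exists (Num.min c (K ^- 2)); first by rewrite lt_min c0 invr_gt0 exprn_gt0.
move=> k; have [l [f [kl af cf]]] := large (maxn k k0).
have [kl' k0l] : (k <= l)%N /\ (k0 <= l)%N by apply/andP; rewrite -geq_max.
have [p [r [v [pp Lp pC [rf fp] pspan]]]] := central_support (sA l) (fA l) af.
exists p; split=> //.
  by move=> a /(chain_le Ainc kl') /pC ->.
apply/andP; split; first by rewrite ge_min (le_trans cf fp).
rewrite lerBrDl -lerBrDr ge_min; apply/orP; right.
have rD : (r <= D)%N.
  have : r%:R * c <= 1 by apply: le_trans rf; rewrite ler_wpM2l.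
  rewrite -ler_pdivlMr // mul1r => /le_lt_trans/(_ hD).
  by rewrite ltr_nat => /ltnW.
have card_r : #|{: 'I_r * 'I_r}| = (r * r)%N by rewrite card_prod card_ord.
have rrDD : (r * r <= D * D)%N by exact: leq_mul.
have away := @tr_away_from_1 R T x p _
  (fun ij : 'I_r * 'I_r => v ij.1 * star (v ij.2)) pp.
rewrite card_r in away; apply: le_trans (away _ _).
- rewrite lef_pV2 ?posrE ?exprn_gt0 ?ltr_pwDl // lerXn2r ?nnegrE ?addr_ge0 //.
  rewrite lerD2l (big_ord_widen (D * D).+1 (fun i => anorm (x i))) //.
  rewrite big_mkcond; apply: ler_sum => i _; case: ifP => // _.
  exact: anorm_ge0.
- move=> i j hi hj; by apply: xn; [apply: leq_trans hi _|apply: leq_trans hj _].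
move=> i hi; apply: pspan; apply: (chain_le Ainc k0l); apply: xA.
by apply: leq_trans hi _.
Qed.

Theorem asymptotically_central : exists2 d : R, 0 < d & forall k, exists z,
  [/\ projection z, forall a, A k a -> a * z = z * a & d <= tr z <= 1 - d].
Proof.
have [[c c0 large]|small] := pselect (exists2 c : R, 0 < c &
    forall k, exists l f, [/\ (k <= l)%N, atom (A l) f & c <= tr f]).
  exact: central_of_large_atoms c0 large.
exists (1 / 3); first by lra.
move=> k0; have [I [b bA]] := fA k0.
pose c : R := (3 * (#|I|.+1)%:R)^-1.
have c0 : 0 < c by rewrite invr_gt0 mulr_gt0 ?ltr0n.
have [l k0l smalll] : exists2 l, (k0 <= l)%N & forall f, atom (A l) f -> tr f <= c.
  apply: contrapT => h; apply: small; exists c => // k.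
  apply: contrapT => h'; apply: h; exists (maxn k k0); first exact: leq_maxr.
  move=> f af; rewrite leNgt; apply/negP => cf; apply: h'.
  by exists (maxn k k0), f; rewrite leq_maxl ltW.
have AL := chain_le Ainc k0l.
have sD := rel_commutant_closed (sA k0) (sA l).
have fD : finite_span (rel_commutant (A k0) (A l)).
  by have [J [b' b'A]] := fA l; exists J, b' => x [/b'A].
have D1 : rel_commutant (A k0) (A l) 1.
  by split=> // a _; rewrite mulr1 mul1r.
have [|z [pz [_ zA] tz]] := middle_projection sD fD D1.
  move=> e ae; apply: le_trans (atom_rel_commutant_tr (sA k0) (sA l) (A1 k0)
    AL bA (fA l) (ltW c0) smalll ae) _.
  rewrite /c ler_pdivrMr ?mulr_gt0 ?ltr0n // mulrA divfK ?pnatr_eq0 // mul1r.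
  by rewrite ler_nat.
by exists z.
Qed.

End Tower.
End AsymptoticallyCentral.

(** * Orthogonal projection in a complete real inner product space *)

Section RealInnerProduct.
Context (R : realType) (V : lmodType R[i]) (rho : V -> V -> R).
Implicit Types (u v w k : V) (t : R).
Hypotheses (rhoC : forall u v, rho u v = rho v u)
  (rhoDl : forall u v w, rho (u + v) w = rho u w + rho v w)
  (rhoZl : forall t u v, rho (t%:C *: u) v = t * rho u v)
  (rho_ge0 : forall u, 0 <= rho u u)
  (rho_complete : forall u : nat -> V,
    (forall e, 0 < e -> exists N, forall m n, (N <= m)%N -> (N <= n)%N ->
      rho (u m - u n) (u m - u n) < e) ->
    exists l, forall e, 0 < e -> exists N, forall n, (N <= n)%N ->
      rho (u n - l) (u n - l) < e).

Lemma rhoNl u v : rho (- u) v = - rho u v.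
Proof.
have -> : - u = (-1)%:C *: u by rewrite rmorphN1 scaleN1r.
by rewrite rhoZl mulN1r.
Qed.

Lemma rhoBl u v w : rho (u - v) w = rho u w - rho v w.
Proof. by rewrite rhoDl rhoNl. Qed.

Lemma rhoBr u v w : rho w (u - v) = rho w u - rho w v.
Proof. by rewrite rhoC rhoBl !(rhoC w). Qed.

Lemma rhoDr u v w : rho w (u + v) = rho w u + rho w v.
Proof. by rewrite rhoC rhoDl !(rhoC w). Qed.

Lemma rhoZr t u v : rho v (t%:C *: u) = t * rho v u.
Proof. by rewrite rhoC rhoZl (rhoC v). Qed.

Lemma discriminant (a b c : R) : 0 <= c ->
  (forall t, 0 <= a - 2 * t * b + t ^+ 2 * c) -> b ^+ 2 <= a * c.
Proof.
move=> c0 h; have [c_eq0|c_neq0] := eqVneq c 0.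
  have [->|b0] := eqVneq b 0; first by rewrite c_eq0 expr0n mulr0.
  have := h ((a + 1) / (2 * b)); rewrite c_eq0 mulr0 addr0.
  have -> : 2 * ((a + 1) / (2 * b)) * b = a + 1 by field.
  lra.
have := h (b / c); have cp : 0 < c by rewrite lt_def c_neq0.
have -> : a - 2 * (b / c) * b + (b / c) ^+ 2 * c = (a * c - b ^+ 2) / c by field.
by rewrite pmulr_lge0 ?invr_gt0 // subr_ge0.
Qed.

Lemma rho_sub_scale t u k : rho (u - t%:C *: k) (u - t%:C *: k) =
  rho u u - 2 * t * rho u k + t ^+ 2 * rho k k.
Proof. rewrite !(rhoBl, rhoBr, rhoZl, rhoZr) (rhoC k u); ring. Qed.

Lemma rho_sub_sqr u k :
  rho (u - k) (u - k) = rho u u - 2 * rho u k + rho k k.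
Proof. rewrite !(rhoBl, rhoBr) (rhoC k u); ring. Qed.

Lemma rho_cauchy_schwarz u k : rho u k ^+ 2 <= rho u u * rho k k.
Proof. by apply: discriminant => // t; rewrite -rho_sub_scale. Qed.

Lemma ex_inv_lt (e : R) : 0 < e -> exists N, forall n, (N <= n)%N -> n.+1%:R^-1 < e.
Proof.
move=> e0; exists (Num.bound e^-1) => n hn.
have h : e^-1 < (Num.bound e^-1)%:R by apply: archi_boundP; rewrite invr_ge0 ltW.
rewrite invf_plt ?posrE ?ltr0n //; apply: (lt_le_trans h).
by rewrite ler_nat (leq_trans hn).
Qed.

(** A minimizing sequence for the distance from [w] to [K] is Cauchy by the
    parallelogram law; almost minimality makes the residues almost orthogonal to
    [K], by the discriminant of a quadratic polynomial. *)
Lemma orthogonal_projection (K : set V) w : K 0 ->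
  (forall u v, K u -> K v -> K (u + v)) -> (forall t u, K u -> K (t%:C *: u)) ->
  (forall u, (forall e, 0 < e -> exists2 k, K k & rho (u - k) (u - k) < e) -> K u) ->
  exists2 p, K p & forall k, K k -> rho (w - p) k = 0.
Proof.
move=> K0 KD KZ Kclosed.
pose dists := [set rho (w - k) (w - k) | k in K].
have dists0 : dists !=set0 by exists (rho (w - 0) (w - 0)), 0.
have dlb : lbound dists 0 by move=> _ [k _ <-].
pose d := inf dists.
have d_le k : K k -> d <= rho (w - k) (w - k).
  by move=> Kk; apply: ge_inf; [exists 0|exists k].
have /choice[k hk] n : exists k, K k /\ rho (w - k) (w - k) < d + n.+1%:R^-1.
  have [|_ [k Kk <-] h] := @inf_adherent _ dists n.+1%:R^-1 _ (conj dists0 (ex_intro _ 0 dlb)).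
    by rewrite invr_gt0 ltr0n.
  by exists k.
have Kk n : K (k n) by case: (hk n).
have KN u : K u -> K (- u).
  by move=> Ku; have -> : - u = (-1)%:C *: u by [rewrite rmorphN1 scaleN1r]; exact: KZ.
(* compare the distances from w to k m, to k n and to their midpoint *)
have para m n : rho (k m - k n) (k m - k n) <=
    2 * m.+1%:R^-1 + 2 * n.+1%:R^-1.
  have h := d_le ((2^-1)%:C *: (k m + k n)) (KZ _ _ (KD _ _ (Kk m) (Kk n))).
  have := (hk m).2; have := (hk n).2; move: h.
  rewrite rho_sub_scale !rho_sub_sqr !(rhoDl, rhoDr) (rhoC (k n) (k m)).
  move: (rho w w) (rho w (k m)) (rho w (k n)) (rho (k m) (k m)) => a b c f.
  move: (rho (k m) (k n)) (rho (k n) (k n)) => g h.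
  move: (m.+1%:R^-1) (n.+1%:R^-1) => x y.
  have -> : 2^-1 ^+ 2 = 4^-1 :> R by field.
  lra.
have [p hp] : exists p, forall e, 0 < e -> exists N, forall n, (N <= n)%N ->
    rho (k n - p) (k n - p) < e.
  apply: rho_complete => e e0; have [|N hN] := @ex_inv_lt (e / 4).
    by rewrite divr_gt0.
  exists N => m n hm hn; apply: (le_lt_trans (para m n)).
  have := hN m hm; have := hN n hn.
  move: (m.+1%:R^-1) (n.+1%:R^-1) => x y; lra.
exists p.
  apply: Kclosed => e /hp[N hN]; exists (k N) => //.
  by rewrite -opprB rhoNl rhoC rhoNl opprK; exact: hN.
move=> z Kz; apply/eqP; rewrite -sqrf_eq0 eq_le sqr_ge0 andbT.
apply/ler_addgt0Pl => e e0; rewrite addr0.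
pose c := rho z z; have c0 : 0 <= c by exact: rho_ge0.
pose e' := e / (4 * (c + 1)).
have e'0 : 0 < e' by rewrite divr_gt0 // mulr_gt0 // ltr_wpDl.
have [N1 h1] := ex_inv_lt e'0; have [N2 h2] := hp _ e'0.
pose n := maxn N1 N2.
have {}h1 := h1 n (leq_maxl _ _); have {}h2 := h2 n (leq_maxr _ _).
have -> : w - p = (w - k n) + (k n - p) by rewrite addrA subrK.
have cs := rho_cauchy_schwarz (k n - p) z.
have ds : rho (w - k n) z ^+ 2 <= n.+1%:R^-1 * c.
  apply: discriminant => // t.
  have := d_le (k n + t%:C *: z) (KD _ _ (Kk n) (KZ _ _ Kz)).
  rewrite opprD addrA rho_sub_scale; have := (hk n).2; rewrite /c.
  move: n.+1%:R^-1 => x; lra.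
have b1 : n.+1%:R^-1 * c <= e' * c by rewrite ler_wpM2r // ltW.
have b2 : rho (k n - p) (k n - p) * rho z z <= e' * c by rewrite ler_wpM2r // ltW.
have b3 : 4 * (e' * c) <= e.
  rewrite /e' mulrAC mulrA ler_pdivrMr ?mulr_gt0 ?ltr_wpDl //; nra.
rewrite rhoDl; move: (rho (w - k n) z) (rho (k n - p) z) ds cs => a b ds cs.
have {}ds := le_trans ds b1; have {}cs := le_trans cs b2.
have -> : (a + b) ^+ 2 = 2 * a ^+ 2 + 2 * b ^+ 2 - (a - b) ^+ 2 by ring.
have := sqr_ge0 (a - b); move: (e' * c) b3 ds cs => y; lra.
Qed.

End RealInnerProduct.

(** * Square-summable sequences of vectors *)

Section SquareSummable.
Context (R : realType) (H : hilbertSpace R).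
Local Notation C := R[i].
Local Notation dot := (@hs_dot R H).
Local Notation nrm := (hnorm dot).

Definition rdot (u v : H) : R := complex.Re (dot u v).

Lemma rdotC u v : rdot u v = rdot v u.
Proof. by rewrite /rdot dotC; case: (dot v u). Qed.

Lemma rdotDl u v w : rdot (u + v) w = rdot u w + rdot v w.
Proof. by rewrite /rdot linearDl raddfD. Qed.

Lemma rdotZl t u v : rdot (t%:C *: u) v = t * rdot u v.
Proof.
rewrite /rdot (linearZl_LR dot) /=; case: (dot u v) => a b.
by rewrite /= mul0r subr0.
Qed.

Lemma rdotuu u : rdot u u = nrm u ^+ 2.
Proof. by rewrite /rdot dotE. Qed.

Lemma rdotZ_conj (a : C) u v : rdot (a *: u) v = rdot u (a^*%R *: v).
Proof. by rewrite /rdot linearZl_LR linearZr_LR /= conjCK. Qed.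

Lemma rdot_adjoint f g : is_adjoint dot f g -> forall u v, rdot (f u) v = rdot u (g v).
Proof. by move=> fg u v; rewrite /rdot fg. Qed.

Lemma nrmD_sqr u v : nrm (u + v) ^+ 2 <= 2 * nrm u ^+ 2 + 2 * nrm v ^+ 2.
Proof.
have := Defs.hnormD dot u v; have := Defs.hnorm_ge0 dot u; have := Defs.hnorm_ge0 dot v.
have := Defs.hnorm_ge0 dot (u + v); have := sqr_ge0 (nrm u - nrm v).
move: (nrm u) (nrm v) (nrm (u + v)) => a b c ab c0 b0 a0 cab.
have : c ^+ 2 <= (a + b) ^+ 2 by rewrite lerXn2r ?nnegrE ?addr_ge0.
rewrite sqrrD; move: ab; rewrite sqrrB; lra.
Qed.

Definition l2_pred : {pred nat -> H} := fun w =>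
  `[< exists B : R, forall N, \sum_(n < N) nrm (w n) ^+ 2 <= B >].

Lemma l2P (w : nat -> H) : reflect (exists B : R, forall N, \sum_(n < N) nrm (w n) ^+ 2 <= B)
  (w \in l2_pred).
Proof. exact: asboolP. Qed.

Fact l2_submod_closed : submod_closed l2_pred.
Proof.
split=> [|a u v /l2P[B hB] /l2P[D hD]]; apply/l2P.
  by exists 0 => N; rewrite big1 // => n _; rewrite Defs.hnorm0 expr0n.
exists (2 * (sqmod a * B) + 2 * D) => N.
apply: (@le_trans _ _ (\sum_(n < N) (2 * (sqmod a * nrm (u n) ^+ 2) + 2 * nrm (v n) ^+ 2))).
  apply: ler_sum => n _; apply: le_trans (nrmD_sqr _ _) _.
  rewrite lerD2r Defs.hnormZ exprMn; rewrite le_eqVlt; apply/orP; left; apply/eqP; congr (_ * (_ * _)).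
  by apply: complexI; rewrite sqmod_norm rcX -Re_ge0E.
rewrite big_split /= -!mulr_sumr; apply: lerD; rewrite ler_pM2l ?hD //.
by rewrite ler_wpM2l ?sqmod_ge0 ?hB.
Qed.

HB.instance Definition _ :=
  GRing.isSubmodClosed.Build C (nat -> H) l2_pred l2_submod_closed.

Definition l2 : Type := {w : nat -> H | w \in l2_pred}.
HB.instance Definition _ := SubChoice.on l2.
HB.instance Definition _ := [SubChoice_isSubLmodule of l2 by <:].
Implicit Types (u v w : l2).

Lemma l2_valD u v n : val (u + v) n = val u n + val v n. Proof. by []. Qed.
Lemma l2_valB u v n : val (u - v) n = val u n - val v n. Proof. by []. Qed.
Lemma l2_valZ (a : C) u n : val (a *: u) n = a *: val u n. Proof. by []. Qed.

Definition psum (u v : nat -> H) N : R := \sum_(n < N) rdot (u n) (v n).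
(** The real part of the inner product suffices: for complex subspaces, real and
    complex orthogonality agree. *)
Definition rho u v : R := limn (psum (val u) (val v)).

Lemma psumuu (u : nat -> H) N : psum u u N = \sum_(n < N) nrm (u n) ^+ 2.
Proof. by apply: eq_bigr => n _; rewrite rdotuu. Qed.

Lemma psum_nd (u : nat -> H) : nondecreasing_seq (psum u u).
Proof.
apply/nondecreasing_seqP => n.
by rewrite !psumuu big_ord_recr lerDl sqr_ge0.
Qed.

Lemma cvg_psumuu u : cvgn (psum (val u) (val u)).
Proof.
have /l2P[B hB] := valP u.
suff ub : has_ubound (range (psum (val u) (val u))).
  exact: nondecreasing_is_cvgn (psum_nd _) ub.
by exists B => _ [N _ <-]; rewrite psumuu.
Qed.

(** By polarization, from the monotone case. *)
Lemma cvg_psum u v : cvgn (psum (val u) (val v)).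
Proof.
have -> : psum (val u) (val v) = (fun N => 2^-1 * (psum (val (u + v)) (val (u + v)) N
    - psum (val u) (val u) N - psum (val v) (val v) N)).
  apply/funext => N; rewrite /psum -!sumrB mulr_sumr; apply: eq_bigr => n _.
  rewrite l2_valD rdotDl ![rdot _ (_ + _)]rdotC !rdotDl (rdotC (val v n)).
  by field.
apply: is_cvgM; first exact: is_cvg_cst.
apply: is_cvgB; last exact: cvg_psumuu.
apply: is_cvgB; exact: cvg_psumuu.
Qed.

Lemma rho_ext u v u' v' :
  (forall n, rdot (val u n) (val v n) = rdot (val u' n) (val v' n)) ->
  rho u v = rho u' v'.
Proof.
by move=> h; congr (limn _); apply/funext => N; apply: eq_bigr => n _.
Qed.

Lemma rhoC u v : rho u v = rho v u.
Proof. by apply: rho_ext => n; exact: rdotC. Qed.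

Lemma rhoDl u v w : rho (u + v) w = rho u w + rho v w.
Proof.
rewrite /rho -limD; try exact: cvg_psum.
congr (limn _); apply/funext => N; rewrite /psum -[RHS]big_split /=.
by apply: eq_bigr => n _; exact: rdotDl.
Qed.

Lemma rhoZl t u v : rho (t%:C *: u) v = t * rho u v.
Proof.
apply: cvg_lim => //.
have -> : psum (val (t%:C *: u)) (val v) = (fun N => t * psum (val u) (val v) N).
  apply/funext => N; rewrite /psum mulr_sumr.
  by apply: eq_bigr => n _; exact: rdotZl.
by apply: cvgMr; exact: cvg_psum.
Qed.

Lemma psum_le_rho u N : psum (val u) (val u) N <= rho u u.
Proof. by apply: nondecreasing_cvgn_le; [exact: psum_nd|exact: cvg_psumuu]. Qed.

Lemma rho_le u B : (forall N, psum (val u) (val u) N <= B) -> rho u u <= B.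
Proof.
move=> h; apply: limr_le; first exact: cvg_psumuu.
by near=> N; exact: h.
Unshelve. all: by end_near. Qed.

Lemma rho_ge0 u : 0 <= rho u u.
Proof. by apply: le_trans (psum_le_rho u 0); rewrite /psum big_ord0. Qed.

Lemma nrm_le_rho u n : nrm (val u n) ^+ 2 <= rho u u.
Proof.
apply: le_trans (psum_le_rho u n.+1); rewrite psumuu big_ord_recr /=.
by rewrite lerDr sumr_ge0 // => i _; exact: sqr_ge0.
Qed.

Lemma rho_eq0 u : rho u u = 0 -> u = 0.
Proof.
move=> u0; apply: val_inj; apply/funext => n; apply: (@Defs.hnorm_eq0 _ _ dot).
have := nrm_le_rho u n; rewrite u0 => h; apply/eqP.
by rewrite -sqrf_eq0 eq_le h sqr_ge0.
Qed.

End SquareSummable.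

(** * The ultrastrong bicommutant theorem *)

Section BicommutantDensity.
Context (R : realType) (H : hilbertSpace R).
Local Notation C := R[i].
Local Notation dot := (@hs_dot R H).
Local Notation nrm := (hnorm dot).
Local Notation l2 := (l2 H).
Implicit Types (u v w : l2).

(** The limit is taken coordinatewise; the Cauchy property, which is uniform in
    the number of terms, is inherited by the limit on partial sums. *)
Lemma l2_complete (u : nat -> l2) :
  (forall e, 0 < e -> exists N, forall m n, (N <= m)%N -> (N <= n)%N ->
     rho (u m - u n) (u m - u n) < e) ->
  exists l, forall e, 0 < e -> exists N, forall n, (N <= n)%N ->
    rho (u n - l) (u n - l) < e.
Proof.
move=> uC.
have /choice[l hl] n : exists l : H, forall e, 0 < e -> exists N, forall m,
    (N <= m)%N -> nrm (val (u m) n - l) ^+ 2 < e.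
  have [e e0|l hl] := @hs_complete R H (fun m => val (u m) n).
    have [|N hN] := uC (e ^+ 2); first by rewrite exprn_gt0.
    exists N => m m' hm hm'.
    rewrite -(@ltr_pXn2r _ 2) ?nnegrE ?(ltW e0) ?Defs.hnorm_ge0 //.
    exact: le_lt_trans (nrm_le_rho (u m - u m') n) (hN m m' hm hm').
  exists l => e e0.
  have s0 : 0 < Num.sqrt e by rewrite sqrtr_gt0.
  have := hl; move=> /cvgrPdist_lt /(_ _ s0)[N _ hN]; exists N => m hm.
  have := hN m hm; rewrite /= sub0r normrN ger0_norm ?Defs.hnorm_ge0 // => h.
  by rewrite -[ltRHS]sqr_sqrtr ?(ltW e0) // ltr_pXn2r ?nnegrE ?Defs.hnorm_ge0 ?(ltW s0).
have tail e : 0 < e -> exists N, forall m, (N <= m)%N -> forall M,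
    \sum_(n < M) nrm (val (u m) n - l n) ^+ 2 <= e.
  move=> e0; have [|N hN] := uC (e / 4); first by rewrite divr_gt0.
  exists N => m hm M.
  have e'0 : 0 < e / (4 * M.+1%:R) by rewrite divr_gt0 ?mulr_gt0 ?ltr0n.
  have /choice[N' hN'] (n : 'I_M) : exists N', forall m, (N' <= m)%N ->
      nrm (val (u m) n - l n) ^+ 2 < e / (4 * M.+1%:R) by exact: hl.
  pose m' := maxn N (\max_(n < M) N' n).
  have b1 : \sum_(n < M) nrm (val (u m') n - l n) ^+ 2 <= e / 4.
    apply: (@le_trans _ _ (\sum_(n < M) e / (4 * M.+1%:R))).
      apply: ler_sum => n _; apply/ltW/hN'.
      by rewrite /m' leq_max (leq_bigmax n) orbT.
    rewrite sumr_const card_ord -[leLHS]mulr_natr.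
    have -> : e / (4 * M.+1%:R) * M%:R = e / 4 * (M%:R / M.+1%:R).
      by rewrite invfM !mulrA; ring.
    rewrite -[leRHS]mulr1; apply: ler_wpM2l; first by rewrite divr_ge0 ?(ltW e0).
    by rewrite ler_pdivrMr ?ltr0n // mul1r ler_nat.
  have b2 : \sum_(n < M) nrm (val (u m) n - val (u m') n) ^+ 2 <= e / 4.
    have := hN m m' hm (leq_maxl _ _) => /ltW; apply: le_trans.
    by have := psum_le_rho (u m - u m') M; rewrite psumuu.
  apply: (@le_trans _ _ (\sum_(n < M) (2 * nrm (val (u m) n - val (u m') n) ^+ 2 +
      2 * nrm (val (u m') n - l n) ^+ 2))).
    apply: ler_sum => n _.
    have -> : val (u m) n - l n = (val (u m) n - val (u m') n) + (val (u m') n - l n).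
      by rewrite addrA subrK.
    exact: nrmD_sqr.
  rewrite big_split /= -!mulr_sumr.
  by move: (\sum_(n < M) _) (\sum_(n < M) _) b1 b2 => a b b1 b2; lra.
have l2l : l \in @l2_pred R H.
  have [N hN] := tail 1 ltr01.
  have dl2 : (fun n => val (u N) n - l n) \in @l2_pred R H.
    by apply/l2P; exists 1; exact: hN.
  have -> : l = val (u N) - (fun n => val (u N) n - l n).
    by apply/funext => n; rewrite /= opprB addrC subrK.
  by apply: rpredB => //; exact: valP.
exists (exist _ l l2l) => e e0.
have [|N hN] := tail (e / 2); first by rewrite divr_gt0.
exists N => m hm; apply: (@le_lt_trans _ _ (e / 2)); last by lra.
by apply: rho_le => M; rewrite psumuu; exact: hN.
Qed.

Section Lift.
Variables (f : H -> H) (lf : linear f) (c : R) (fc : bounded_by dot f c).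

Fact l2_map_subproof w : f \o val w \in @l2_pred R H.
Proof.
have [c0 hf] := fc; have /l2P[B hB] := valP w; apply/l2P; exists (c ^+ 2 * B) => N.
apply: (@le_trans _ _ (\sum_(n < N) c ^+ 2 * nrm (val w n) ^+ 2)).
  apply: ler_sum => n _; rewrite -exprMn lerXn2r ?nnegrE ?Defs.hnorm_ge0 //.
    by rewrite mulr_ge0 ?Defs.hnorm_ge0.
  exact: hf.
by rewrite -mulr_sumr ler_wpM2l ?exprn_ge0.
Qed.

Definition l2_map w : l2 := exist _ (f \o val w) (l2_map_subproof w).

Lemma l2_map_val w n : val (l2_map w) n = f (val w n). Proof. by []. Qed.

Lemma l2_map_linear : linear l2_map.
Proof. by move=> a u v; apply: val_inj; apply/funext => n; exact: lf. Qed.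

Lemma rho_l2_map_le w : rho (l2_map w) (l2_map w) <= c ^+ 2 * rho w w.
Proof.
have [c0 hf] := fc; apply: rho_le => N; rewrite psumuu.
apply: (@le_trans _ _ (c ^+ 2 * psum (val w) (val w) N)).
  rewrite psumuu mulr_sumr; apply: ler_sum => n _.
  rewrite -exprMn lerXn2r ?nnegrE ?Defs.hnorm_ge0 ?hf //.
  by rewrite mulr_ge0 ?Defs.hnorm_ge0.
by rewrite ler_wpM2l ?exprn_ge0 ?psum_le_rho.
Qed.

End Lift.

Fact l2_delta_subproof j (h : H) : (fun n => if n == j then h else 0) \in @l2_pred R H.
Proof.
apply/l2P; exists (nrm h ^+ 2); elim=> [|N IH]; first by rewrite big_ord0 sqr_ge0.
rewrite big_ord_recr /=; case: eqP => [->|_].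
  rewrite big1 ?add0r // => n _; rewrite (ltn_eqF (ltn_ord n)).
  by rewrite Defs.hnorm0 expr0n.
by rewrite Defs.hnorm0 expr0n addr0.
Qed.

Definition l2_delta j h : l2 :=
  exist _ (fun n => if n == j then h else 0) (l2_delta_subproof j h).

Lemma l2_delta_val j h n : val (l2_delta j h) n = if n == j then h else 0. Proof. by []. Qed.

Lemma l2_delta_linear j : linear (l2_delta j).
Proof.
move=> a h k; apply: val_inj; apply/funext => n.
rewrite l2_delta_val l2_valD l2_valZ !l2_delta_val; case: eqP => // _.
by rewrite scaler0 addr0.
Qed.

Lemma rho_l2_delta_le j h : rho (l2_delta j h) (l2_delta j h) <= nrm h ^+ 2.
Proof.
apply: rho_le; elim=> [|N IH]; first by rewrite /psum big_ord0 sqr_ge0.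
move: IH; rewrite !psumuu big_ord_recr /= => IH; case: eqP => [->|_].
  rewrite big1 ?add0r // => n _; rewrite (ltn_eqF (ltn_ord n)).
  by rewrite Defs.hnorm0 expr0n.
by rewrite Defs.hnorm0 expr0n addr0.
Qed.

Definition l2_truncate N w : l2 := \sum_(j < N) l2_delta j (val w j).

Lemma l2_truncate_val N w n : val (l2_truncate N w) n = if (n < N)%N then val w n else 0.
Proof.
rewrite /l2_truncate; elim: N => [|N IH]; first by rewrite big_ord0.
rewrite big_ord_recr l2_valD IH l2_delta_val ltnS [(n <= N)%N]leq_eqVlt.
by case: eqP => [->|_]; rewrite ?ltnn /= ?add0r ?addr0.
Qed.

Lemma l2_truncate_tail w e : 0 < e ->
  exists N, rho (w - l2_truncate N w) (w - l2_truncate N w) < e.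
Proof.
move=> e0; have cw := @cvg_psumuu R H w.
have : \forall N \near \oo, `|rho w w - psum (val w) (val w) N| < e / 2.
  by move/cvgrPdist_lt : cw; apply; rewrite divr_gt0.
case=> N _ hN; exists N; apply: (@le_lt_trans _ _ (e / 2)); last by lra.
apply: rho_le => M; have {hN} hN := ltW (hN N (leqnn N)).
apply: le_trans hN; apply: le_trans (ler_norm _).
rewrite lerBrDr; apply: le_trans (psum_le_rho w (M + N)).
apply: le_trans (_ : psum (val (w - l2_truncate N w)) (val (w - l2_truncate N w)) (M + N) +
    psum (val w) (val w) N <= _).
  by rewrite lerD2r; apply: psum_nd; rewrite leq_addr.
rewrite !psumuu (big_ord_widen (M + N) (fun n => nrm (val w n) ^+ 2)) ?leq_addl //.
rewrite [X in _ + X]big_mkcond -big_split; apply: ler_sum => n _.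
have -> : val (w - l2_truncate N w) n = if (n < N)%N then 0 else val w n.
  by rewrite l2_valB l2_truncate_val; case: ifP; rewrite ?subrr ?subr0.
by case: ifP => _ /=; rewrite ?Defs.hnorm0 ?expr0n ?add0r ?addr0.
Qed.

Section Density.
Variables (S : set (H -> H)) (sS : star_subalgebra S).
Variables (x : H -> H) (Sx : commutant (commutant S) x) (xi : l2).

Let S_lin f : S f -> linear f.
Proof. by case: sS => h _ _ _ _ /h[]. Qed.
Let S_bdd f : S f -> exists c, bounded_by dot f c.
Proof. by case: sS => h _ _ _ _ /h[]. Qed.

(** The closed subspace of square-summable sequences generated by the sequences
    (a xi_n)_n for a in S. *)
Definition orbit_closure : set l2 := [set w : l2 | forall e : R, 0 < e ->
  exists2 a, S a & forall N, \sum_(n < N) nrm (val w n - a (val xi n)) ^+ 2 <= e].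

Lemma orbit_closure0 : orbit_closure 0.
Proof.
move=> e e0; exists (0 : H -> H).
  case: sS => _ S1 Slin _ _; have := Slin (-1) _ _ S1 S1.
  by rewrite scaleN1r addNr.
by move=> N; rewrite big1 ?ltW // => n _; rewrite subr0 Defs.hnorm0 expr0n.
Qed.

Lemma orbit_closure_lin a u v : orbit_closure u -> orbit_closure v ->
  orbit_closure (a *: u + v).
Proof.
move=> Ku Kv e e0.
pose c := 4 * (sqmod a + 1).
have c0 : 0 < c by rewrite mulr_gt0 // ltr_wpDl ?sqmod_ge0.
have [f Sf hf] := Ku (e / c) (divr_gt0 e0 c0).
have [g Sg hg] := Kv (e / 4) (divr_gt0 e0 (ltr0Sn _ 3)).
exists (a *: f + g); first by case: sS => _ _ Slin _ _; exact: Slin.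
move=> N.
apply: (@le_trans _ _ (\sum_(n < N) (2 * (sqmod a * nrm (val u n - f (val xi n)) ^+ 2)
    + 2 * nrm (val v n - g (val xi n)) ^+ 2))).
  apply: ler_sum => n _; rewrite l2_valD l2_valZ.
  have -> : a *: val u n + val v n - (a *: f + g) (val xi n) =
      a *: (val u n - f (val xi n)) + (val v n - g (val xi n)).
    by rewrite scalerBr addrACA -opprD.
  apply: le_trans (nrmD_sqr _ _) _; rewrite lerD2r Defs.hnormZ exprMn.
  rewrite le_eqVlt; apply/orP; left; apply/eqP; congr (_ * (_ * _)).
  by apply: complexI; rewrite sqmod_norm rcX -Re_ge0E.
rewrite big_split /= -!mulr_sumr.
have h1 : sqmod a * (\sum_(n < N) nrm (val u n - f (val xi n)) ^+ 2) <= e / 4.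
  apply: (@le_trans _ _ (sqmod a * (e / c))); first by rewrite ler_wpM2l ?sqmod_ge0.
  have s0 := sqmod_ge0 a; have s1 : sqmod a + 1 != 0 by rewrite gt_eqF ?ltr_wpDl.
  have -> : sqmod a * (e / c) = e / 4 * (sqmod a / (sqmod a + 1)).
    by rewrite /c; field.
  rewrite -[leRHS]mulr1; apply: ler_wpM2l; first by rewrite divr_ge0 ?ltW.
  by rewrite ler_pdivrMr ?ltr_wpDl // mul1r lerDl.
have := hg N; move: (\sum_(n < N) _) h1 => b; move: (sqmod a * _) => d; lra.
Qed.

Lemma orbit_closure_closed u :
  (forall e, 0 < e -> exists2 k, orbit_closure k & rho (u - k) (u - k) < e) ->
  orbit_closure u.
Proof.
move=> h e e0; have e4 : 0 < e / 4 by rewrite divr_gt0.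
have [k Kk uk] := h _ e4; have [a Sa ka] := Kk _ e4; exists a => // N.
apply: (@le_trans _ _ (\sum_(n < N) (2 * nrm (val u n - val k n) ^+ 2 +
    2 * nrm (val k n - a (val xi n)) ^+ 2))).
  apply: ler_sum => n _; have -> : val u n - a (val xi n) =
      (val u n - val k n) + (val k n - a (val xi n)) by rewrite addrA subrK.
  exact: nrmD_sqr.
rewrite big_split /= -!mulr_sumr.
have := psum_le_rho (u - k) N; rewrite psumuu; have := ka N.
move: (\sum_(n < N) _) (\sum_(n < N) _) (rho _ _) uk => b c r; lra.
Qed.

Lemma orbit_closure_l2_map f c (lf : linear f) (fc : bounded_by dot f c) w :
  S f -> orbit_closure w -> orbit_closure (l2_map fc w).
Proof.
move=> Sf Kw e e0; have [c0 hf] := fc.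
have c1 : 0 < c ^+ 2 + 1 by rewrite ltr_wpDl ?sqr_ge0.
have [a Sa wa] := Kw (e / (c ^+ 2 + 1)) (divr_gt0 e0 c1).
exists (f \o a); first by case: sS => _ _ _ SM _; exact: SM.
move=> N; apply: (@le_trans _ _ ((c ^+ 2 + 1) * (e / (c ^+ 2 + 1)))); last first.
  by rewrite mulrC divfK // gt_eqF.
apply: le_trans (_ : (c ^+ 2 + 1) * \sum_(n < N) nrm (val w n - a (val xi n)) ^+ 2 <= _).
  rewrite mulr_sumr; apply: ler_sum => n _; rewrite l2_map_val /=.
  have -> : f (val w n) - f (a (val xi n)) = f (val w n - a (val xi n)).
    by have := lf (-1) (a (val xi n)) (val w n); rewrite !scaleN1r ![- _ + _]addrC.
  apply: le_trans (_ : c ^+ 2 * nrm (val w n - a (val xi n)) ^+ 2 <= _).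
    rewrite -exprMn lerXn2r ?nnegrE ?Defs.hnorm_ge0 ?hf //.
    by rewrite mulr_ge0 ?Defs.hnorm_ge0.
  by rewrite ler_wpM2r ?sqr_ge0 // lerDl.
by apply: ler_wpM2l; [exact: ltW|exact: wa].
Qed.

Lemma orbit_closure_base : orbit_closure xi.
Proof.
move=> e e0; exists id; first by case: sS.
by move=> N; rewrite big1 ?ltW // => n _; rewrite subrr Defs.hnorm0 expr0n.
Qed.

Local Notation K := orbit_closure.

Let KD u v : K u -> K v -> K (u + v).
Proof. by move=> Ku Kv; rewrite -[u]scale1r; exact: orbit_closure_lin. Qed.
Let KZ (a : C) u : K u -> K (a *: u).
Proof. by move=> Ku; rewrite -[_ *: _]addr0; apply: orbit_closure_lin => //; exact: orbit_closure0. Qed.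
Let KB u v : K u -> K v -> K (u - v).
Proof. by move=> Ku Kv; rewrite -scaleN1r; apply: KD => //; exact: KZ. Qed.

Let rBl u v w : rho (u - v) w = rho u w - rho v w.
Proof. exact: (rhoBl (@rhoDl R H) (@rhoZl R H)). Qed.
Let rBr u v w : rho w (u - v) = rho w u - rho w v.
Proof. exact: (rhoBr (@rhoC R H) (@rhoDl R H) (@rhoZl R H)). Qed.
Let rDr u v w : rho w (u + v) = rho w u + rho w v.
Proof. exact: (rhoDr (@rhoC R H) (@rhoDl R H)). Qed.

Lemma rhoZ_conj (a : C) u v : rho (a *: u) v = rho u (a^*%R *: v).
Proof. by apply: rho_ext => n; rewrite !l2_valZ rdotZ_conj. Qed.

Lemma rhoD_sqr u v : rho (u + v) (u + v) <= 2 * rho u u + 2 * rho v v.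
Proof.
have := rho_ge0 (u - v); rewrite rBl !rBr rhoDl !rDr (rhoC v u); lra.
Qed.

(** Let P be the orthogonal projection onto the orbit closure K of xi.  As S is
    closed under adjoints, P commutes with the diagonal action of S, so that the
    matrix entries of P, seen as operators on H, lie in the commutant of S and
    commute with x.  Hence P commutes with the diagonal action of x on sequences
    with finitely many nonzero terms, then on xi by continuity.  As xi belongs to
    K, so does (x xi_n)_n. *)
Lemma bicommutant_density (e : R) : 0 < e ->
  exists2 a, S a & forall N, \sum_(n < N) nrm (x (val xi n) - a (val xi n)) ^+ 2 <= e.
Proof.
have [[lx [c xc]] xcomm] := Sx; have [c0 _] := xc.
suff : K (l2_map xc xi) by move=> h /h.
have /choice[P hP] w : exists p, K p /\ forall k, K k -> rho (w - p) k = 0.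
  have [p Kp hp] := @orthogonal_projection R (l2 : lmodType C) (@rho R H)
    (@rhoC R H) (@rhoDl R H) (@rhoZl R H) (@rho_ge0 R H) l2_complete K w
    orbit_closure0 KD (fun t u => @KZ t%:C u) orbit_closure_closed.
  by exists p.
have PK w : K (P w) by case: (hP w).
have orth w k : K k -> rho (w - P w) k = 0 by case: (hP w) => _; exact.
have Puniq w p : K p -> (forall k, K k -> rho (w - p) k = 0) -> P w = p.
  move=> Kp hp; apply/eqP; rewrite -subr_eq0; apply/eqP; apply: rho_eq0.
  set k := P w - p; have Kk : K k by exact: KB.
  have kE : k = (w - p) - (w - P w) by rewrite opprB addrC subrKA.
  by rewrite {1}kE rBl hp // orth // subrr.
have Plin a u v : P (a *: u + v) = a *: P u + P v.
  apply: Puniq; first by apply: KD => //; exact: KZ.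
  move=> k Kk; have -> : a *: u + v - (a *: P u + P v) = a *: (u - P u) + (v - P v).
    by rewrite scalerBr opprD addrACA.
  by rewrite rhoDl rhoZ_conj !orth ?addr0 //; exact: KZ.
have Pfix w : K w -> P w = w.
  by move=> Kw; apply: Puniq => // k _; rewrite subrr -(scale0r w) rhoZl mul0r.
have Ple w : rho (P w) (P w) <= rho w w.
  have := rho_ge0 (w - P w); have := orth w _ (PK w).
  have -> : rho w w = rho (w - P w) (w - P w) + 2 * rho (w - P w) (P w) + rho (P w) (P w).
    rewrite !rBl !rBr (rhoC (P w) w); ring.
  lra.
have Plift f d (lf : linear f) (fd : bounded_by dot f d) w : S f ->
    P (l2_map fd w) = l2_map fd (P w).
  move=> Sf; apply: Puniq; first exact: orbit_closure_l2_map.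
  move=> k Kk; have [g Sg fg] : exists2 g, S g & is_adjoint dot f g.
    by case: sS => _ _ _ _; apply.
  have [d' gd] := S_bdd Sg.
  transitivity (rho (w - P w) (l2_map gd k)); last first.
    by apply: orth; apply: orbit_closure_l2_map => //; exact: S_lin.
  apply: rho_ext => n; rewrite -(rdot_adjoint fg); congr (rdot _ _).
  rewrite !l2_valB !l2_map_val.
  by have := lf (-1) (val (P w) n) (val w n); rewrite !scaleN1r ![- _ + _]addrC.
have f0 (f : H -> H) : linear f -> f 0 = 0.
  move=> lf; have := lf (-1) (0 : H) (0 : H).
  by rewrite scaler0 addr0 scaleN1r addNr.
(* the (i, j) entry of P commutes with x *)
have Pdelta i j h : val (P (l2_delta j (x h))) i = x (val (P (l2_delta j h)) i).
  pose g h' := val (P (l2_delta j h')) i.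
  suff : commutant S g by move/xcomm/(congr1 (fun t => t h)).
  split.
    split; first by move=> a h1 h2; rewrite /g l2_delta_linear Plin l2_valD l2_valZ.
    exists 1; split=> // h'; rewrite mul1r.
    rewrite -(@ler_pXn2r _ 2) ?nnegrE ?Defs.hnorm_ge0 //.
    apply: le_trans (nrm_le_rho _ _) _; apply: le_trans (Ple _) _.
    exact: rho_l2_delta_le.
  move=> f Sf; apply/funext => h'; have [d fd] := S_bdd Sf.
  rewrite /= /g -(l2_map_val fd) -Plift //; last exact: S_lin.
  congr (val (P _) i); apply: val_inj; apply/funext => n.
  rewrite l2_map_val !l2_delta_val; case: eqP => // _; rewrite f0 //; exact: S_lin.
pose B w := P (l2_map xc w) - l2_map xc (P w).
have Blin a u v : B (a *: u + v) = a *: B u + B v.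
  rewrite /B l2_map_linear // !Plin l2_map_linear // scalerBr opprD.
  by rewrite addrACA.
have Bdelta j h : B (l2_delta j h) = 0.
  apply/eqP; rewrite subr_eq0; apply/eqP/val_inj/funext => i.
  rewrite l2_map_val -Pdelta; congr (val (P _) i); apply/val_inj/funext => n.
  by rewrite l2_map_val !l2_delta_val; case: eqP => // _; rewrite f0.
have B0 : B 0 = 0.
  by have := Blin (-1) 0 0; rewrite scaler0 addr0 scaleN1r addNr.
have Btrunc N w : B (l2_truncate N w) = 0.
  rewrite /l2_truncate; elim: N => [|N IH]; first by rewrite big_ord0.
  by rewrite big_ord_recr /= -[\sum_(i < N) _]scale1r Blin IH Bdelta scaler0 addr0.
have Ble w : rho (B w) (B w) <= 4 * c ^+ 2 * rho w w.
  have := rhoD_sqr (P (l2_map xc w)) (- l2_map xc (P w)).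
  have -> : rho (- l2_map xc (P w)) (- l2_map xc (P w)) = rho (l2_map xc (P w)) (l2_map xc (P w)).
    by apply: rho_ext => n; rewrite /rdot linearNl linearNr opprK.
  have h1 := Ple (l2_map xc w); have h2 := rho_l2_map_le xc w.
  have h3 := rho_l2_map_le xc (P w).
  have h4 : c ^+ 2 * rho (P w) (P w) <= c ^+ 2 * rho w w.
    by rewrite ler_wpM2l ?sqr_ge0.
  move: (c ^+ 2 * rho (P w) (P w)) h3 h4 => z h3 h4.
  rewrite -mulrA; move: (c ^+ 2 * rho w w) h2 h4 => y h2 h4 h5.
  by rewrite -/(B w) in h5; lra.
(* B is bounded and vanishes on the truncations of xi, whose tails are small *)
have Bxi : B xi = 0.
  apply: rho_eq0; apply/eqP; rewrite eq_le rho_ge0 andbT.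
  apply/ler_addgt0Pl => d d0; rewrite addr0.
  have q0 : 0 < 4 * c ^+ 2 + 1 by rewrite ltr_wpDl ?mulr_ge0 ?sqr_ge0.
  have [N hN] := l2_truncate_tail xi (divr_gt0 d0 q0).
  have -> : B xi = B (xi - l2_truncate N xi).
    by rewrite addrC -scaleN1r Blin Btrunc scaler0 add0r.
  apply: le_trans (Ble _) _; move: hN; rewrite ltr_pdivlMr //.
  have := rho_ge0 (xi - l2_truncate N xi); move: (rho _ _) => z; lra.
have := Bxi; rewrite /B (Pfix xi orbit_closure_base) => /eqP.
by rewrite subr_eq0 => /eqP <-.
Qed.

End Density.
End BicommutantDensity.

(** * Density for the 2-norm in a tracial von Neumann algebra *)

Section Interleaving.
Context (R : realType) (H : hilbertSpace R).
Local Notation nrm := (hnorm (@hs_dot R H)).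

Lemma sum_blocks m N (g : nat -> R) :
  \sum_(i < N * m) g i = \sum_(n < N) \sum_(j < m) g (n * m + j)%N.
Proof.
elim: N => [|N IH]; first by rewrite mul0n !big_ord0.
by rewrite mulSnr big_split_ord big_ord_recr /= IH.
Qed.

(** The term [z j n] is stored at index n * m + j; for m = 0 the sequence is
    constantly 0. *)
Lemma interleave m (z : 'I_m -> nat -> H) :
  (forall j, exists B : R, forall N, \sum_(n < N) nrm (z j n) ^+ 2 <= B) ->
  exists xi : l2 H, forall (g : H -> R), (forall h, 0 <= g h) -> forall j N,
    \sum_(n < N) g (z j n) <= \sum_(i < N * m) g (val xi i).
Proof.
move=> /choice[B hB].
pose xi i : H := if insub (i %% m)%N is Some j then z j (i %/ m)%N else 0.
have xiE n (j : 'I_m) : xi (n * m + j)%N = z j n.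
  have m0 : (0 < m)%N by apply: leq_ltn_trans (ltn_ord j).
  rewrite /xi modnMDl divnMDl // modn_small // divn_small // addn0.
  by rewrite valK.
have xiP : xi \in @l2_pred R H.
  apply/l2P; exists (\sum_j B j) => N.
  have [m0|m0] := posnP m.
    rewrite big1 => [|i _].
      apply: sumr_ge0 => j _; have := ltn_ord j; by rewrite [X in (_ < X)%N]m0.
    rewrite /xi; case: insubP => [j|_]; first by have := ltn_ord j; rewrite [X in (_ < X)%N]m0.
    by rewrite Defs.hnorm0 expr0n.
  apply: le_trans (_ : \sum_(i < N * m) nrm (xi i) ^+ 2 <= _).
    rewrite (big_ord_widen (N * m) (fun i => nrm (xi i) ^+ 2)) ?leq_pmulr //.
    rewrite big_mkcond; apply: ler_sum => i _; case: ifP => // _.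
    exact: sqr_ge0.
  rewrite (@sum_blocks m N (fun i => nrm (xi i) ^+ 2)) exchange_big.
  apply: ler_sum => j _; apply: le_trans (hB j N).
  by rewrite le_eqVlt; apply/orP; left; apply/eqP/eq_bigr => n _; rewrite xiE.
exists (exist _ xi xiP) => g g0 j N /=.
rewrite (@sum_blocks m N (fun i => g (xi i))); apply: ler_sum => n _.
rewrite (bigD1 j) //= xiE lerDl; exact: sumr_ge0.
Qed.

Lemma square_summable_bound (x : nat -> H) : square_summable x ->
  exists B : R, forall N, \sum_(n < N) nrm (x n) ^+ 2 <= B.
Proof.
move=> sx; exists (limn (series (fun n => nrm (x n) ^+ 2))) => N.
rewrite -(big_mkord xpredT (fun n => nrm (x n) ^+ 2)).
apply: (nondecreasing_cvgn_le _ sx N).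
apply/nondecreasing_seqP => n; rewrite /series /= big_nat_recr //=.
by rewrite lerDl sqr_ge0.
Qed.

End Interleaving.

Section Normality.
Context (R : realType) (H : hilbertSpace R) (M : vonNeumannAlgebra H).
Context (tau : faithful_normal_tracial_state M).
Local Notation C := R[i].
Local Notation dot := (@hs_dot R H).
Local Notation nrm := (hnorm dot).
Local Notation T := (vn_algebra tau).

(** If [F] diverges then [limn F] is the default value 0, so that convergence need
    not be assumed. *)
Lemma limn_norm_le (F : nat -> C^o) (b e : R) : 0 < e -> 0 <= b ->
  (forall N, `|F N| <= b%:C) -> `|limn F| < (b + e)%:C.
Proof.
move=> e0 b0 Fb; have [cF|ncF] := pselect (cvgn F).
  have eC : 0 < e%:C :> C by rewrite ltcR.
  have : \forall N \near \oo, `|limn F - F N| < e%:C.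
    by move/cvgrPdist_lt : cF; apply.
  case=> N _ /(_ N (leqnn N)) h.
  rewrite -[limn F](subrK (F N)) (le_lt_trans (ler_normD _ _)) // addrC rcD.
  exact: ler_ltD.
rewrite (dvgP ncF) normr0 ltcR; lra.
Qed.

Lemma vn_dot_star (t : T) u v :
  dot (val (star t * t) u) v = dot (val t u) (val t v).
Proof. by rewrite -(is_adjointC (vn_adjointP t)). Qed.

(** Normality bounds tau (star t * t) once finitely many functionals
    f -> sum <f x_n, y_n> are small at star t * t; by the Cauchy-Schwarz
    inequality this holds when t is small on all the sequences x and y, which are
    merged into one. *)
Lemma norm2_small_on_l2 (e : R) : 0 < e -> exists (xi : l2 H) (d : R), 0 < d /\
  forall t : T, (forall N, \sum_(i < N) nrm (val t (val xi i)) ^+ 2 <= d) ->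
    norm2 t ^+ 2 <= e.
Proof.
move=> e0; have [k [x [y [sxy [d d0 hd]]]]] := ts_normal tau e0.
pose z (j : 'I_(k + k)%N) := match fintype.split j with inl i => x i | inr i => y i end.
have [|xi hxi] := @interleave R H (k + k)%N z.
  move=> j; apply: square_summable_bound; rewrite /z.
  by case: (fintype.split j) => i; case: (sxy i).
have zx i : z (lshift k i) = x i by rewrite /z (unsplitK (inl i)).
have zy i : z (rshift k i) = y i by rewrite /z (unsplitK (inr i)).
exists xi, (d / 2); split; first by rewrite divr_gt0.
move=> t ht.
have bd j N : \sum_(n < N) nrm (val t (z j n)) ^+ 2 <= d / 2.
  apply: le_trans (hxi (fun h => nrm (val t h) ^+ 2) _ j N) (ht _) => h.
  exact: sqr_ge0.
have : `|tau (val (star t * t))| < e%:C.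
  apply: hd => [|j]; first exact: vn_valP.
  have -> : d = d / 2 + d / 2 by field.
  apply: limn_norm_le; rewrite ?divr_gt0 ?divr_ge0 ?(ltW d0) // => N.
  apply: le_trans (ler_norm_sum _ _ _) _.
  apply: le_trans (_ : \sum_(n < N) (2^-1 * (nrm (val t (x j n)) ^+ 2 +
      nrm (val t (y j n)) ^+ 2))%:C <= _).
    apply: ler_sum => n _; rewrite vn_dot_star.
    apply: le_trans (cauchy_schwarz _ _ _) _; rewrite lecR.
    have := sqr_ge0 (nrm (val t (x j n)) - nrm (val t (y j n))); rewrite sqrrB; lra.
  rewrite -rmorph_sum lecR -mulr_sumr big_split /= .
  have := bd (lshift k j) N; have := bd (rshift k j) N; rewrite zx zy; lra.
have -> : tau (val (star t * t)) = (norm2 t ^+ 2)%:C by rewrite -norm2E.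
by rewrite ger0_norm ?ler0c ?sqr_ge0 // ltcR => /ltW.
Qed.

End Normality.

(** * Hyperfinite von Neumann algebras have property Gamma *)

Section HyperfiniteTower.
Context (R : realType) (H : hilbertSpace R) (M : vonNeumannAlgebra H).
Context (tau : faithful_normal_tracial_state M).
Local Notation C := R[i].
Local Notation dot := (@hs_dot R H).
Local Notation nrm := (hnorm dot).
Local Notation T := (vn_algebra tau).
Variable (A : nat -> set (H -> H)).
Hypotheses (sA : forall k, star_subalgebra (A k))
  (fA : forall k, finite_dimensional (A k))
  (Ainc : forall k, A k `<=` A k.+1)
  (AM : commutant (commutant (\bigcup_k A k)) = vn_ops M).

Lemma ops_chain_le k l : (k <= l)%N -> A k `<=` A l.
Proof.
move=> /subnK <-; elim: (l - k)%N => [|m IH] //= x Ax.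
exact/Ainc/IH.
Qed.

Lemma common_stage f g : (\bigcup_k A k) f -> (\bigcup_k A k) g ->
  exists k, A k f /\ A k g.
Proof.
move=> [k _ fk] [l _ gl]; exists (maxn k l); split.
  by apply: ops_chain_le fk; exact: leq_maxl.
by apply: ops_chain_le gl; exact: leq_maxr.
Qed.

Lemma bigcup_star_subalgebra : star_subalgebra (\bigcup_k A k).
Proof.
split.
- by move=> f [k _]; case: (sA k) => h _ _ _ _ /h.
- by exists 0%N => //; case: (sA 0%N).
- move=> a f g Sf Sg; have [k [fk gk]] := common_stage Sf Sg.
  by exists k => //; case: (sA k) => _ _ h _ _; exact: h.
- move=> f g Sf Sg; have [k [fk gk]] := common_stage Sf Sg.
  by exists k => //; case: (sA k) => _ _ _ h _; exact: h.
move=> f [k _ fk]; case: (sA k) => _ _ _ _ /(_ f fk)[g gk fg].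
by exists g => //; exists k.
Qed.

Lemma stage_in_M k : A k `<=` vn_ops M.
Proof.
move=> f fk; rewrite -AM; split.
  by case: (sA k) => h _ _ _ _; exact: h.
by move=> g [_ gA]; rewrite gA //; exists k.
Qed.

Definition stage k : set T := [set x | A k (val x)].

Lemma stage_star_closed k : star_closed (stage k).
Proof.
have [_ S1 Slin SM Sstar] := sA k; split.
- by have := Slin (-1) _ _ S1 S1; rewrite scaleN1r addNr.
- by move=> a x y xk yk; apply: Slin.
- by move=> x y xk yk; apply: SM.
move=> x xk; have [g gk xg] := Sstar _ xk.
have xgE : g = val (star x) := adjoint_inj xg (vn_adjointP x).
by rewrite /stage /mkset -xgE.
Qed.

Lemma stage1 k : stage k 1.
Proof. by case: (sA k). Qed.

Lemma stage_inc k : stage k `<=` stage k.+1.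
Proof. by move=> x; exact: Ainc. Qed.

Lemma onb_finite_span (S : set T) n (a : nat -> T) :
  (forall x, S x -> x = \sum_(i < n) ip x (a i) *: a i) -> finite_span S.
Proof.
by move=> aS; exists 'I_n, (fun i : 'I_n => a i) => x /aS xE; exists (fun i : 'I_n => ip x (a i)).
Qed.

Lemma vn_val_sum (I : Type) (r : seq I) (F : I -> T) :
  val (\sum_(i <- r) F i) = \sum_(i <- r) val (F i).
Proof. exact: raddf_sum. Qed.

(** The functions spanning [A k] are not assumed to lie in M, so the trace inner
    product is not defined on them; they only serve to bound the length of
    orthonormal families of [stage k]. *)
Lemma stage_finite_span k : finite_span (stage k).
Proof.
have [d [b bA]] := fA k.
have bd n (a : nat -> T) : (forall i, (i < n)%N -> stage k (a i)) ->
    orthonormal_family n a -> (n <= d)%N.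
  move=> ak an; rewrite leqNgt; apply/negP => dn.
  have /choice[c hc] (i : 'I_n) : exists c : 'I_d -> C, val (a i) = \sum_j c j *: b j.
    exact/bA/ak.
  pose N := \matrix_(i < n, j < d) c i j.
  have : kermx N != 0.
    rewrite kermx_eq0 /row_free neq_ltn; apply/orP; left.
    exact: leq_ltn_trans (rank_leq_col _) dn.
  case/rowV0Pn => v /sub_kermxP vN /negP; apply.
  have va : \sum_i v 0 i *: a i = 0.
    apply: val_inj; rewrite vn_val_sum.
    rewrite (eq_bigr (fun i => \sum_j (v 0 i * c i j) *: b j)); last first.
      by move=> i _; rewrite vn_valZ hc scaler_sumr; apply: eq_bigr => j _; rewrite scalerA.
    rewrite exchange_big big1 //= => j _; rewrite -scaler_suml.
    suff -> : \sum_i v 0 i * c i j = 0 by rewrite scale0r.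
    have /rowP/(_ j) := vN; rewrite !mxE => vN0; rewrite -[RHS]vN0.
    by apply: eq_bigr => i _; rewrite !mxE.
  apply/eqP/rowP => j; rewrite mxE.
  have : ip (\sum_i v 0 i *: a i) (a j) = 0 by rewrite va ip0l.
  rewrite ip_suml (bigD1 j) //= big1 => [|i ij].
    by rewrite ipZl an // eqxx mulr1 addr0.
  by rewrite ipZl an // -val_eqE /= in ij *; rewrite (negPf ij) mulr0.
have [n [a [_ _ _ aS]]] := onb_exists_bound (star_closed_linear (stage_star_closed k)) bd.
exact: onb_finite_span aS.
Qed.

Lemma stage_dense (x : T) (e : R) : 0 < e ->
  exists k, exists2 y, stage k y & norm2 (x - y) ^+ 2 <= e.
Proof.
move=> e0; have [xi [d [d0 hd]]] := norm2_small_on_l2 tau e0.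
have xA : commutant (commutant (\bigcup_k A k)) (val x).
  by rewrite AM; exact: vn_valP.
have [a [k _ ak] ha] := bicommutant_density bigcup_star_subalgebra xA xi d0.
have aM := stage_in_M ak.
pose y : T := exist _ a (introT (vnP _ _) aM).
by exists k, y => //; apply: hd.
Qed.

Hypothesis inf_dim : ~ finite_dimensional (vn_ops M).

(** Otherwise the union of the stages is finite dimensional, hence closed for the
    2-norm, and being dense it is all of M. *)
Lemma stage_orthonormal d : exists k (x : nat -> T), orthonormal_family d x /\
  forall i, (i < d)%N -> stage k (x i).
Proof.
apply: contrapT => none; apply: inf_dim.
pose S : set T := \bigcup_k stage k.
have lS : linear_subspace S.
  split; first by exists 0%N => //; case: (stage_star_closed 0%N).
  move=> a x y Sx Sy.
  have [k [xk yk]] : exists k, A k (val x) /\ A k (val y).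
    by apply: common_stage; [case: Sx => k _ ?|case: Sy => k _ ?]; exists k.
  by exists k => //; case: (stage_star_closed k) => _ h _ _; exact: h.
have Sd n (a : nat -> T) : (forall i, (i < n)%N -> S (a i)) ->
    orthonormal_family n a -> (n <= d)%N.
  move=> Sa an; rewrite leqNgt; apply/negP => dn; apply: none.
  have /choice[l hl] (i : 'I_n) : exists l, stage l (a i).
    by have [l _ al] := Sa i (ltn_ord i); exists l.
  exists (\max_(i < n) l i), a; split.
    by move=> i j hi hj; apply: an; apply: ltn_trans dn.
  move=> i hi; have hin := ltn_trans hi dn.
  apply: (ops_chain_le _ (hl (Ordinal hin))).
  exact: (leq_bigmax (Ordinal hin)).
have [n [a [_ Sa an aS]]] := onb_exists_bound lS Sd.
have [I [b bS]] := onb_finite_span aS.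
exists n, (fun i : 'I_n => val (a i)) => f fM.
pose x : T := exist _ f (introT (vnP _ _) fM).
have [y Sy xy] := orth_proj_exists lS x bS.
have xyE : x = y.
  apply/eqP; rewrite -subr_eq0; apply/eqP/norm2_eq0/eqP.
  rewrite -sqrf_eq0 eq_le sqr_ge0 andbT; apply/ler_addgt0Pl => e e0; rewrite addr0.
  have [k [z zk xz]] := stage_dense x e0.
  have Sz : S z by exists k.
  apply: le_trans xz; have -> : x - z = (x - y) + (y - z) by rewrite addrA subrK.
  have xyz : ip (x - y) (y - z) = 0 by apply: xy; exact: (subB lS).
  by rewrite (norm2_pythagoras xyz) lerDl sqr_ge0.
exists (fun i : 'I_n => ip y (a i)).
rewrite -[f]/(val x) xyE {1}(aS y Sy) vn_val_sum.
by apply: eq_bigr => i _; rewrite vn_valZ.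
Qed.

Lemma vn_projection_norm (z : T) : projection z -> anorm z <= 1.
Proof.
move=> [zz sz]; apply: opnorm_lb; split=> // u; rewrite mul1r.
have [->|z0] := eqVneq (nrm (val z u)) 0; first exact: Defs.hnorm_ge0.
have zu : 0 < nrm (val z u) by rewrite lt_def z0 Defs.hnorm_ge0.
rewrite -(ler_pM2l zu) -expr2.
have := cauchy_schwarz dot (val z u) u => /le_rc_Re; apply: le_trans.
have -> : dot (val z u) u = dot (val z u) (val z u).
  by rewrite -vn_dot_star sz zz.
by rewrite dotE.
Qed.

(** The commutator of [z] with [x i] only sees the distance from [x i] to a stage
    commuting with [z], since [z] has norm at most 1. *)
Theorem property_gamma : exists2 d : R, 0 < d &
  forall (m : nat) (x : 'I_m -> T) (e : R), 0 < e ->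
  exists z : T, [/\ projection z, anorm z <= 1, d <= tr z <= 1 - d &
    forall i, norm2 (x i * z - z * x i) <= e].
Proof.
have [d d0 hd] := asymptotically_central stage_star_closed stage1 stage_finite_span
  stage_inc stage_orthonormal.
exists d => // m x e e0.
pose e' := (e / 4) ^+ 2.
have e'0 : 0 < e' by rewrite exprn_gt0 // divr_gt0.
have /choice[l hl] i : exists l, exists2 y, stage l y & norm2 (x i - y) ^+ 2 <= e'.
  exact: stage_dense.
have [z [pz zA tz]] := hd (\max_(i < m) l i).
exists z; split=> //; first exact: vn_projection_norm.
move=> i; have [y yl xy] := hl i.
have yz : y * z = z * y.
  by apply: zA; apply: (ops_chain_le _ yl); exact: leq_bigmax.
have -> : x i * z - z * x i = (x i - y) * z - z * (x i - y).
  by rewrite mulrBl mulrBr yz opprB addrA subrK.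
have {}xy : norm2 (x i - y) <= e / 4.
  by rewrite -(@ler_pXn2r _ 2) ?nnegrE ?norm2_ge0 // divr_ge0 ?ltW.
have z1 := vn_projection_norm pz.
have h1 : norm2 ((x i - y) * z) <= norm2 (x i - y).
  by rewrite (le_trans (norm2M_ler _ _)) // -[leRHS]mulr1 ler_wpM2l ?norm2_ge0.
have h2 : norm2 (z * (x i - y)) <= norm2 (x i - y).
  by rewrite (le_trans (norm2M_le _ _)) // -[leRHS]mul1r ler_wpM2r ?norm2_ge0.
have := norm2D_le ((x i - y) * z) (- (z * (x i - y))); rewrite norm2N.
lra.
Qed.

End HyperfiniteTower.

(** * Limits along a free ultrafilter *)

Section Ultralimits.
Context (R : realType) (omega : free_ultrafilter).
Local Notation C := R[i].
Local Notation om := (ultrafilter_sets omega).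

Lemma free_ultrafilter_ge N : \forall n \near om, (N <= n)%N.
Proof.
elim: N => [|N IH]; first by apply: filterE.
have [E oE EN] : exists2 E, om E & ~ E N.
  apply: contrapT => h; have : (\bigcap_(E in om) E) N.
    by move=> E oE; apply: contrapT => EN; apply: h; exists E.
  by rewrite ultrafilter_free.
apply: filterS2 IH oE => n Nn En; rewrite ltn_neqAle Nn andbT.
by apply/eqP => nN; apply: EN; rewrite nN.
Qed.

Lemma cvg_inv_omega : n.+1%:R^-1 @[n --> om] --> (0 : R).
Proof.
apply/cvgrPdist_lt => e e0; have [N hN] := ex_inv_lt e0.
apply: filterS (free_ultrafilter_ge N) => n /hN.
by rewrite sub0r normrN ger0_norm // invr_ge0.
Qed.

(** Compactness gives a cluster point, and an ultrafilter converges to its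
    cluster points. *)
Lemma ultralimit_exists (c : nat -> R) (B : R) : (forall n, `|c n| <= B) ->
  exists l : R, c n @[n --> om] --> l.
Proof.
move=> cB.
have cin : \forall n \near om, `[- B, B]%classic (c n).
  by apply: filterE => n; rewrite /= in_itv /= -ler_norml.
have [l [_ cl]] := @segment_compact R (- B) B (c @ om) _ cin.
exists l => D Dl; have [//|oD] := in_ultra_setVsetC (c @^-1` D) (ultrafilter_ultra omega).
have [|r [/= rD Dr]] := cl (~` D) D _ Dl; first exact: oD.
by case: (rD Dr).
Qed.

Lemma cvg_rc_norm (c : nat -> C) (l : C) :
  complex.Re (c n) @[n --> om] --> complex.Re l ->
  complex.Im (c n) @[n --> om] --> complex.Im l ->
  complex.Re `|c n - l| @[n --> om] --> (0 : R).
Proof.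
move=> cr ci.
apply: (@squeeze_cvgr _ _ _ _ (cst 0) (fun n => `|complex.Re l - complex.Re (c n)| +
    `|complex.Im l - complex.Im (c n)|)).
- apply: filterE => n; apply/andP; split; first exact: Re_ge0.
  rewrite -lecR rcD -Re_ge0E //.
  rewrite [in leLHS](_ : c n - l = (complex.Re (c n) - complex.Re l)%:C +
      'i%C * (complex.Im (c n) - complex.Im l)%:C).
    apply: le_trans (ler_normD _ _) _; rewrite normrM.
    have -> : `|'i%C : C| = 1 by rewrite normc_def /= expr0n expr1n add0r sqrtr1.
    have nrc (r : R) : `|r%:C| = `|r|%:C by rewrite normc_def /= expr0n addr0 sqrtr_sqr.
    by rewrite mul1r !nrc [`|complex.Re l - _|]distrC [`|complex.Im l - _|]distrC.
  clear; case: (c n) l => [a b] [d e]; apply/eqP; rewrite eq_complex /=.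
  by apply/andP; split; apply/eqP; ring.
- exact: cvg_cst.
have -> : (0 : R) = `|complex.Re l - complex.Re l| + `|complex.Im l - complex.Im l|.
  by rewrite !subrr !normr0 addr0.
by apply: cvgD; apply: cvg_norm; apply: cvgB => //; exact: cvg_cst.
Qed.

Lemma complex_ultralimit_exists (c : nat -> C) (B : R) :
  (forall n, sqmod (c n) <= B ^+ 2) -> 0 <= B ->
  exists l : C, complex.Re `|c n - l| @[n --> om] --> (0 : R).
Proof.
move=> cB B0.
have bd (x y : R) : x ^+ 2 + y ^+ 2 <= B ^+ 2 -> `|x| <= B.
  move=> h; rewrite -(@ler_pXn2r _ 2) ?nnegrE //= real_normK ?num_real //.
  by apply: le_trans h; rewrite lerDl sqr_ge0.
have [a ha] := @ultralimit_exists (fun n => complex.Re (c n)) B (fun n => bd _ _ (cB n)).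
have [b hb] : exists l : R, complex.Im (c n) @[n --> om] --> l.
  apply: (@ultralimit_exists _ B) => n.
  by apply: (bd _ (complex.Re (c n))); rewrite addrC; exact: cB.
by exists (a +i* b); exact: cvg_rc_norm.
Qed.

End Ultralimits.

(** * Commutants in the two ultraproducts *)

Section TracialUltraproduct.
Context (R : realType) (omega : free_ultrafilter) (A : nat -> tracialAlgType R).
Local Notation C := R[i].
Local Notation om := (ultrafilter_sets omega).
Local Notation U := (ultraproduct omega A).
Implicit Types (X Y : bounded_seq A).

Lemma up_mulE X Y : upi omega X * upi omega Y = upi omega (X * Y) :> U.
Proof. exact: upiM. Qed.

Lemma up_scaleE (a : C) X : a *: upi omega X = upi omega (a *: X) :> U.
Proof. exact: upiZ. Qed.

Lemma up_oneE : (1 : U) = upi omega 1.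
Proof. by []. Qed.

Lemma up_commute X Y : upi omega X * upi omega Y = upi omega Y * upi omega X :> U <->
  norm2 (X n * Y n - Y n * X n) @[n --> om] --> (0 : R).
Proof. by rewrite !up_mulE; exact: upi_eq. Qed.

Lemma up_scalar X (a : C) : upi omega X = a *: 1 :> U <->
  norm2 (X n - a *: 1) @[n --> om] --> (0 : R).
Proof. by rewrite up_oneE up_scaleE; exact: upi_eq. Qed.

End TracialUltraproduct.

Section Variance.
Context (R : realType) (T : tracialAlgType R).
Local Notation C := R[i].

Lemma ip1 (x : T) : ip x 1 = trace x.
Proof. by rewrite /ip star1 mul1r. Qed.

(** The trace of [x] is its orthogonal projection onto the scalars. *)
Lemma variance (x : T) (a : C) : norm2 (x - a *: 1) ^+ 2 =
  norm2 (x - trace x *: 1) ^+ 2 + sqmod (trace x - a).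
Proof.
have -> : x - a *: 1 = (x - trace x *: 1) + (trace x - a) *: 1.
  by rewrite scalerBl addrA subrK.
have h : ip (x - trace x *: 1) ((trace x - a) *: 1) = 0.
  by rewrite ipZr ip1 traceB traceZ trace1 mulr1 subrr mulr0.
rewrite norm2_pythagoras //; congr (_ + _); apply: complexI.
by rewrite -ipxx ipZl ipZr ip1 trace1 mulr1 -sqmodE.
Qed.

Lemma sqmod_trace_le (x : T) : sqmod (trace x) <= norm2 x ^+ 2.
Proof.
have := variance x 0; rewrite scale0r !subr0 => ->.
by rewrite lerDr sqr_ge0.
Qed.

Lemma proj_variance (p : T) (d : R) (a : C) : 0 < d -> projection p ->
  d <= tr p <= 1 - d -> d <= norm2 (p - a *: 1).
Proof.
move=> d0 pp /andP[h1 h2].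
rewrite -(@ler_pXn2r _ 2) ?nnegrE ?norm2_ge0 ?(ltW d0) //.
have E : norm2 (p - trace p *: 1) ^+ 2 = tr p - tr p ^+ 2.
  have := variance p 0; rewrite scale0r !subr0 -tr_proj // (trace_projE pp) sqmod_rc.
  by rewrite tr_proj // => E; apply/esym/eqP; rewrite subr_eq; apply/eqP.
rewrite variance E; have := sqmod_ge0 (trace p - a).
move: (sqmod _) (tr p) h1 h2 => s t h1 h2 s0; nra.
Qed.

End Variance.

Section MatrixUltraproduct.
Context (R : realType) (omega : free_ultrafilter).
Local Notation C := R[i].
Local Notation om := (ultrafilter_sets omega).
Local Notation Mat := (fun n : nat => 'M[C]_n.+1).
Local Notation U := (ultraproduct omega Mat).

Lemma cvg_sqr (f : nat -> R) : f n @[n --> om] --> (0 : R) ->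
  f n ^+ 2 @[n --> om] --> (0 : R).
Proof. by move=> f0; rewrite -(mulr0 0); apply: cvgM. Qed.

Lemma sqr_le_cvg (f g : nat -> R) : (forall n, 0 <= f n) ->
  (forall n, f n ^+ 2 <= g n) -> g n @[n --> om] --> (0 : R) ->
  f n @[n --> om] --> (0 : R).
Proof.
move=> f0 fg g0; apply/cvgrPdist_lt => e e0.
have e2 : 0 < e ^+ 2 by rewrite exprn_gt0.
move/cvgrPdist_lt : g0 => /(_ _ e2); apply: filterS => n.
rewrite !sub0r !normrN ger0_norm; last by rewrite (le_trans _ (fg n)) ?sqr_ge0.
rewrite ger0_norm // => h.
by rewrite -(@ltr_pXn2r _ 2) ?nnegrE ?(ltW e0) // (le_lt_trans (fg n)).
Qed.

Definition mx_generator (i : 'I_3) n : 'M[C]_n.+1 :=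
  match val i with 0 => clock R n | 1 => chirp R n | _ => fourier R n end.

Lemma mx_generator_bounded i : exists c : R, forall n, anorm (mx_generator i n : Mat n) <= c.
Proof.
exists 1 => n; apply: unitary_anorm_le1; rewrite /mx_generator.
case: (val i) => [|[|_]];
  [exact: clock_unitary|exact: chirp_unitary|exact: fourier_unitary].
Qed.

Definition mx_generator_seq i : bounded_seq Mat := BoundedSeq (mx_generator_bounded i).

(** By the spectral gap, a representative of [x] is close to the scalars
    trace (X n), which are bounded and thus have an ultralimit. *)
Theorem matrix_scalar_commutant (x : U) :
  (forall i, upi omega (mx_generator_seq i) * x = x * upi omega (mx_generator_seq i)) ->
  exists a : C, x = a *: 1.
Proof.
elim/upP: x => X XC.
have c0 i := (iffLR (@up_commute R omega Mat _ _) (XC i)).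
have near : norm2 (X n - trace (X n) *: 1) @[n --> om] --> (0 : R).
  apply: (@sqr_le_cvg _ (fun n => (100 + 24 / cutoff R) *
    (comm_sqr (clock R n) (X n) + comm_sqr (chirp R n) (X n) +
     comm_sqr (fourier R n) (X n)))).
  - by move=> n; exact: norm2_ge0.
  - by move=> n; exact: spectral_gap.
  rewrite -(mulr0 (100 + 24 / cutoff R)); apply: cvgMr.
  have -> : (0 : R) = 0 + 0 + 0 by rewrite !addr0.
  apply: cvgD; [apply: cvgD|].
  - exact: cvg_sqr (c0 (@Ordinal 3 0 isT)).
  - exact: cvg_sqr (c0 (@Ordinal 3 1 isT)).
  - exact: cvg_sqr (c0 (@Ordinal 3 2 isT)).
have [B hB] := bseqP X.
have B0 : 0 <= B by apply: le_trans (hB 0%N); exact: anorm_ge0.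
have [n|l hl] := @complex_ultralimit_exists R omega (fun n => trace (X n)) B _ B0.
  apply: le_trans (sqmod_trace_le _) _; rewrite lerXn2r ?nnegrE ?norm2_ge0 //.
  apply: le_trans (hB n); have := norm2M_le (X n) 1.
  by rewrite mulr1 norm2_1 mulr1.
exists l; apply/up_scalar.
apply: (@sqr_le_cvg _ (fun n => norm2 (X n - trace (X n) *: 1) ^+ 2 +
  complex.Re `|trace (X n) - l| ^+ 2)).
- by move=> n; exact: norm2_ge0.
- move=> n; rewrite variance lerD2l -lecR sqmod_norm rcX -Re_ge0E //.
by rewrite -(addr0 0); apply: cvgD; exact: cvg_sqr.
Qed.

End MatrixUltraproduct.

Section HyperfiniteUltrapower.
Context (R : realType) (omega : free_ultrafilter).
Context (H : hilbertSpace R) (M : vonNeumannAlgebra H).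
Context (tau : faithful_normal_tracial_state M).
Local Notation C := R[i].
Local Notation om := (ultrafilter_sets omega).
Local Notation U := (ultraproduct omega (fun _ : nat => vn_algebra tau)).

Theorem hyperfinite_nonscalar_commutant (m : nat) (x : 'I_m -> U) :
  is_hyperfinite M -> ~ finite_dimensional (vn_ops M) ->
  exists z : U, (forall i, x i * z = z * x i) /\ forall a : C, z <> a *: 1.
Proof.
move=> [A [A1 A2 A3]] inf.
have [d d0 hd] := @property_gamma R H M tau A (fun k => (A1 k).1)
  (fun k => (A1 k).2) A2 A3 inf.
have /choice[X hX] i : exists X : bounded_seq (fun _ : nat => vn_algebra tau),
    upi omega X = x i by exists (repr (x i)); exact: upi_repr.
have inv_gt0 n : 0 < (n.+1%:R : R)^-1 by rewrite invr_gt0 ltr0n.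
have /choice[z hz] n := hd m (fun i => X i n) _ (inv_gt0 n).
have zb : exists c : R, forall n, anorm (z n) <= c.
  by exists 1 => n; case: (hz n).
pose Z : bounded_seq (fun _ : nat => vn_algebra tau) := BoundedSeq zb.
exists (upi omega Z); split=> [i|a].
  rewrite -hX; apply/up_commute.
  apply: (@squeeze_cvgr _ _ _ _ (cst 0) (fun n => n.+1%:R^-1)).
  - apply: filterE => n; rewrite norm2_ge0 /=.
    by case: (hz n) => _ _ _; exact.
  - exact: cvg_cst.
  - exact: cvg_inv_omega.
move/up_scalar/cvgrPdist_lt/(_ _ d0)/filter_ex => [n].
rewrite sub0r normrN ger0_norm ?norm2_ge0 //.
case: (hz n) => pz _ tz _; rewrite ltNge => /negP; apply.
exact: proj_variance.
Qed.

End HyperfiniteUltrapower.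

Theorem theorem4p3 (R : realType) (omega : free_ultrafilter)
    (H : hilbertSpace R) (M : vonNeumannAlgebra H)
    (tau : faithful_normal_tracial_state M) :
  is_II1_factor M -> is_hyperfinite M ->
  ~ star_isomorphic (ultraproduct omega (fun n : nat => 'M[R[i]]_n.+1))
                    (ultraproduct omega (fun _ : nat => vn_algebra tau)).
Proof.
move=> [_ inf _] hyp [f [fbij _]].
have [z [zC zns]] := hyperfinite_nonscalar_commutant
  (fun i => f (upi omega (mx_generator_seq R i))) hyp inf.
have [g gf fg] := fbij.
have [a ga] : exists a : R[i], g z = a *: 1.
  apply: matrix_scalar_commutant => i; apply: (can_inj gf).
  by rewrite !rmorphM /= fg zC.
by apply: (zns a); rewrite -[z]fg ga linearZ /= rmorph1.
Qed.
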